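(* Fix $\beta\in(1/2,1)$ and $r\in(\rho^*(\beta),1)$. Let $b_n=n^{\beta}/3$ (rounded to an integer), let $\delta_n$ be a positive sequence tending to zero as $n\to\infty$, and let $a>0$ be a constant. Apply standard higher criticism to $U_nX$ and reject $H_0$ if and only if the resulting score exceeds $(1+a)\sqrt{2\log\log n}$. Then, uniformly in all sequences $\Sigma_n$ with $\Sigma_n\in\tilde\Theta_n^*(\delta_n,b_n)$, $$P_{H_0}\{\text{Reject }H_0\}+P_{H_1^{(n)}}\{\text{Accept }H_0\}\to 0,\qquad n\to\infty .$$
   Context: Model: for each $n$, one observes the $n$-vector $X=\mu+Z$ with $Z\sim \mathrm{N}(0,\Sigma_n)$. Let $m=n^{1-\beta}$ (rounded to an integer), $A_n=\sqrt{2r\log n}$. Under $H_0$, $\mu=0$. Under $H_1^{(n)}$, $\mu$ is random, independent of $Z$: locations $\ell_1<\dots<\ell_m$ are drawn from $\{1,\dots,n\}$ without replacement (every $m$-subset having probability $\binom{n}{m}^{-1}$), $\mu_j=A_n$ if $j\in\{\ell_1,\dots,\ell_m\}$ and $\mu_j=0$ otherwise. Define $\rho^*(\beta)=\beta-1/2$ for $1/2<\beta\le 3/4$ and $\rho^*(\beta)=(1-\sqrt{1-\beta})^2$ for $3/4<\beta<1$. For a positive definite matrix $\Sigma_n$, $U_n$ denotes the inverse of its Cholesky factor, i.e. the unique lower triangular matrix with positive diagonal entries such that $U_n\Sigma_nU_n'=I_n$. Let $\Theta_n$ be the set of (positive definite) $n\times n$ correlation matrices and $$\tilde\Theta_n^*(\delta_n,b_n)=\Bigl\{\Sigma_n\in\Theta_n:\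 \sum_{j=1}^{k-b_n}|U_n(k,j)|\le\delta_n\ \text{ for all } b_n+1\le k\le n\Bigr\}.$$ Standard higher criticism applied to a vector $Y\in\mathbb{R}^n$: let $p_j=P\{|\mathrm{N}(0,1)|\ge|Y_j|\}$, let $p_{(1)}\le\dots\le p_{(n)}$ be the sorted values, and the score is $$\max_{j:\,1/n\le p_{(j)}\le 1/2}\frac{\sqrt n\,(j/n-p_{(j)})}{\sqrt{p_{(j)}(1-p_{(j)})}} .$$ ''Uniformly'' means that the supremum over $\Sigma_n\in\tilde\Theta_n^*(\delta_n,b_n)$ of the sum of the two error probabilities tends to $0$. *)

(* Defs.v *)
From HB Require Import structures.
From mathcomp Require Import all_boot all_order all_algebra.
From mathcomp Require Import all_classical all_reals all_analysis.

Set Implicit Arguments.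
Unset Strict Implicit.
Unset Printing Implicit Defensive.

Import Order.TTheory GRing.Theory Num.Theory.
Import numFieldNormedType.Exports.

Local Open Scope classical_set_scope.
Local Open Scope ring_scope.

Section Calibration.
Context {R : realType}.

(* [k] is [x] rounded to an integer, by any rounding rule (down, up, nearest). *)
Definition rounds (x : R) (k : nat) : Prop := `|x - k%:R| < 1.

Definition rho_star (beta : R) : R :=
  if beta <= 3 / 4 then beta - 1 / 2 else (1 - Num.sqrt (1 - beta)) ^+ 2.

Definition amplitude (r : R) (n : nat) : R := Num.sqrt (2 * r * ln n%:R).

End Calibration.

Section Covariance.
Context {R : realType}.

Definition pos_def n (S : 'M[R]_n) : Prop :=
  S^T = S /\ forall v : 'cV[R]_n, v != 0 -> 0 < (v^T *m S *m v) 0 0.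

Definition correlation_mx n (S : 'M[R]_n) : Prop :=
  pos_def S /\ forall i, S i i = 1.

(* [is_trig_mx] is lower triangularity. *)
Definition is_inv_cholesky n (S U : 'M[R]_n) : Prop :=
  [/\ is_trig_mx U, forall i, 0 < U i i & U *m S *m U^T = 1%:M].

(* The unique such matrix when [S] is positive definite; the default value 0
   is reached only when there is none. *)
Definition inv_cholesky n (S : 'M[R]_n) : 'M[R]_n :=
  xget 0 [set U | is_inv_cholesky S U].

(* With 1-based row [k + 1] and column [j + 1], the conditions
   [b + 1 <= k + 1] and [j + 1 <= (k + 1) - b] are [b <= k] and [j + b <= k]. *)
Definition Theta_star n (delta : R) (b : nat) : set 'M[R]_n :=
  [set S | correlation_mx S /\
    forall k : 'I_n, (b <= k)%N ->
      \sum_(j < n | (j + b <= k)%N) `|inv_cholesky S k j| <= delta].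

End Covariance.

Section Model.
Context {R : realType} {d : measure_display} {T : measurableType d}.
Variable P : probability T R.

Definition iid_std_normal n (W : 'I_n -> {RV P >-> R}) : Prop :=
  (forall i (B : set R), measurable B ->
     distribution P (W i) B = normal_prob 0 1 B) /\
  (forall B : 'I_n -> set R, (forall i, measurable (B i)) ->
     P [set t | forall i, B i (W i t)] = (\prod_(i < n) P (W i @^-1` B i))%E).

(* Z ~ N(0, S): Z is a linear image A W of a standard Gaussian vector W, with
   A A' = S. For invertible S the matrix A can be taken square and W lives on
   the same probability space as Z, since W = A^-1 Z. *)
Definition centered_gaussian n (S : 'M[R]_n) (Z : T -> 'cV[R]_n) : Prop :=
  exists (A : 'M[R]_n) (W : 'I_n -> {RV P >-> R}),
    [/\ iid_std_normal W, A *m A^T = S & forall t, Z t = A *m \col_i W i t].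

(* Mean vector equal to [A] on a uniformly drawn [m]-subset of the coordinates,
   and to 0 elsewhere. *)
Definition sparse_signal n (m : nat) (A : R) (mu : T -> 'cV[R]_n) : Prop :=
  exists L : T -> {set 'I_n},
    [/\ forall s, measurable [set t | L t = s],
        forall t, #|L t| = m,
        forall s : {set 'I_n}, #|s| = m ->
          P [set t | L t = s] = (('C(n, m))%:R^-1)%:E &
        forall t, mu t = \col_j (if j \in L t then A else 0)].

Definition sigma_of n (X : T -> 'cV[R]_n) : set (set T) :=
  g_sigma_preimage (fun i t => X t i 0).

Definition independent_vectors n (X Y : T -> 'cV[R]_n) : Prop :=
  forall E F : set T, sigma_of X E -> sigma_of Y F ->
    P (E `&` F) = (P E * P F)%E.

End Model.

Section HigherCriticism.
Context {R : realType}.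

Definition p_value (y : R) : R :=
  fine (normal_prob 0 1 [set x : R | `|y| <= `|x|]).

Definition sorted_p_values n (Y : 'cV[R]_n) : seq R :=
  sort <=%R [seq p_value (Y i 0) | i <- enum 'I_n].

(* The entry of (0-based) index [j] of [sorted_p_values Y] is p_(j+1). The
   maximum over an empty range is -oo. *)
Definition hc_score n (Y : 'cV[R]_n) : \bar R :=
  let p := sorted_p_values Y in
  \big[maxe/-oo%E]_(j < n | n%:R^-1 <= p`_j <= 1 / 2)
     (Num.sqrt n%:R * (j.+1%:R / n%:R - p`_j)
        / Num.sqrt (p`_j * (1 - p`_j)))%:E.

Definition hc_rejects (a : R) n (Y : 'cV[R]_n) : Prop :=
  (((1 + a) * Num.sqrt (2 * ln (ln n%:R)))%:E < hc_score Y)%E.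

End HigherCriticism.

(* Main.v *)
From HB Require Import structures.
Require Import Defs.
From mathcomp Require Import all_boot all_order all_algebra.
From mathcomp Require Import all_classical all_reals all_analysis.
From mathcomp Require Import measurable_realfun.
From mathcomp Require Import ring lra zify.

Set Implicit Arguments.
Unset Strict Implicit.
Unset Printing Implicit Defensive.

Import Order.TTheory GRing.Theory Num.Theory.
Import numFieldNormedType.Exports.

Local Open Scope classical_set_scope.
Local Open Scope ring_scope.

(** Write [Y = U (mu + Z)] with [U] the inverse Cholesky factor of [S].  Since
    [Z = A W] with [W] white noise and [A A' = S], the matrix [U A] is orthogonal,
    so [U Z] is again white noise ([whitened_std_gaussian]) and [Y] is white noise
    shifted by the vector [nu = U mu].

    With [N(x)] the number of p-values at most [x], the score exceeds [c] exactly
    when some p-value [p] in [1/n, 1/2] has [N(p) - n p > c sqrt(n p (1 - p))]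
    ([hc_rejectsP]).

    Null hypothesis.  The p-values are independent and uniform, and [N(x) / x] is
    a reverse martingale, so the probability that [N(x) >= (1 + e) n x] for some
    [x >= s] obeys the same exponential bound as for [x = s] alone
    ([maximal_relative], [p_value_maximal]).  On a block [s, u] of levels this
    bounds the probability of an exceedance of [c] by about
    [exp(- (s / u) (1 - u) c^2 / (2 + c / sqrt(n s)))].  The threshold satisfies
    [c^2 = 2 (1 + a)^2 ln ln n].  Between [c^4 / n] and a small constant the levels
    are covered by O(log n) blocks of fixed ratio close to 1, each of probability
    at most [(log n)^-(1 + a)]; below [c^4 / n], nine blocks of ratio [sqrt c] suffice;
    above the constant a single block does ([null_hc]).

    Alternative.  Fix the support [s] of [mu] and write [A] for the amplitude.
    Unit variances force the diagonal of [U] to be at least 1, and the row sums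
    away from the diagonal are at most [delta].  Hence [nu_j >= A (1 - delta)] at
    every clean signal [j], that is, one with no other signal among the [b - 1]
    positions before it, and [|nu_k| <= A delta] at every quiet position [k], one
    with no signal in its window of length [b].  As [m b] is about [n / 3], a
    positive fraction of the positions is quiet, and a second moment computation
    for the number of close pairs of signals shows that at least half of the
    signals are clean, up to an event of probability O(1 / m)
    ([many_close_pairs_rare]).  The values of [nu] elsewhere are arbitrary but
    harmless: a shift can only increase the two-sided tails of a Gaussian
    ([gauss_pr_shift_abs_ge]).

    Put [kappa = sqrt r] and count the entries beyond [t = sigma sqrt(2 ln n)],
    with [kappa < sigma < 1].  The clean signals raise the expected count above
    its null value [n p0] by about [n^(1 - beta - (sigma - kappa)^2)], while
    [sqrt(n p0)] is about [n^((1 - sigma^2) / 2)].  The excess wins by a power of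
    [n] when [1/2 - beta + 2 sigma kappa - kappa^2 - sigma^2 / 2 > 0], and such a
    [sigma] exists exactly above the detection boundary ([detectable_level]).  A
    Chernoff bound makes the count itself large; to get an exceedance at an
    actual p-value in the allowed range, one also needs some entry of modulus
    between [t] and [t + 1], and the quiet positions provide it
    ([shifted_accept]).  Averaging over the support, which is independent of the
    noise, ends the proof ([mixture_error]).  All bounds depend on [S] only through
    membership in the class, whence uniformity; the class contains the identity as
    soon as [b > 0], so that the supremum is not over an empty set. *)

(** * A maximal inequality for empirical counts *)

Section FiniteProducts.
Context {R : realType}.

(** Only the total mass of [w * phi] on the cells in [low] matters when the event
    [A] does not distinguish them: collapsing these cells to one point turns both
    sides into products of one-coordinate sums, where the hypothesis applies.
    This is the conditioning step of the maximal inequality below. *)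
Lemma ler_sum_prod_collapse (I C : finType) (w phi psi : C -> R) (low : pred C)
    (A : pred {ffun I -> C}) :
  (forall x, 0 <= w x) -> (forall x, 0 <= psi x) ->
  (forall x, ~~ low x -> phi x = psi x) ->
  \sum_(x | low x) w x * psi x <= \sum_(x | low x) w x * phi x ->
  (forall f g : {ffun I -> C},
     (forall k, f k = g k \/ low (f k) /\ low (g k)) -> A f = A g) ->
  \sum_(f | A f) \prod_k (w (f k) * psi (f k)) <=
  \sum_(f | A f) \prod_k (w (f k) * phi (f k)).
Proof.
move=> w0 psi0 phipsi lowle Ainv.
pose h x := if low x then None else Some x.
pose H (f : {ffun I -> C}) : {ffun I -> option C} := [ffun k => h (f k)].
rewrite (partition_big H predT)//= [leRHS](partition_big H predT)//=.
apply: ler_sum => g _.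
have hh x y : h x = h y -> x = y \/ low x /\ low y.
  by rewrite /h; case: ifP; case: ifP => // _ _; [right|case; left].
case: (pickP (fun f => A f && (H f == g))) => [f0 /andP[Af0 /eqP Hf0]|A0]; last first.
  by rewrite !big_pred0.
have AE f : (A f && (H f == g)) = (H f == g).
  case: eqP => [Hf|]; last by rewrite andbF.
  rewrite andbT (Ainv f f0)// => k; apply: hh.
  by move: Hf Hf0 => <- /ffunP/(_ k); rewrite !ffunE => ->.
have fam (F : C -> R) : \sum_(f | A f && (H f == g)) \prod_k F (f k) =
    \prod_k \sum_(x | h x == g k) F x.
  rewrite (bigA_distr_big_dep _ (fun k x => F x)).
  apply: eq_bigl => f; rewrite AE; apply/eqP/familyP => [<- k|Hf].
    by rewrite unfold_in/= ffunE eqxx.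
  by apply/ffunP => k; rewrite ffunE; have := Hf k; rewrite unfold_in/= => /eqP.
rewrite (fam (fun x => w x * psi x)) (fam (fun x => w x * phi x)).
apply: ler_prod => k _; rewrite sumr_ge0 /=; last by move=> *; rewrite mulr_ge0.
case: (g k) => [x|]; last first.
  have E x : (h x == None) = low x by rewrite /h; case: ifP.
  by rewrite !(eq_bigl _ _ E).
apply: ler_sum => z; rewrite /h; case: ifP => // lz _.
by rewrite phipsi ?lz.
Qed.

(** Jensen's inequality for a variable with values 0 and [lambda]. *)
Lemma expR_secant (rho lambda : R) : 0 <= rho <= 1 ->
  expR (lambda * rho) <= 1 + rho * (expR lambda - 1).
Proof.
move=> /andP[r0 r1].
have h1 := expR_ge1Dx (- (lambda * rho)).
have h2 := expR_ge1Dx (lambda * (1 - rho)).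
have e1 : expR lambda = expR (lambda * rho) * expR (lambda * (1 - rho)).
  by rewrite -expRD; congr expR; ring.
have e2 : expR (lambda * rho) * expR (- (lambda * rho)) = 1.
  by rewrite -expRD subrr expR0.
have p := expR_gt0 (lambda * rho).
rewrite e1; set a := expR (lambda * rho) in e1 e2 p *.
set b := expR (- _) in h1 e2; set c := expR (lambda * (1 - rho)) in h2 e1 *.
have : a * 1 <= a * ((1 - rho) * b + rho * c).
  rewrite ler_pM2l//.
  have : (1 - rho) * (1 - lambda * rho) <= (1 - rho) * b by rewrite ler_wpM2l// subr_ge0.
  have : rho * (1 + lambda * (1 - rho)) <= rho * c by rewrite ler_wpM2l.
  by nra.
rewrite mulr1 mulrDr mulrCA e2; nra.
Qed.

Section Maximal.
Variables (n M : nat) (w : 'I_M.+1 -> R).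
Hypothesis w_ge0 : forall i, 0 <= w i.
Hypothesis w0_gt0 : 0 < w ord0.
Hypothesis w_sum1 : \sum_i w i = 1.

Definition cumul i := \sum_(x < M.+1 | (x <= i)%N) w x.
Definition ncumul (f : {ffun 'I_n -> 'I_M.+1}) i := #|[set k | (f k <= i)%N]%SET|.

Lemma cumul_ge i : w ord0 <= cumul i.
Proof. by rewrite /cumul (bigD1 ord0)//= lerDl sumr_ge0. Qed.

Lemma prod_expR_count (f : {ffun 'I_n -> 'I_M.+1}) (i : nat) (u : R) :
  \prod_k (if (f k <= i)%N then expR u else 1) = expR (u * (ncumul f i)%:R).
Proof.
rewrite -big_mkcond/= prodr_const [in RHS]mulrC expRM_natl.
by congr (_ ^+ _); apply: eq_card => k; rewrite inE.
Qed.

(** Doob's inequality for the reverse martingale [ncumul f i / cumul i], in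
    exponential form.  Decompose according to the largest [i] at which the
    count is high.  This event does not distinguish the cells up to [i]; given
    the number [ncumul f i] of points in them, each of these points falls
    into cell 0 with probability [w 0 / cumul i], and Jensen's inequality bounds
    the exponential moment of the count in cell 0 from below. *)
Lemma maximal_cumul (c lambda : R) : 0 <= lambda ->
  expR (lambda * (c * w ord0)) *
    \sum_(f : {ffun 'I_n -> 'I_M.+1} |
        [exists i : 'I_M.+1, c * cumul i <= (ncumul f i)%:R])
      \prod_k w (f k)
  <= expR (n%:R * (w ord0 * (expR lambda - 1))).
Proof.
move=> l0.
pose hit i (f : {ffun 'I_n -> 'I_M.+1}) := c * cumul i <= (ncumul f i)%:R.
(* [i] is the last hit, which comes first in reverse time *)
pose A i f := hit i f && [forall j : 'I_M.+1, (i < j)%N ==> ~~ hit j f].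
pose y0 (x : 'I_M.+1) : R := if (x <= 0)%N then expR lambda else 1.
have y00 x : 0 <= y0 x by rewrite /y0; case: ifP.
have step i : expR (lambda * (c * w ord0)) * \sum_(f | A i f) \prod_k w (f k) <=
   \sum_(f | A i f) \prod_k (w (f k) * y0 (f k)).
  have Ti0 : 0 < cumul i by apply: lt_le_trans w0_gt0 (cumul_ge i).
  pose y1 (x : 'I_M.+1) : R := if (x <= i)%N then expR (lambda * (w ord0 / cumul i)) else 1.
  have y10 x : 0 <= y1 x by rewrite /y1; case: ifP.
  apply: (@le_trans _ _ (\sum_(f | A i f) \prod_k (w (f k) * y1 (f k)))).
    rewrite mulr_sumr; apply: ler_sum => f /andP[hif _].
    rewrite big_split/= mulrC ler_wpM2l ?prodr_ge0//.
    rewrite (prod_expR_count f i) ler_expR -mulrA ler_wpM2l//.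
    by rewrite mulrC -[leRHS]mulrA ler_wpM2l// mulrC ler_pdivlMr.
  apply: (@ler_sum_prod_collapse _ _ _ _ _ (fun x : 'I_M.+1 => (x <= i)%N)) => //.
  - by move=> x xi; rewrite /y1 /y0 (negbTE xi) ifF//; move: xi; case: (x : nat).
  - have -> : \sum_(x < M.+1 | (x <= i)%N) w x * y1 x =
        cumul i * expR (lambda * (w ord0 / cumul i)).
      by rewrite mulr_suml; apply: eq_bigr => x xi; rewrite /y1 xi.
    have -> : \sum_(x < M.+1 | (x <= i)%N) w x * y0 x =
        cumul i * (1 + w ord0 / cumul i * (expR lambda - 1)).
      rewrite mulrDr mulr1 mulrA [_ * (_ / _)]mulrC divfK ?gt_eqF//.
      rewrite /cumul (bigD1 ord0)//= [in RHS](bigD1 ord0)//= /y0/=.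
      rewrite (eq_bigr w); last first.
        by move=> x /andP[_]; rewrite -val_eqE/= -lt0n ltnNge => /negbTE->; rewrite mulr1.
      ring.
    apply: ler_wpM2l; first exact: ltW.
    apply: expR_secant; rewrite divr_ge0//=; last exact: ltW.
    by rewrite ler_pdivrMr// mul1r cumul_ge.
  - move=> f g fg.
    have nE j : (i <= j)%N -> ncumul f j = ncumul g j.
      move=> ij; apply: eq_card => k; rewrite !inE.
      case: (fg k) => [->//|[fi gi]].
      by rewrite (leq_trans fi ij) (leq_trans gi ij).
    have hE j : (i <= j)%N -> hit j f = hit j g by move=> ij; rewrite /hit nE.
    rewrite /A hE//; congr (_ && _); apply: eq_forallb => j.
    by case: ltnP => //= ij; rewrite hE// ltnW.
pose B f := [exists i : 'I_M.+1, hit i f].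
have BE f : B f -> exists i : 'I_M.+1, A i f.
  move=> /existsP[i0 hi0].
  case: (@arg_maxnP _ i0 (fun i => hit i f) (fun i : 'I_M.+1 => i : nat) hi0) => i hi imax.
  exists i; rewrite /A hi/=; apply/forallP => j; apply/implyP => ij.
  by apply/negP => /imax; rewrite /geq/= leqNgt ij.
apply: (@le_trans _ _ (\sum_(f : {ffun 'I_n -> 'I_M.+1}) \prod_k (w (f k) * y0 (f k)))); last first.
  rewrite -(bigA_distr_bigA (fun (k : 'I_n) x => w x * y0 x)) prodr_const card_ord.
  rewrite expRM_natl lerXn2r// ?nnegrE ?sumr_ge0//.
    by move=> *; rewrite mulr_ge0.
  apply: le_trans (expR_ge1Dx _); rewrite -{1}w_sum1 (bigD1 ord0)//= [in leRHS](bigD1 ord0)//=.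
  rewrite /y0/= (eq_bigr w).
    lra.
  by move=> x; rewrite -val_eqE/= -lt0n ltnNge => /negbTE->; rewrite mulr1.
apply: (@le_trans _ _ (\sum_(i < M.+1) \sum_(f : {ffun 'I_n -> 'I_M.+1} | A i f) \prod_k (w (f k) * y0 (f k)))).
  apply: le_trans; last by apply: ler_sum => i _; exact: step.
  rewrite -mulr_sumr ler_wpM2l ?expR_ge0//.
  under [leRHS]eq_bigr do rewrite big_mkcond.
  rewrite exchange_big/= big_mkcond/=; apply: ler_sum => f _.
  have P0 : 0 <= \prod_k w (f k) by apply: prodr_ge0.
  case: ifP => [/BE[i Ai]|_]; last by apply: sumr_ge0 => i _; case: ifP.
  by rewrite (bigD1 i)//= Ai lerDl sumr_ge0// => j _; case: ifP.
under eq_bigr do rewrite big_mkcond.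
rewrite exchange_big/=; apply: ler_sum => f _.
have P0 : 0 <= \prod_k (w (f k) * y0 (f k)) by apply: prodr_ge0 => k _; rewrite mulr_ge0.
case: (pickP (fun i : 'I_M.+1 => A i f)) => [i Ai|A0]; last first.
  by rewrite big1// => i _; rewrite A0.
rewrite (bigD1 i)//= Ai [X in _ + X]big1 ?addr0// => j ji; case: ifP => // Aj; exfalso.
move: Ai Aj => /andP[hi /forallP Hi] /andP[hj /forallP Hj].
have := Hi j; have := Hj i; rewrite hi hj/= !implybF -!leqNgt => ij' ji'.
by move: ji; rewrite -val_eqE/= eqn_leq ij' ji'.
Qed.

End Maximal.

Lemma expRN_le_quadratic (x : R) : 0 <= x -> expR (- x) <= 1 - x + x ^+ 2.
Proof.
move=> x0; rewrite expRN; have h := expR_ge1Dx x.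
rewrite invf_ple ?posrE ?expR_gt0//; last by nra.
apply: le_trans h; have p : 0 < 1 - x + x ^+ 2 by nra.
rewrite -[leLHS]mul1r ler_pdivrMr//.
suff : (1 + x) * (1 - x + x ^+ 2) = 1 + x ^+ 3 by move=> ->; rewrite lerDl exprn_ge0.
ring.
Qed.

(** Chernoff's bound, with the exponent [l = (Q - y) / (2 Q)] and
    [exp(- l) <= 1 - l + l^2]. *)
Lemma bernoulli_lower_tail n (q : 'I_n -> R) (y : R) (Q := \sum_k q k) :
  (forall k, 0 <= q k <= 1) -> 0 < Q -> y <= Q ->
  \sum_(f : {ffun 'I_n -> bool} | (#|[set k | f k]%SET|)%:R <= y)
     \prod_k (if f k then q k else 1 - q k)
  <= expR (- ((Q - y) ^+ 2 / (4 * Q))).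
Proof.
move=> q01 Q0 yQ; pose l := (Q - y) / (2 * Q).
have l0 : 0 <= l by rewrite divr_ge0 ?subr_ge0// mulr_ge0// ltW.
pose v k (b : bool) := if b then q k * expR (- l) else 1 - q k.
apply: (@le_trans _ _ (expR (l * y) * \sum_(f : {ffun 'I_n -> bool}) \prod_k v k (f k))).
  rewrite mulr_sumr big_mkcond/=; apply: ler_sum => f _.
  have V0 : 0 <= \prod_k v k (f k).
    apply: prodr_ge0 => k _; rewrite /v; have /andP[? ?] := q01 k.
    by case: ifP => _; [rewrite mulr_ge0 ?expR_ge0|rewrite subr_ge0].
  case: ifP => fy; last by rewrite mulr_ge0 ?expR_ge0.
  have -> : \prod_k v k (f k) =
    \prod_k (if f k then q k else 1 - q k) * expR (- l * (#|[set k | f k]%SET|)%:R).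
    transitivity (\prod_k ((if f k then q k else 1 - q k) * (if f k then expR (- l) else 1))).
      by apply: eq_bigr => k _; rewrite /v; case: ifP; rewrite ?mulr1.
    rewrite big_split/=; congr (_ * _).
    rewrite -big_mkcond/= prodr_const [in RHS]mulrC expRM_natl.
    by congr (_ ^+ _); apply: eq_card => k; rewrite inE.
  rewrite mulrCA ler_peMr//.
    apply: prodr_ge0 => k _; have /andP[? ?] := q01 k; case: ifP => // _.
    by rewrite subr_ge0.
  by rewrite -expRD -[leLHS]expR0 ler_expR mulNr subr_ge0 ler_wpM2l.
rewrite -(bigA_distr_bigA v)/=.
apply: (@le_trans _ _ (expR (l * y) * \prod_k expR (q k * (l ^+ 2 - l)))).
  rewrite ler_wpM2l ?expR_ge0//; apply: ler_prod => k _.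
  have /andP[q0 q1] := q01 k; rewrite big_bool/= /v.
  rewrite addr_ge0 ?mulr_ge0 ?expR_ge0 ?subr_ge0//=.
  apply: le_trans (expR_ge1Dx _); have := expRN_le_quadratic l0 => h.
  have : q k * expR (- l) <= q k * (1 - l + l ^+ 2) by rewrite ler_wpM2l.
  lra.
rewrite -expR_sum -expRD ler_expR -mulr_suml -/Q /l le_eqVlt; apply/orP; left; apply/eqP.
field; lra.
Qed.

End FiniteProducts.

Section ExpPade.
Context {R : realType}.

(** The function [2 + x - exp(x) (2 - x)] vanishes at 0 and its derivative
    [1 - exp(x) (1 - x)] is nonnegative. *)
Lemma expR_pade (x : R) : 0 <= x -> expR x * (2 - x) <= 2 + x.
Proof.
move=> x0; pose f (y : R) : R := 2 + y - expR y * (2 - y).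
pose df (y : R) : R := 1 - expR y * (1 - y).
have fd (y : R) : is_derive y 1 f (df y).
  apply: is_derive_eq; rewrite /df /GRing.scale/=; ring.
have [c] := @MVT_segment R f df 0 x x0 (fun y _ => fd y)
   (@derivable_within_continuous _ _ _ _ (fun y _ => @ex_derive _ _ _ _ _ _ _ (fd y))).
rewrite in_itv/= => /andP[c0 _].
have dfc : 0 <= df c.
  rewrite /df subr_ge0; have := expR_ge1Dx (- c) => h.
  have : expR c * (1 - c) <= expR c * expR (- c) by rewrite ler_wpM2l ?expR_ge0.
  by rewrite expRxMexpNx_1.
rewrite subr0 => E.
have : 0 <= f x - f 0 by rewrite E mulr_ge0.
by rewrite /f expR0; lra.
Qed.

(** The exponent [l = 2 e / (2 + e)] makes [exp l <= 1 + e] by the Pade bound and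
    gives the Bernstein rate [e^2 / (2 + e)] without logarithms. *)
Lemma maximal_relative n M (w : 'I_M.+1 -> R) (e : R) :
  (forall i, 0 <= w i) -> 0 < w ord0 -> \sum_i w i = 1 -> 0 <= e ->
  \sum_(f : {ffun 'I_n -> 'I_M.+1} |
      [exists i : 'I_M.+1, n%:R * (1 + e) * cumul w i <= (ncumul f i)%:R])
    \prod_k w (f k)
  <= expR (- (n%:R * w ord0 * (e ^+ 2 / (2 + e)))).
Proof.
move=> w0 w00 w1 e0; pose l := 2 * e / (2 + e).
have e2 : 0 < 2 + e by lra.
have l0 : 0 <= l by rewrite divr_ge0 ?mulr_ge0// ltW.
have el : expR l <= 1 + e.
  have l2 : 2 - l = 4 / (2 + e) by rewrite /l; field; lra.
  have := expR_pade l0; rewrite l2 (_ : 2 + l = (1 + e) * (4 / (2 + e))).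
    by rewrite ler_pM2r ?divr_gt0.
  by rewrite /l; field; lra.
have := @maximal_cumul _ n M w w0 w00 w1 (n%:R * (1 + e)) l l0.
rewrite -ler_pdivlMl ?expR_gt0// => /le_trans; apply.
rewrite -expRN -expRD ler_expR.
set N := n%:R; have N0 : 0 <= N by rewrite /N.
set W := w ord0 in w00 *.
have : N * W * (expR l - 1) <= N * W * e by apply: ler_wpM2l; [rewrite mulr_ge0// ltW|lra].
have -> : e ^+ 2 / (2 + e) = l * (1 + e) - e by rewrite /l; field; lra.
lra.
Qed.
End ExpPade.

(** * Inverse Cholesky factors *)

Section Cholesky.
Context {R : realType}.

(** Block elimination: the Schur complement of the upper left entry is again
    positive definite, and its inverse Cholesky factor extends by one row. *)
Lemma inv_cholesky_exists n (S : 'M[R]_n) : pos_def S -> exists U, is_inv_cholesky S U.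
Proof.
elim: n S => [S _|n IH S [Ssym Spos]].
  exists 0; split; last by rewrite [LHS]flatmx0 [RHS]flatmx0.
    by apply/is_trig_mxP => -[].
  by case.
pose S1 : 'M[R]_(1 + n) := S.
pose sg := S 0 0; pose s := dlsubmx S1; pose S2 := drsubmx S1.
have sym1 : S1^T = S1 by [].
have urE : ursubmx S1 = s^T by rewrite /s trmx_dlsub sym1.
have S2sym : S2^T = S2 by rewrite /S2 trmx_drsub sym1.
have ulE : ulsubmx S1 = sg%:M.
  rewrite [LHS]mx11_scalar /sg !mxE; congr (_%:M); congr (S _ _); exact: val_inj.
have S1E : S1 = block_mx sg%:M s^T s S2 by rewrite -ulE -urE submxK.
have sg0 : 0 < sg.
  have e0 : (delta_mx 0 0 : 'cV[R]_n.+1) != 0.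
    by apply/eqP => /matrixP/(_ 0 0)/eqP; rewrite !mxE !eqxx oner_eq0.
  by have := Spos _ e0; rewrite trmx_delta -rowE -colE !mxE.
pose S' := S2 - sg^-1 *: (s *m s^T).
have pS' : pos_def S'.
  split.
    by rewrite /S' linearB/= linearZ/= trmx_mul trmxK S2sym.
  move=> v v0; pose w : 'cV[R]_(1 + n) := col_mx (- sg^-1 *: (s^T *m v)) v.
  have w0 : w != 0.
    by apply: contraNneq v0 => /(congr1 dsubmx); rewrite /w col_mxKd linear0 => ->.
  have := Spos w w0.
  have -> : w^T *m S *m w = v^T *m S' *m v; last by [].
  have Sw : S1 *m w = col_mx 0 (S' *m v).
    rewrite S1E /w mul_block_col mul_scalar_mx scalerA mulrN divff ?gt_eqF//.
    rewrite scaleN1r addNr; congr col_mx.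
    by rewrite -scalemxAr mulmxA /S' mulmxBl scaleNr -scalemxAl addrC.
  by rewrite -mulmxA [S *m w]Sw /w tr_col_mx mul_row_col mulmx0 add0r mulmxA.
have [U' [U't U'p U'S]] := IH _ pS'.
pose c := (Num.sqrt sg)^-1.
have c0 : 0 < c by rewrite invr_gt0 sqrtr_gt0.
have cc : c * c * sg = 1.
  by rewrite /c -invfM -expr2 sqr_sqrtr ?ltW// mulVf// gt_eqF.
pose U : 'M[R]_(1 + n) := block_mx c%:M 0 (- sg^-1 *: (U' *m s)) U'.
have Udl i j : U (rshift 1 i) (rshift 1 j) = U' i j by rewrite /U block_mxEdr.
have Uur i j : U (lshift n i) (rshift 1 j) = 0 by rewrite /U block_mxEur mxE.
have Uul i : U (lshift n i) (lshift n i) = c by rewrite /U block_mxEul mxE !ord1.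
exists U; split.
- apply/is_trig_mxP => i j.
  case: (@split_ordP 1 n i) => i' ->; case: (@split_ordP 1 n j) => j' -> /=.
  + by rewrite !ord1.
  + by move=> _; exact: Uur.
  + by rewrite !ord1.
  + rewrite /= !add1n ltnS => ij; apply: etrans (Udl i' j') _.
    by move/is_trig_mxP: U't; apply.
- move=> i; case: (@split_ordP 1 n i) => i' ->; first by apply: (lt_le_trans c0); rewrite -(Uul i').
  by apply: (lt_le_trans (U'p i')); rewrite -Udl.
- suff key : U *m S1 *m U^T = 1%:M by exact: key.
  have US : U *m S1 = block_mx (c * sg)%:M (c *: s^T) 0 (U' *m S').
    rewrite S1E /U mulmx_block !mul0mx !addr0 -scalar_mxM mul_scalar_mx.
    congr block_mx.
      by rewrite mul_mx_scalar scalerA mulrN divff ?gt_eqF// scaleN1r addNr.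
    rewrite /S' mulmxBr -scalemxAr addrC mulmxA; congr (_ + _).
    by rewrite scaleNr mulNmx scalemxAl.
  rewrite US /U tr_block_mx mulmx_block !trmx0 !mul0mx !mulmx0 !addr0 !add0r.
  rewrite U'S tr_scalar_mx -scalar_mxM mulrAC cc mul_scalar_mx linearZ/= trmx_mul.
  rewrite scalerA mulrN mulfK ?gt_eqF// -scalemxAl scaleNr addNr.
  by rewrite -scalar_mx_block.
Qed.

Lemma inv_choleskyP n (S : 'M[R]_n) : pos_def S -> is_inv_cholesky S (inv_cholesky S).
Proof. by move=> /inv_cholesky_exists[U HU]; apply: (@xgetPex _ 0 [set U | is_inv_cholesky S U]); exists U. Qed.

(** Forward substitution: once the rows of [C] before the [i]-th vanish above the
    diagonal, row [i] of the equation shows that the [i]-th does too. *)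
Lemma trig_mx_inverse n (U C : 'M[R]_n) : is_trig_mx U -> (forall i, 0 < U i i) ->
  U *m C = 1%:M -> is_trig_mx C /\ forall i, U i i * C i i = 1.
Proof.
move=> /is_trig_mxP Ut Up UC.
have Ct (m : nat) (i j : 'I_n) : (i < m)%N -> (i < j)%N -> C i j = 0.
  elim: m i j => // m IH i j im ij.
  have := congr1 (fun M : 'M[R]_n => M i j) UC; rewrite !mxE (bigD1 i)//= big1; last first.
    move=> k ki; have [ik|ki'] := ltnP i k; first by rewrite Ut// mul0r.
    have ki2 : (k < i)%N by rewrite ltn_neqAle ki' andbT; exact: ki.
    by rewrite IH ?mulr0//; [exact: leq_trans ki2 im|exact: ltn_trans ij].
  rewrite addr0 -val_eqE/= ltn_eqF// => /eqP; rewrite mulf_eq0 gt_eqF//=.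
  by move=> /eqP.
split; first by apply/is_trig_mxP => i j; exact: (Ct i.+1).
move=> i; have := congr1 (fun M : 'M[R]_n => M i i) UC.
rewrite !mxE eqxx (bigD1 i)//= big1 ?addr0// => k ki.
have [ik|ki'] := ltnP i k; first by rewrite Ut// mul0r.
by rewrite (Ct k.+1) ?mulr0// ltn_neqAle ki' andbT; exact: ki.
Qed.

(** With [C] the inverse of [U], the unit diagonal of [S = C C'] bounds
    [C i i] by 1, and [U i i] is the inverse of [C i i]. *)
Lemma inv_cholesky_diag_ge1 n (S U : 'M[R]_n) i :
  is_inv_cholesky S U -> S i i = 1 -> 1 <= U i i.
Proof.
move=> [Ut Up USU] Sii.
pose C := S *m U^T; have UC : U *m C = 1%:M by rewrite mulmxA.
have [Ct Cd] := trig_mx_inverse Ut Up UC.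
have CU : C *m U = 1%:M by apply: mulmx1C.
have SE : S = C *m C^T.
  transitivity (S *m (U^T *m C^T)); last by rewrite mulmxA.
  by rewrite -trmx_mul CU trmx1 mulmx1.
clearbody C; have : C i i ^+ 2 <= 1.
  rewrite -Sii {1}SE mxE (bigD1 i)//= mxE -expr2 lerDl sumr_ge0// => k _.
  by rewrite mxE -expr2 sqr_ge0.
have Ui := Up i; have := Cd i; nra.
Qed.

Lemma correlation_mx1 n : correlation_mx (1%:M : 'M[R]_n).
Proof.
split; last by move=> i; rewrite mxE eqxx.
split=> [|v v0]; first exact: trmx1.
have -> : (v^T *m 1%:M *m v) 0 0 = \sum_k v k 0 ^+ 2.
  by rewrite mulmx1 mxE; apply: eq_bigr => k _; rewrite mxE expr2.
rewrite lt0r sumr_ge0 ?andbT; last by move=> k _; rewrite sqr_ge0.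
apply: contraNneq v0 => /eqP; rewrite psumr_eq0; last by move=> k _; rewrite sqr_ge0.
move=> /allP H; apply/eqP/matrixP => k l; rewrite mxE ord1.
by have := H k (mem_index_enum _); rewrite sqrf_eq0 => /eqP.
Qed.

Lemma inv_cholesky1 n (i j : 'I_n) : i != j -> inv_cholesky (1%:M : 'M[R]_n) i j = 0.
Proof.
have [p1 _] := @correlation_mx1 n.
move: (inv_choleskyP p1); set U := inv_cholesky _ => -[Ut Up].
rewrite mulmx1 => /(trig_mx_inverse Ut Up)[/is_trig_mxP Ut' _].
rewrite -val_eqE neq_ltn => /orP[ij|ij]; first by move/is_trig_mxP : Ut; apply.
by have := Ut' _ _ ij; rewrite mxE.
Qed.

(** The identity matrix witnesses that the supremum of the errors is not taken
    over an empty set. *)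
Lemma Theta_star1 n (delta : R) (b : nat) : 0 <= delta -> (0 < b)%N ->
  Theta_star delta b (1%:M : 'M[R]_n).
Proof.
move=> d0 b0; split=> [|k bk]; first exact: correlation_mx1.
rewrite big1// => j jk; rewrite inv_cholesky1 ?normr0//.
by rewrite -val_eqE gtn_eqF//=; lia.
Qed.

End Cholesky.

(** * Gaussian integrals and rotations of the plane *)

Section GaussianDensity.
Context {R : realType}.
Local Notation mu := (@lebesgue_measure R).
Local Notation gam := (@normal_prob R 0 1).
Local Notation phi := (@normal_pdf R 0 1).

Lemma normal_pdf01E (x : R) : phi x = normal_peak 1 * expR (- (x ^+ 2 / 2)).
Proof.
by rewrite /normal_pdf oner_eq0 /normal_fun subr0 expr1n mulNr.
Qed.

(** The density is the Radon-Nikodym derivative, by uniqueness of the latter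
    almost everywhere. *)
Lemma ge0_integral_normal_prob (h : measurableTypeR R -> \bar R) :
  measurable_fun [set: measurableTypeR R] h -> (forall x, 0 <= h x)%E ->
  (\int[gam]_x h x = \int[mu]_x (h x * (phi x)%:E))%E.
Proof.
move=> mh h0; have dom := @normal_prob_dominates R 0 1.
rewrite -(@Radon_Nikodym_SigmaFinite.change_of_variables _ _ R gam mu dom h setT)//.
have iF := Radon_Nikodym_SigmaFinite.f_integrable dom.
have ip := @integrable_normal_pdf R 0 1.
apply: ge0_ae_eq_integral => //.
- by apply: emeasurable_funM => //; exact: measurable_int iF.
- by apply: emeasurable_funM => //; exact: measurable_int ip.
- by move=> x _; rewrite mule_ge0// Radon_Nikodym_SigmaFinite.f_ge0.
- by move=> x _; rewrite mule_ge0// lee_fin normal_pdf_ge0.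
have : ae_eq mu setT (Radon_Nikodym_SigmaFinite.f gam mu) (fun x => (phi x)%:E).
  apply: integral_ae_eq => //; first exact: measurable_int ip.
  by move=> E _ mE; rewrite -Radon_Nikodym_SigmaFinite.f_integral.
by apply: filterS => x + _ => /(_ I) ->.
Qed.

Lemma lebesgue_measure_affine (c d : R) (A : set (measurableTypeR R)) : c != 0 -> measurable A ->
  mu A = (`|c|%:E * mu ((fun x => (c * x + d)%R) @^-1` A))%E.
Proof.
move=> c0 mA.
pose g (x : measurableTypeR R) : measurableTypeR R := c * x + d.
have mg : measurable_fun setT g.
  by apply: measurable_funD => //; exact: measurable_funM.
have cp : 0 < `|c| by rewrite normr_gt0.
pose c' : {nonneg R} := NngNum (ltW cp).
pose mg' : {mfun _ >-> _} := HB.pack g (isMeasurableFun.Build _ _ _ _ _ mg).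
rewrite (@lebesgue_measure_unique R (mscale c' (pushforward mu mg')))//=.
move=> _ [[a b]] _ <-; rewrite /mscale/= /pushforward/=.
rewrite lebesgue_measure_itv/= lte_fin.
have [cn|cn] : c < 0 \/ 0 < c by case: ltgtP c0; [left|right|].
- have -> : g @^-1` `]a, b] = `[(b - d) / c, (a - d) / c[%classic.
    rewrite /g; apply/seteqP; split => x /=; rewrite !in_itv/= => /andP[h1 h2];
      apply/andP; split.
    + by rewrite ler_ndivrMr// ; lra.
    + by rewrite ltr_ndivlMr//; lra.
    + by move: h2; rewrite ltr_ndivlMr//; lra.
    + by move: h1; rewrite ler_ndivrMr//; lra.
  rewrite lebesgue_measure_itv/= lte_fin ltr_ndivlMr// divfK// ltr0_norm//.
  rewrite ltrD2r; case: ifP => _; last by rewrite mule0.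
  by rewrite -EFinB -EFinM; congr EFin; field; rewrite lt_eqF.
- have -> : g @^-1` `]a, b] = `](a - d) / c, (b - d) / c]%classic.
    rewrite /g; apply/seteqP; split => x /=; rewrite !in_itv/= => /andP[h1 h2];
      apply/andP; split.
    + by rewrite ltr_pdivrMr//; lra.
    + by rewrite ler_pdivlMr//; lra.
    + by move: h1; rewrite ltr_pdivrMr//; lra.
    + by move: h2; rewrite ler_pdivlMr//; lra.
  rewrite lebesgue_measure_itv/= lte_fin ltr_pdivrMr// divfK// gtr0_norm//.
  rewrite ltrD2r; case: ifP => _; last by rewrite mule0.
  by rewrite -EFinB -EFinM; congr EFin; field; rewrite gt_eqF.
Qed.

Lemma ge0_integral_affine (c d : R) (h : measurableTypeR R -> \bar R) : c != 0 ->
  measurable_fun [set: measurableTypeR R] h -> (forall x, 0 <= h x)%E ->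
  (\int[mu]_x h x = `|c|%:E * \int[mu]_x h (c * x + d)%R)%E.
Proof.
move=> c0 mh h0.
pose g (x : measurableTypeR R) : measurableTypeR R := c * x + d.
have mg : measurable_fun setT g.
  by apply: measurable_funD => //; exact: measurable_funM.
have cp : 0 < `|c| by rewrite normr_gt0.
pose c' : {nonneg R} := NngNum (ltW cp).
pose mg' : {mfun _ >-> _} := HB.pack g (isMeasurableFun.Build _ _ _ _ _ mg).
pose nu : {measure set measurableTypeR R -> \bar R} := pushforward mu mg'.
transitivity (\int[mscale c' (nu mg)]_x h x)%E.
  by apply: eq_measure_integral => A mA _; exact: (lebesgue_measure_affine d c0 mA).
rewrite ge0_integral_mscale//; congr (_ * _)%E.
by rewrite /nu ge0_integral_pushforward.
Qed.

End GaussianDensity.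

Section PlaneRotation.
Context {R : realType}.
Local Notation mu := (@lebesgue_measure R).
Local Notation gam := (@normal_prob R 0 1).
Local Notation phi := (@normal_pdf R 0 1).

Lemma normal_prob_indic (A : set (measurableTypeR R)) : measurable A ->
  (gam A = \int[mu]_x ((\1_A x)%:E * (phi x)%:E))%E.
Proof.
move=> mA; rewrite /normal_prob integral_mkcond; apply: eq_integral => x _.
by rewrite patchE indicE; case: ifPn; rewrite ?mul1e ?mul0e.
Qed.

Lemma measurable_indic_pdf (A : set (measurableTypeR R)) : measurable A ->
  measurable_fun [set: measurableTypeR R] (fun y => (\1_A y)%:E * (phi y)%:E)%E.
Proof.
move=> mA; rewrite (_ : (fun _ => _) = (fun y => (\1_A y * phi y)%:E)); last first.
  by apply/funext => y; rewrite EFinM.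
apply/measurable_EFinP; apply: measurable_funM; first exact: measurable_indic.
exact: measurable_normal_pdf.
Qed.

Lemma indic_pdf_ge0 (A : set (measurableTypeR R)) (y : R) : (0 <= (\1_A y)%:E * (phi y)%:E)%E.
Proof. by rewrite -EFinM lee_fin mulr_ge0// normal_pdf_ge0. Qed.

Lemma normal_pdf_rotation (c s x y : R) : c ^+ 2 + s ^+ 2 = 1 ->
  phi (c * x - s * y) * phi (c * y + s * x) = phi x * phi y.
Proof.
move=> cs; rewrite !normal_pdf01E mulrACA [RHS]mulrACA -!expRD; congr (_ * expR _).
have -> : x ^+ 2 = (c ^+ 2 + s ^+ 2) * x ^+ 2 by rewrite cs mul1r.
have -> : y ^+ 2 = (c ^+ 2 + s ^+ 2) * y ^+ 2 by rewrite cs mul1r.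
by field.
Qed.

(** Rotation invariance of the Gaussian measure in the plane.  A rotation with
    nonzero cosine [c] is the product of two maps, each of which changes one
    coordinate only, in an affine way; so two one-dimensional affine
    substitutions suffice, with Fubini's theorem in between. *)
Lemma normal_prob_rotation (c s : R) (A B : set (measurableTypeR R)) :
  c != 0 -> c ^+ 2 + s ^+ 2 = 1 -> measurable A -> measurable B ->
  (gam \x gam)%E [set z | A (c * z.1 + s * z.2) /\ B (- s * z.1 + c * z.2)]
  = (gam A * gam B)%E.
Proof.
move=> c0 cs mA mB; set F := [set z | _].
pose f (p q : R) (C : set (measurableTypeR R)) (z : measurableTypeR R * measurableTypeR R) : R :=
  \1_C (p * z.1 + q * z.2).
have ml p q : measurable_fun setT
    (fun z : measurableTypeR R * measurableTypeR R => (p * z.1 + q * z.2 : measurableTypeR R)).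
  by apply: measurable_funD; apply: measurable_funM.
have mf p q C : measurable C -> measurable_fun setT (f p q C).
  move=> mC; apply: (@measurableT_comp _ _ _ _ _ _ (\1_C : measurableTypeR R -> R) _ (fun z => p * z.1 + q * z.2)); last exact: ml.
  exact: measurable_indic.
have mF : measurable F.
  have -> : F = ((fun z => c * z.1 + s * z.2) @^-1` A) `&`
      ((fun z => - s * z.1 + c * z.2) @^-1` B) by [].
  by apply: measurableI; rewrite -[X in measurable X]setTI; apply: ml.
have mphi p q : measurable_fun setT
  (fun z : measurableTypeR R * measurableTypeR R => phi (p * z.1 + q * z.2)).
  by apply: (measurableT_comp (measurable_normal_pdf _ _)); exact: ml.

have mx (x : R) : measurable_fun setT (fun y : measurableTypeR R => (x, y) : measurableTypeR R * measurableTypeR R).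
  exact: pair1_measurable.
have my (y : R) : measurable_fun setT (fun x : measurableTypeR R => (x, y) : measurableTypeR R * measurableTypeR R).
  exact: pair2_measurable.
pose g (z : measurableTypeR R * measurableTypeR R) : \bar R :=
  (f c s A z * f (- s) c B z * phi (1 * z.1 + 0 * z.2) * phi (0 * z.1 + 1 * z.2))%:E.
pose g2 (z : measurableTypeR R * measurableTypeR R) : \bar R :=
  (`|c^-1| * (f (c^-1) (s / c) A z * f 0 1 B z * phi (1 * z.1 + 0 * z.2) *
     phi (s / c * z.1 + c^-1 * z.2)))%:E.
have f0 p q C z : 0 <= f p q C z by rewrite /f indicE.
have g0 z : (0 <= g z)%E by rewrite lee_fin !mulr_ge0// normal_pdf_ge0.
have g20 z : (0 <= g2 z)%E by rewrite lee_fin !mulr_ge0// normal_pdf_ge0.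
have mg : measurable_fun setT g.
  apply/measurable_EFinP; do 3 (apply: measurable_funM => //); exact: mf.
have mg2 : measurable_fun setT g2.
  apply/measurable_EFinP; apply: measurable_funM => //.
  do 3 (apply: measurable_funM => //); exact: mf.
have E1 : (gam \x gam)%E F = (\int[mu]_x \int[mu]_y g (x, y))%E.
  rewrite /product_measure1 ge0_integral_normal_prob//; last first.
    exact: measurable_fun_xsection.
  apply: eq_integral => x _ /=.
  rewrite normal_prob_indic; last exact: measurable_xsection.
  transitivity (\int[mu]_y ((\1_(xsection F x) y)%:E * (phi y)%:E * (phi x)%:E))%E.
    rewrite ge0_integralZr//.
    + by apply: measurable_indic_pdf; exact: measurable_xsection.
    + by move=> y _; exact: indic_pdf_ge0.
    + by rewrite lee_fin normal_pdf_ge0.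
  - apply: eq_integral => y _; rewrite /g /f /= !mul1r !mul0r addr0 add0r.
    rewrite !indicE mem_xsection -!EFinM; congr EFin.
    rewrite mulrAC; congr (_ * _ * _); rewrite -natrM mulnb; congr (nat_of_bool _)%:R.
    apply/idP/andP => [/set_mem[h1 h2]|[/set_mem h1 /set_mem h2]].
      by split; exact/mem_set.
    exact/mem_set.
have E2 : (\int[mu]_x \int[mu]_y g (x, y) = \int[mu]_x \int[mu]_y g2 (x, y))%E.
  apply: eq_integral => x _.
  rewrite (@ge0_integral_affine _ c^-1 (s / c * x))//; last 2 first.
  - by rewrite invr_eq0.
  - exact: measurableT_comp mg (mx x).
  transitivity (\int[mu]_y (`|c^-1|%:E * g (x, (c^-1 * y + s / c * x)%R)))%E.
    rewrite ge0_integralZl//.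
    apply: measurableT_comp mg _; apply: (measurableT_comp (mx x)).
    by apply: measurable_funD => //; apply: measurable_funM.
  - apply: eq_integral => y _; rewrite /g /g2 /f/= -EFinM; congr EFin.
    congr (_ * (\1_A _ * \1_B _ * phi _ * phi _)).
    + have -> : c^-1 * x = (c ^+ 2 + s ^+ 2) / c * x by rewrite cs mul1r.
      by field.
    + by field.
    + by ring.
    + by ring.
rewrite E1 E2.
have g2E x y : g2 (x, y) = (`|c^-1| * (\1_A (c^-1 * x + s / c * y) * \1_B y * phi x *
     phi (s / c * x + c^-1 * y)))%:E.
  by rewrite /g2 /f /= !mul0r !mul1r addr0 add0r.
clearbody g2; clear E1 E2.
rewrite (@fubini_tonelli _ _ (measurableTypeR R) (measurableTypeR R) R mu mu g2 mg2 g20).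
have -> : (gam A * gam B = \int[mu]_y (gam A * ((\1_B y)%:E * (phi y)%:E)))%E.
  have a0 : (0 <= gam A)%E by [].
  rewrite (normal_prob_indic mB); move: (gam A) a0 => a a0; apply/esym.
  apply: ge0_integralZl => //; first exact: measurable_indic_pdf.
  by move=> y _; exact: indic_pdf_ge0.
apply: eq_integral => y _.
pose h x := g2 (x, y).
have mh : measurable_fun [set: measurableTypeR R] h by exact: measurableT_comp mg2 (my y).
have h0 x : (0 <= h x)%E by exact: g20.
rewrite -[LHS]/(\int[mu]_x h x)%E (@ge0_integral_affine _ c (- s * y) h c0 mh h0).
have -> : (gam A * ((\1_B y)%:E * (phi y)%:E) =
    \int[mu]_x ((\1_A x)%:E * (phi x)%:E * ((\1_B y)%:E * (phi y)%:E)))%E.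
  rewrite (normal_prob_indic mA); apply/esym; apply: ge0_integralZr => //.
  - exact: measurable_indic_pdf.
  - by move=> x _; exact: indic_pdf_ge0.
  - exact: indic_pdf_ge0.
have <- : (\int[mu]_x (`|c|%:E * h (c * x + - s * y)%R) =
    `|c|%:E * \int[mu]_x h (c * x + - s * y)%R)%E.
  apply: ge0_integralZl => //; apply: measurableT_comp mh _.
  by apply: measurable_funD => //; apply: measurable_funM.
apply: eq_integral => x _; rewrite /h g2E -!EFinM; congr EFin.
have cc : `|c| * `|c^-1| = 1 by rewrite -normrM divff// normr1.
rewrite [LHS]mulrA [X in X * _ = _]cc mul1r.
have -> : c^-1 * (c * x + - s * y) + s / c * y = x by field.
have -> : s / c * (c * x + - s * y) + c^-1 * y = c * y + s * x.
  have -> : c^-1 * y = (c ^+ 2 + s ^+ 2) / c * y by rewrite cs mul1r.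
  by field.
have -> : c * x + - s * y = c * x - s * y by ring.
by rewrite -mulrA normal_pdf_rotation//; ring.
Qed.
End PlaneRotation.

(** * Standard Gaussian vectors *)

Section RealProbability.
Context {R : realType} {d : measure_display} {T : measurableType d}.
Variable P : probability T R.

(** Real-valued probabilities, so that real arithmetic applies to them. *)
Definition pr (A : set T) : R := fine (P A).

Lemma prE A : measurable A -> P A = (pr A)%:E.
Proof. by move=> mA; rewrite /pr fineK// fin_num_measure. Qed.

Lemma pr_ge0 A : 0 <= pr A.
Proof. by rewrite fine_ge0. Qed.

Lemma pr_le A B : measurable A -> measurable B -> A `<=` B -> pr A <= pr B.
Proof.
by move=> mA mB AB; rewrite -lee_fin -!prE//; apply: le_measure; rewrite ?inE.
Qed.

Lemma pr_le1 A : measurable A -> pr A <= 1.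
Proof. by move=> mA; rewrite -lee_fin -prE// probability_le1. Qed.

Lemma prU A B : measurable A -> measurable B -> A `&` B = set0 ->
  pr (A `|` B) = pr A + pr B.
Proof.
move=> mA mB AB; apply: EFin_inj; rewrite EFinD -!prE//; last exact: measurableU.
exact: measureU.
Qed.

Lemma pr_setU_le A B : measurable A -> measurable B -> pr (A `|` B) <= pr A + pr B.
Proof.
move=> mA mB; rewrite -lee_fin EFinD -!prE//; last exact: measurableU.
exact: measureU2.
Qed.

Lemma measurable_exists (I : finType) (Q : pred I) (F : I -> set T) :
  (forall i, Q i -> measurable (F i)) -> measurable [set t | exists2 i, Q i & F i t].
Proof.
move=> mF; rewrite (_ : [set t | _] = \bigcup_(i in [set i | Q i]) F i).
  apply: fin_bigcup_measurable => //; exact: finite_finset.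
by apply/seteqP; split => t /= [i Qi Fi]; exists i.
Qed.

Lemma measurable_forall (I : finType) (Q : pred I) (F : I -> set T) :
  (forall i, Q i -> measurable (F i)) -> measurable [set t | forall i, Q i -> F i t].
Proof.
move=> mF; rewrite (_ : [set t | _] = \bigcap_(i in [set i | Q i]) F i).
  apply: fin_bigcap_measurable => //; exact: finite_finset.
by apply/seteqP; split => t /= H i Qi; apply: H.
Qed.

(** The union bound over a finite index set. *)
Lemma pr_exists_le (I : finType) (Q : pred I) (F : I -> set T) :
  (forall i, Q i -> measurable (F i)) ->
  pr [set t | exists2 i, Q i & F i t] <= \sum_(i | Q i) pr (F i).
Proof.
move=> mF.
suff H (s : seq I) : pr [set t | exists2 i, (i \in s) && Q i & F i t] <=
    \sum_(i <- s | Q i) pr (F i).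
  have := H (index_enum I); congr (pr _ <= _).
  by apply/seteqP; split => t [i]; [move=> /andP[_ Qi]|move=> Qi]; exists i;
    rewrite // mem_index_enum.
have mFs (s1 : seq I) : measurable [set t | exists2 i, (i \in s1) && Q i & F i t].
  by apply: measurable_exists => i /andP[_]; exact: mF.
elim: s => [|i s IH].
  rewrite big_nil (_ : [set t | _] = set0) /pr ?measure0//.
  by apply/seteqP; split => t // [].
rewrite big_cons; case: ifP => Qi; last first.
  apply: le_trans IH; apply: pr_le => // t [j /andP[]].
  rewrite inE => /orP[/eqP->|js Qj Fj]; first by rewrite Qi.
  by exists j => //; rewrite js.
apply: le_trans (lerD (lexx _) IH); apply: le_trans (pr_setU_le (mF i Qi) (mFs s)).
apply: pr_le => //; first by apply: measurableU => //; exact: mF.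
move=> t [j /andP[]]; rewrite inE => /orP[/eqP->|js Qj Fj]; first by left.
by right; exists j => //; rewrite js.
Qed.

Lemma pr_exists (I : finType) (Q : pred I) (F : I -> set T) :
  (forall i, Q i -> measurable (F i)) ->
  (forall i j t, Q i -> Q j -> F i t -> F j t -> i = j) ->
  pr [set t | exists2 i, Q i & F i t] = \sum_(i | Q i) pr (F i).
Proof.
move=> mF tF.
suff H (s : seq I) : uniq s -> pr [set t | exists2 i, (i \in s) && Q i & F i t] =
    \sum_(i <- s | Q i) pr (F i).
  have := H (index_enum I) (index_enum_uniq _); congr (pr _ = _).
  by apply/seteqP; split => t [i]; [move=> /andP[_ Qi]|move=> Qi]; exists i;
    rewrite // mem_index_enum.
have mFs (s1 : seq I) : measurable [set t | exists2 i, (i \in s1) && Q i & F i t].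
  by apply: measurable_exists => i /andP[_]; exact: mF.
elim: s => [|i s IH] /=.
  rewrite big_nil (_ : [set t | _] = set0) /pr ?measure0//.
  by apply/seteqP; split => t // [].
move=> /andP[si us]; rewrite big_cons; case: ifP => Qi; last first.
  rewrite -IH//; congr pr; apply/seteqP; split => t [j].
    rewrite inE => /andP[/orP[/eqP->|js Qj Fj]]; first by rewrite Qi.
    by exists j => //; rewrite js.
  by move=> /andP[js Qj] Fj; exists j => //; rewrite inE js orbT.
rewrite -IH// -prU//.
- congr pr; apply/seteqP; split => t.
    move=> [j /andP[]]; rewrite inE => /orP[/eqP->|js Qj Fj]; first by left.
    by right; exists j => //; rewrite js.
  move=> [Fi|[j /andP[js Qj] Fj]]; first by exists i => //; rewrite inE eqxx.
  by exists j => //; rewrite inE js orbT.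
- exact: mF.
- apply/seteqP; split => t // [Fi [j /andP[js Qj] Fj]].
  by move: si; rewrite (tF i j t Qi Qj Fi Fj) js.
Qed.

End RealProbability.

Section StdGaussian.
Context {R : realType}.
Local Notation gam := (@normal_prob R 0 1).

Definition gauss_pr (B : set R) : R := fine (gam B).

Lemma gauss_prE (B : set R) : measurable B -> gam B = (gauss_pr B)%:E.
Proof. by move=> mB; rewrite /gauss_pr fineK// fin_num_measure. Qed.

Lemma gauss_pr_ge0 B : 0 <= gauss_pr B.
Proof. by rewrite fine_ge0. Qed.

Lemma gauss_prT : gauss_pr setT = 1.
Proof. by rewrite /gauss_pr probability_setT. Qed.

(** Independence and the marginal laws in one product formula on boxes. *)
Definition std_gaussian d (T : measurableType d) (P : probability T R) n
    (Y : 'I_n -> T -> R) :=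
  (forall i, measurable_fun setT (Y i)) /\
  forall B : 'I_n -> set R, (forall i, measurable (B i)) ->
    pr P [set t | forall i, B i (Y i t)] = \prod_i gauss_pr (B i).

Lemma std_gaussian_of_iid d (T : measurableType d) (P : probability T R) n
    (W : 'I_n -> {RV P >-> R}) :
  iid_std_normal W -> std_gaussian P (fun i => W i : T -> R).
Proof.
move=> [WN Wi]; split=> [i|B mB]; first exact: measurable_funP.
rewrite /pr Wi// (eq_bigr (fun i => (gauss_pr (B i))%:E)) ?prodEFin// => i _.
by rewrite -gauss_prE//; exact: WN.
Qed.

End StdGaussian.

(** * Orthogonal invariance *)

Section RotationInvariance.
Context {R : realType}.
Local Notation gam := (@normal_prob R 0 1).

Definition plane_rotation n (i j : 'I_n) (c s : R) (v : 'I_n -> R) : 'I_n -> R :=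
  fun k => if k == i then c * v i + s * v j
           else if k == j then - s * v i + c * v j else v k.

Lemma plane_rotation_dot n (i j : 'I_n) (c s : R) (v w : 'I_n -> R) :
  i != j -> c ^+ 2 + s ^+ 2 = 1 ->
  \sum_k plane_rotation i j c s v k * plane_rotation i j c s w k = \sum_k v k * w k.
Proof.
move=> ij cs; rewrite (bigD1 i)//= (bigD1 j) 1?eq_sym//=.
rewrite [in RHS](bigD1 i)//= [in RHS](bigD1 j) 1?eq_sym//= !addrA; congr (_ + _).
  rewrite /plane_rotation !eqxx eq_sym (negbTE ij).
  have -> : v i * w i + v j * w j = (c ^+ 2 + s ^+ 2) * (v i * w i + v j * w j).
    by rewrite cs mul1r.
  ring.
by apply: eq_bigr => k /andP[ki kj]; rewrite /plane_rotation (negbTE ki) (negbTE kj).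
Qed.

(** Condition on the event [D] that the other coordinates lie in their sets: the
    normalized joint law of [Y i] and [Y j] on [D] agrees with the product
    Gaussian measure on rectangles, hence everywhere, in particular on the
    rotated rectangle. *)
Lemma std_gaussian_plane_rotation_neq0 n (i j : 'I_n) (c s : R)
    d (T : measurableType d) (P : probability T R) (Y : 'I_n -> T -> R) :
  i != j -> c != 0 -> c ^+ 2 + s ^+ 2 = 1 -> std_gaussian P Y ->
  std_gaussian P (fun k t => plane_rotation i j c s (Y^~ t) k).
Proof.
move=> ij c0 cs [mY PY]; split=> [k|B mB].
  rewrite /plane_rotation; case: eqP => _.
    by apply: measurable_funD; apply: measurable_funM.
  by case: eqP => _ //; apply: measurable_funD; apply: measurable_funM.
pose D := [set t | forall k, (k != i) && (k != j) -> B k (Y k t)].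
have mYB k (C : set R) : measurable C -> measurable (Y k @^-1` C).
  by move=> mC; rewrite -[X in measurable X]setTI; exact: mY.
have mD : measurable D by apply: measurable_forall => k _; exact: mYB.
pose p : R := \prod_(k | (k != i) && (k != j)) gauss_pr (B k).
have p0 : 0 <= p by rewrite prodr_ge0// => *; exact: gauss_pr_ge0.
have rect (A C : set R) : measurable A -> measurable C ->
    pr P (D `&` [set t | A (Y i t) /\ C (Y j t)]) = gauss_pr A * gauss_pr C * p.
  move=> mA mC.
  pose B' k := if k == i then A else if k == j then C else B k.
  have -> : D `&` [set t | A (Y i t) /\ C (Y j t)] = [set t | forall k, B' k (Y k t)].
    rewrite /B'; apply/seteqP; split => t /=.
      move=> [Dt [At Ct]] k; case: eqP => [->//|/eqP ki]; case: eqP => [->//|/eqP kj].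
      by apply: Dt; rewrite ki.
    move=> H; split; last first.
      by split; [have := H i; rewrite eqxx|have := H j; rewrite eqxx eq_sym (negbTE ij)].
    by move=> k /andP[/negbTE ki /negbTE kj]; have := H k; rewrite ki kj.
  rewrite PY; last by rewrite /B' => k; case: eqP => // _; case: eqP.
  rewrite (bigD1 i)//= (bigD1 j) 1?eq_sym//= mulrA /B' !eqxx eq_sym (negbTE ij).
  congr (_ * _); apply: eq_bigr => k /andP[ki kj].
  by rewrite (negbTE ki) (negbTE kj).
pose h (t : T) : measurableTypeR R * measurableTypeR R := (Y i t, Y j t).
have mh : measurable_fun setT h by apply: measurable_fun_pair; exact: mY.
pose E : set (measurableTypeR R * measurableTypeR R) :=
  [set z | B i (c * z.1 + s * z.2) /\ B j (- s * z.1 + c * z.2)].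
have mE : measurable E.
  have ml (u v : R) : measurable_fun setT (fun z : measurableTypeR R * measurableTypeR R =>
      (u * z.1 + v * z.2 : measurableTypeR R)).
    by apply: measurable_funD; apply: measurable_funM.
  have -> : E = ((fun z => c * z.1 + s * z.2) @^-1` B i) `&`
      ((fun z => - s * z.1 + c * z.2) @^-1` B j) by [].
  by apply: measurableI; rewrite -[X in measurable X]setTI; apply: ml => //; exact: mB.
have mhE : measurable (h @^-1` E) by rewrite -[X in measurable X]setTI; exact: mh.
pose mh' : {mfun _ >-> _} := HB.pack h (isMeasurableFun.Build _ _ _ _ _ mh).
have -> : [set t | forall k, B k (plane_rotation i j c s (Y^~ t) k)] = D `&` (h @^-1` E).
  rewrite /plane_rotation; apply/seteqP; split => t /=.
    move=> H; split=> [k /andP[/negbTE ki /negbTE kj]|].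
      by have := H k; rewrite ki kj.
    by split; [have := H i; rewrite eqxx|have := H j; rewrite eqxx eq_sym (negbTE ij)].
  move=> [Dt [Hi Hj]] k; case: eqP => [->//|/eqP ki]; case: eqP => [->//|/eqP kj].
  by apply: Dt; rewrite ki.
have goalE : \prod_k gauss_pr (B k) = gauss_pr (B i) * gauss_pr (B j) * p.
  by rewrite (bigD1 i)//= (bigD1 j) 1?eq_sym//= mulrA.
(* conditioning on [D] requires [p > 0]; otherwise both sides vanish *)
rewrite goalE; move: p0; rewrite le_eqVlt => /orP[/eqP p0|p0].
  rewrite -p0 mulr0; apply/eqP; rewrite eq_le pr_ge0 andbT.
  have := rect setT setT measurableT measurableT.
  rewrite -p0 mulr0 => <-; apply: pr_le; [exact: measurableI| |].
    apply: measurableI => //; rewrite (_ : [set t | _] = setT) //.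
    by apply/seteqP; split.
  by move=> t [? ?].
pose k' : {nonneg R} := NngNum (ltW (divr_gt0 ltr01 p0)).
pose nu := mscale k' (pushforward (mrestr P mD) mh').
have key : (gam \x gam)%E E = nu mh E.
  apply: product_measure_unique => //= A C mA mC.
  rewrite /nu /mscale/= /pushforward /mrestr/=.
  have -> : h @^-1` (A `*` C) `&` D = D `&` [set t | A (Y i t) /\ C (Y j t)].
    by rewrite setIC.
  have mAC : measurable [set t | A (Y i t) /\ C (Y j t)].
    by apply: measurableI; exact: mYB.
  rewrite (prE _ (measurableI _ _ mD mAC)) rect// !gauss_prE// -!EFinM.
  by congr EFin; field; rewrite gt_eqF.
move: key; rewrite (normal_prob_rotation c0 cs (mB i) (mB j)).
rewrite /nu /mscale/= /pushforward /mrestr/=.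
rewrite setIC (prE _ (measurableI _ _ mD mhE)) !gauss_prE// -!EFinM => -[->].
by rewrite div1r mulrC mulrA divff ?mul1r// gt_eqF.
Qed.

(** A quarter turn is the product of two rotations with nonzero cosines. *)
Lemma std_gaussian_plane_rotation n (i j : 'I_n) (c s : R)
    d (T : measurableType d) (P : probability T R) (Y : 'I_n -> T -> R) :
  i != j -> c ^+ 2 + s ^+ 2 = 1 -> std_gaussian P Y ->
  std_gaussian P (fun k t => plane_rotation i j c s (Y^~ t) k).
Proof.
move=> ij cs gY; have [c0|c0] := eqVneq c 0; last first.
  exact: std_gaussian_plane_rotation_neq0.
have s1 : s ^+ 2 = 1 by rewrite -cs c0; ring.
(* two rotations whose angles, from the triangle with sides 3, 4 and 5, add up
   to a right angle *)
have g1 := @std_gaussian_plane_rotation_neq0 _ i j (4 / 5) (3 / 5 * s) _ _ _ _ ij _ _ gY.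
have g2 := @std_gaussian_plane_rotation_neq0 _ i j (3 / 5) (4 / 5 * s) _ _ _ _ ij _ _ (g1 _ _).
have e1 : (4 / 5 : R) ^+ 2 + (3 / 5 * s) ^+ 2 = 1 by rewrite [X in _ + X]exprMn s1; field.
have e2 : (3 / 5 : R) ^+ 2 + (4 / 5 * s) ^+ 2 = 1 by rewrite [X in _ + X]exprMn s1; field.
have n1 : (4 / 5 : R) != 0 by lra.
have n2 : (3 / 5 : R) != 0 by lra.
have := g2 n2 e2 n1 e1; congr (std_gaussian P _).
have ji : (j == i) = false by rewrite eq_sym (negbTE ij).
apply/funext => k; apply/funext => t; rewrite /plane_rotation !eqxx ji.
have ss : s * s = 1 by rewrite -expr2.
case: eqP => [_|_].
  rewrite c0.
  have -> : 3 / 5 * (4 / 5 * Y i t + 3 / 5 * s * Y j t) +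
     4 / 5 * s * (- (3 / 5 * s) * Y i t + 4 / 5 * Y j t) =
     12 / 25 * (1 - s * s) * Y i t + s * Y j t by field.
  by rewrite ss; ring.
case: eqP => [_|//].
have -> : - (4 / 5 * s) * (4 / 5 * Y i t + 3 / 5 * s * Y j t) +
     3 / 5 * (- (3 / 5 * s) * Y i t + 4 / 5 * Y j t) =
     - s * Y i t + 12 / 25 * (1 - s * s) * Y j t by field.
by rewrite ss c0; ring.
Qed.

Lemma gauss_prN (B : set R) : measurable B -> gauss_pr (-%R @^-1` B) = gauss_pr B.
Proof.
move=> mB; have mB' : measurable (-%R @^-1` B : set (measurableTypeR R)).
  rewrite -[X in measurable X]setTI; apply: (@measurable_funN _ _ _ setT id) => //.
apply: EFin_inj; rewrite -!gauss_prE//.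
rewrite (normal_prob_indic mB) (normal_prob_indic mB').
rewrite (@ge0_integral_affine _ (-1) 0)//; last 2 first.
- exact: measurable_indic_pdf.
- by move=> x; exact: indic_pdf_ge0.
rewrite normrN1 mul1e; apply: eq_integral => x _.
rewrite addr0 mulN1r !indicE !normal_pdf01E sqrrN; congr (_%:E * _)%E.
congr (nat_of_bool _)%:R; apply/idP/idP => /set_mem H; apply/mem_set.
  by move: H; rewrite /preimage/= opprK.
by rewrite /preimage/= opprK.
Qed.

Definition coord_flip n (i : 'I_n) (v : 'I_n -> R) : 'I_n -> R :=
  fun k => if k == i then - v k else v k.

Lemma coord_flip_dot n (i : 'I_n) (v w : 'I_n -> R) :
  \sum_k coord_flip i v k * coord_flip i w k = \sum_k v k * w k.
Proof. by apply: eq_bigr => k _; rewrite /coord_flip; case: eqP; rewrite ?mulrNN. Qed.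

Lemma std_gaussian_coord_flip n (i : 'I_n)
    d (T : measurableType d) (P : probability T R) (Y : 'I_n -> T -> R) :
  std_gaussian P Y -> std_gaussian P (fun k t => coord_flip i (Y^~ t) k).
Proof.
move=> [mY PY]; split=> [k|B mB].
  by rewrite /coord_flip; case: eqP => _ //; exact: measurable_funN.
pose B' k := if k == i then -%R @^-1` (B k) else B k.
have mB' k : measurable (B' k).
  rewrite /B'; case: eqP => _ //; rewrite -[X in measurable X]setTI.
  by apply: (@measurable_funN _ _ _ setT id) => //; exact: mB.
have -> : [set t | forall k, B k (coord_flip i (Y^~ t) k)] =
   [set t | forall k, B' k (Y k t)].
  by rewrite /B' /coord_flip; apply/seteqP; split => t /= H k; have := H k; case: eqP.
rewrite PY//; apply: eq_bigr => k _; rewrite /B'; case: eqP => // _.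
exact: gauss_prN.
Qed.

End RotationInvariance.

Section OrthogonalInvariance.
Context {R : realType}.

Definition orthonormal_rows n (Q : 'I_n -> 'I_n -> R) :=
  forall r s, \sum_k Q r k * Q s k = (r == s)%:R.

Definition unit_rows n (Q : 'I_n -> 'I_n -> R) (k : nat) :=
  forall r : 'I_n, (r < k)%N -> forall j, Q r j = (r == j)%:R.

Definition preserves_gaussian n (Q : 'I_n -> 'I_n -> R) :=
  forall d (T : measurableType d) (P : probability T R) (Y : 'I_n -> T -> R),
  std_gaussian P Y -> std_gaussian P (fun r t => \sum_k Q r k * Y k t).

(** [Q Y] equals [Q'] applied to the rotated [Y], where the rows of [Q'] are those
    of [Q] rotated in the same way. *)
Lemma preserves_gaussian_rotate n (Q : 'I_n -> 'I_n -> R) (i j : 'I_n) (c s : R) :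
  i != j -> c ^+ 2 + s ^+ 2 = 1 ->
  preserves_gaussian (fun r => plane_rotation i j c s (Q r)) -> preserves_gaussian Q.
Proof.
move=> ij cs H d T P Y gY.
have := H _ _ _ _ (std_gaussian_plane_rotation ij cs gY); congr (std_gaussian P _).
by apply/funext => r; apply/funext => t; exact: plane_rotation_dot.
Qed.

Lemma preserves_gaussian_flip n (Q : 'I_n -> 'I_n -> R) (i : 'I_n) :
  preserves_gaussian (fun r => coord_flip i (Q r)) -> preserves_gaussian Q.
Proof.
move=> H d T P Y gY.
have := H _ _ _ _ (std_gaussian_coord_flip i gY); congr (std_gaussian P _).
by apply/funext => r; apply/funext => t; exact: coord_flip_dot.
Qed.

(** Every orthogonal matrix is reduced to the identity by plane rotations and
    sign changes of columns, clearing one entry of one row at a time: the outer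
    induction is on the number of rows already reduced to unit vectors, the
    inner one on the range of columns still to be cleared in the current row. *)
Lemma preserves_gaussian_orthonormal n (Q : 'I_n -> 'I_n -> R) :
  orthonormal_rows Q -> preserves_gaussian Q.
Proof.
suff H m k : (k + m = n)%N -> forall Q : 'I_n -> 'I_n -> R, orthonormal_rows Q -> unit_rows Q k ->
    preserves_gaussian Q.
  by move=> oQ; apply: (H n 0%N (add0n n) Q oQ) => r.
elim: m k => [|m IHm] k.
  rewrite addn0 => <- {}Q oQ uQ d T P Y gY; congr (std_gaussian P _): gY.
  apply/funext => r; apply/funext => t.
  rewrite (bigD1 r)//= uQ// eqxx mul1r big1 ?addr0// => j jr.
  by rewrite uQ// eq_sym (negbTE jr) mul0r.
move=> kmn; have kn : (k < n)%N by lia.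
pose k' := Ordinal kn.
suff H L : forall Q : 'I_n -> 'I_n -> R, orthonormal_rows Q -> unit_rows Q k ->
    (forall j : 'I_n, (L <= j)%N -> (k < j)%N -> Q k' j = 0) -> preserves_gaussian Q.
  by move=> {}Q oQ uQ; apply: (H n) => // j; rewrite leqNgt ltn_ord.
elim: L => [|L IHL] {}Q oQ uQ zQ.
  have zQl (j : 'I_n) : (j < k)%N -> Q k' j = 0.
    move=> jk; have := oQ k' j; rewrite (bigD1 j)//= (uQ j jk) eqxx mulr1 big1 ?addr0.
      by move=> ->; rewrite -val_eqE/= gtn_eqF.
    by move=> l lj; rewrite (uQ j jk) eq_sym (negbTE lj) mulr0.
  have zQ' (j : 'I_n) : j != k' -> Q k' j = 0.
    rewrite -val_eqE/= neq_ltn => /orP[|]; [exact: zQl|exact: zQ].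
  have Qk : Q k' k' = 1 \/ Q k' k' = -1.
    have := oQ k' k'; rewrite eqxx (bigD1 k')//= big1 ?addr0.
      by rewrite -expr2 => /eqP; rewrite sqrf_eq1 => /orP[/eqP->|/eqP->]; [left|right].
    by move=> l lk; rewrite zQ'// mul0r.
  have km : (k.+1 + m = n)%N by lia.
  case: Qk => Qk.
    apply: (IHm k.+1 km) => // r; rewrite ltnS leq_eqVlt => /orP[/eqP rk j|]; last exact: uQ.
    have {rk} -> : r = k' by apply: val_inj.
    by have [<-//|kj] := eqVneq k' j; rewrite zQ'// eq_sym.
  apply: (@preserves_gaussian_flip _ _ k'); apply: (IHm k.+1 km).
    by move=> r s; rewrite coord_flip_dot.
  move=> r; rewrite /coord_flip ltnS leq_eqVlt => /orP[/eqP rk j|rk j].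
    have {rk} -> : r = k' by apply: val_inj.
    by have [->|jk] := eqVneq j k'; rewrite ?eqxx ?Qk ?opprK// zQ'// eq_sym (negbTE jk).
  have [->|_] := eqVneq j k'; last exact: uQ.
  by rewrite uQ// -val_eqE/= ltn_eqF// oppr0.
have [Ln|nL] := ltnP L n; last first.
  by apply: IHL => // j Lj; move: (ltn_ord j); rewrite ltnNge (leq_trans nL Lj).
have [kL|Lk] := ltnP k L; last first.
  apply: IHL => // j; rewrite leq_eqVlt => /orP[/eqP <-|]; last exact: zQ.
  by rewrite ltnNge Lk.
pose l := Ordinal Ln.
have kl : k' != l by rewrite -val_eqE/= ltn_eqF.
have lk : (l == k') = false by rewrite eq_sym (negbTE kl).
have urot (Q1 : 'I_n -> 'I_n -> R) (c s : R) : unit_rows Q1 k ->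
    unit_rows (fun r => plane_rotation k' l c s (Q1 r)) k.
  move=> u1 r rk j; rewrite /plane_rotation.
  have rk' : (r == k') = false by rewrite -val_eqE/= ltn_eqF.
  have rl' : (r == l) = false by rewrite -val_eqE/= ltn_eqF// (leq_trans rk)// ltnW.
  rewrite !u1// rk' rl' !mulr0 addr0.
  by case: eqP => [->|_]; [rewrite rk'|case: eqP => [->|//]; rewrite rl'].
have zrot (Q1 : 'I_n -> 'I_n -> R) (c s : R) :
    (forall j : 'I_n, (L < j)%N -> (k < j)%N -> Q1 k' j = 0) ->
    forall j : 'I_n, (L < j)%N -> (k < j)%N -> plane_rotation k' l c s (Q1 k') j = 0.
  move=> z1 j Lj kj; rewrite /plane_rotation.
  have -> : (j == k') = false by rewrite -val_eqE/= gtn_eqF.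
  have -> : (j == l) = false by rewrite -val_eqE/= gtn_eqF.
  exact: z1.
have main (Q1 : 'I_n -> 'I_n -> R) : orthonormal_rows Q1 -> unit_rows Q1 k ->
    (forall j : 'I_n, (L < j)%N -> (k < j)%N -> Q1 k' j = 0) -> Q1 k' k' != 0 ->
    preserves_gaussian Q1.
  move=> o1 u1 z1 a0; set a := Q1 k' k' in a0; set b := Q1 k' l.
  have q0 : 0 < a ^+ 2 + b ^+ 2 by rewrite ltr_wpDr ?sqr_ge0// exprn_even_gt0.
  pose q := Num.sqrt (a ^+ 2 + b ^+ 2).
  have q1 : 0 < q by rewrite sqrtr_gt0.
  have q2 : q ^+ 2 = a ^+ 2 + b ^+ 2 by rewrite sqr_sqrtr// ltW.
  have cs : (a / q) ^+ 2 + (b / q) ^+ 2 = 1.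
    by rewrite !expr_div_n -mulrDl -q2 divff// expf_neq0// gt_eqF.
  apply: (preserves_gaussian_rotate kl cs); apply: IHL.
  - by move=> r s; rewrite plane_rotation_dot.
  - exact: urot.
  - move=> j; rewrite leq_eqVlt => /orP[/eqP Lj _|]; last exact: zrot.
    have -> : j = l by apply: val_inj.
    by rewrite /plane_rotation lk eqxx -/a -/b; ring.
have [a0|a0] := eqVneq (Q k' k') 0; last exact: main.
have [b0|b0] := eqVneq (Q k' l) 0.
  apply: IHL => // j; rewrite leq_eqVlt => /orP[/eqP Lj _|]; last exact: zQ.
  by have -> : j = l by apply: val_inj.
(* the diagonal entry vanishes: any oblique rotation makes it nonzero *)
have cs : (3 / 5 : R) ^+ 2 + (4 / 5) ^+ 2 = 1 by field.
apply: (preserves_gaussian_rotate kl cs); apply: main.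
- by move=> r s; rewrite plane_rotation_dot.
- exact: urot.
- exact: zrot.
- by rewrite /plane_rotation eqxx a0 mulr0 add0r mulf_neq0//; lra.
Qed.

End OrthogonalInvariance.

(** * Gaussian tails and p-values *)

Section GaussianTails.
Context {R : realType}.
Local Notation mu := (@lebesgue_measure R).
Local Notation gam := (@normal_prob R 0 1).
Local Notation phi := (@normal_pdf R 0 1).
Local Notation peak := (@normal_peak R 1).

Lemma peak_gt0 : 0 < peak.
Proof. exact: normal_peak_gt0 (oner_neq0 _). Qed.

Lemma gauss_pr_le (A B : set R) : measurable A -> measurable B -> A `<=` B ->
  gauss_pr A <= gauss_pr B.
Proof. exact: (@pr_le R _ (measurableTypeR R) gam). Qed.

Lemma gauss_prU (A B : set R) : measurable A -> measurable B -> A `&` B = set0 ->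
  gauss_pr (A `|` B) = gauss_pr A + gauss_pr B.
Proof. exact: (@prU R _ (measurableTypeR R) gam). Qed.

Lemma gauss_pr_le1 (A : set R) : measurable A -> gauss_pr A <= 1.
Proof. exact: (@pr_le1 R _ (measurableTypeR R) gam). Qed.

Lemma gauss_prC (B : set R) : measurable B -> gauss_pr (~` B) = 1 - gauss_pr B.
Proof.
move=> mB; have := gauss_prU mB (measurableC mB) (setICr B).
by rewrite setUCr gauss_prT => ->; ring.
Qed.

Lemma gauss_pr_itv_ub (a b : R) (x y : bool) : a <= b ->
  gauss_pr [set` Interval (BSide x a) (BSide y b)] <= peak * (b - a).
Proof.
move=> ab; set A := [set` _]; have mA : measurable A by exact: measurable_itv.
rewrite -lee_fin -gauss_prE// /normal_prob.
apply: (@le_trans _ _ (\int[mu]_(x in A) peak%:E))%E.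
  apply: ge0_le_integral => //.
  - by move=> z _; rewrite lee_fin normal_pdf_ge0.
  - by apply/measurable_EFinP/measurable_funTS; exact: measurable_normal_pdf.
  - by move=> z _; rewrite lee_fin normal_pdf_ub// oner_neq0.
rewrite integral_cst//= lebesgue_measure_itv/= lte_fin EFinM.
case: ifP => _; first by rewrite -EFinB lexx.
by rewrite mule0 -EFinM lee_fin mulr_ge0 ?subr_ge0// ltW// peak_gt0.
Qed.

Lemma gauss_pr_itv_lb (a b M : R) (x y : bool) : a < b -> `|a| <= M -> `|b| <= M ->
  peak * expR (- (M ^+ 2 / 2)) * (b - a) <= gauss_pr [set` Interval (BSide x a) (BSide y b)].
Proof.
move=> ab aM bM; set A := [set` _]; have mA : measurable A by exact: measurable_itv.
have p0 := peak_gt0.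
rewrite -lee_fin -gauss_prE// /normal_prob.
apply: (@le_trans _ _ (\int[mu]_(x in A) (peak * expR (- (M ^+ 2 / 2)))%:E))%E; last first.
  apply: ge0_le_integral => //.
  - by move=> z _; rewrite lee_fin mulr_ge0 ?expR_ge0// ltW.
  - by apply/measurable_EFinP/measurable_funTS; exact: measurable_normal_pdf.
  - move=> z Az; rewrite lee_fin normal_pdf01E; apply: ler_wpM2l; first exact: ltW.
    rewrite ler_expR lerN2 ler_pM2r// -[z ^+ 2]real_normK ?num_real// lerXn2r ?nnegrE//.
      exact: le_trans aM.
    have [az zb] : a <= z /\ z <= b.
      move: Az; rewrite /A /=.
      by case: (x); case: (y); rewrite in_itv/= => /andP[h1 h2]; split; rewrite // ltW.
    rewrite ler_norml; move: aM bM; rewrite !ler_norml => /andP[? ?] /andP[? ?].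
    by apply/andP; split; lra.
rewrite integral_cst//= lebesgue_measure_itv/= lte_fin ab -EFinB -EFinM.
exact: lexx.
Qed.

(** On the half-line the standard density is at most [exp(- t^2 / 2)] times the
    density of mean [t], whose total mass is 1. *)
Lemma gauss_pr_tail_ub (t : R) : 0 <= t -> gauss_pr `[t, +oo[ <= expR (- (t ^+ 2 / 2)).
Proof.
move=> t0; rewrite -lee_fin -gauss_prE// /normal_prob.
have m1 : (@normal_prob R t 1 `[t, +oo[ <= 1)%E by exact: probability_le1.
apply: (@le_trans _ _ ((expR (- (t ^+ 2 / 2)))%:E * @normal_prob R t 1 `[t, +oo[)%E); last first.
  by rewrite -[leRHS]mule1 lee_wpmul2l// lee_fin expR_ge0.
have mt : measurable_fun (`[t, +oo[ : set (measurableTypeR R)) (fun x => (normal_pdf t 1 x)%:E).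
  by apply/measurable_EFinP/measurable_funTS; exact: measurable_normal_pdf.
have t1 x : (0 <= (normal_pdf t 1 x)%:E)%E by rewrite lee_fin normal_pdf_ge0.
have <- : (\int[mu]_(x in `[t, +oo[) ((expR (- (t ^+ 2 / 2)))%:E * (normal_pdf t 1 x)%:E) =
   (expR (- (t ^+ 2 / 2)))%:E * @normal_prob R t 1 `[t, +oo[)%E.
  by apply: ge0_integralZl => //; rewrite lee_fin expR_ge0.
apply: ge0_le_integral => //.
- by move=> z _; rewrite lee_fin normal_pdf_ge0.
- by apply/measurable_EFinP/measurable_funTS; exact: measurable_normal_pdf.
- exact: emeasurable_funM.
- move=> z; rewrite /= in_itv/= andbT => tz; rewrite -EFinM lee_fin normal_pdf01E.
  rewrite /normal_pdf oner_eq0 /normal_fun mulrCA ler_wpM2l ?normal_peak_ge0//.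
  rewrite -expRD ler_expR expr1n.
  have : 0 <= t * (z - t) by rewrite mulr_ge0// subr_ge0.
  by nra.
Qed.

Lemma itv_abs_ge (t : R) : 0 < t -> [set x : R | t <= `|x|] = `]-oo, (- t)] `|` `[t, +oo[.
Proof.
move=> t0; apply/seteqP; split => x /=; rewrite !in_itv/= andbT.
  by rewrite ler_normr => /orP[|]; [right|left]; rewrite // lerNr.
by rewrite ler_normr => -[|->//]; rewrite lerNr => ->; rewrite orbT.
Qed.

Lemma measurable_abs_ge (t : R) : measurable [set x : R | t <= `|x|].
Proof.
have -> : [set x : R | t <= `|x|] = (@Num.norm _ R) @^-1` `[t, +oo[.
  by apply/seteqP; split => x /=; rewrite in_itv/= andbT.
rewrite -[X in measurable X]setTI; exact: (@normr_measurable R setT).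
Qed.

Lemma p_valueE (y : R) : p_value y = gauss_pr [set x : R | `|y| <= `|x|].
Proof. by []. Qed.

Lemma p_value_norm (y : R) : p_value `|y| = p_value y.
Proof. by rewrite !p_valueE normr_id. Qed.

Lemma p_value_ge0 (y : R) : 0 <= p_value y.
Proof. exact: gauss_pr_ge0. Qed.

Lemma p_value0 : p_value (0 : R) = 1.
Proof.
rewrite p_valueE normr0 (_ : [set x | _] = setT) ?gauss_prT//.
by apply/seteqP; split => x //= _.
Qed.

Lemma measurable_abs_itv (s t : R) : measurable [set x : R | s <= `|x| < t].
Proof.
have -> : [set x : R | s <= `|x| < t] = (@Num.norm _ R) @^-1` `[s, t[.
  by apply/seteqP; split => x /=; rewrite in_itv/=.
rewrite -[X in measurable X]setTI; exact: (@normr_measurable R setT).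
Qed.

Lemma p_value_split (s t : R) : 0 <= s -> s <= t ->
  p_value s = p_value t + gauss_pr [set x : R | s <= `|x| < t].
Proof.
move=> s0 st; rewrite !p_valueE ger0_norm// ger0_norm ?(le_trans s0)// -gauss_prU.
- congr gauss_pr; apply/seteqP; split => x /=.
    by move=> sx; have [tx|tx] := leP t `|x|; [left|right; rewrite sx].
  by move=> [|/andP[]//]; exact: le_trans.
- exact: measurable_abs_ge.
- have -> : [set x : R | s <= `|x| < t] = [set x : R | s <= `|x|] `\` [set x : R | t <= `|x|].
    apply/seteqP; split => x /=; first by move=> /andP[-> xt]; split => //; rewrite leNgt xt.
    by move=> [-> /negP]; rewrite -ltNge.
  by apply: measurableD; exact: measurable_abs_ge.
- by apply/seteqP; split => x //= [tx /andP[_]]; rewrite ltNge tx.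
Qed.

Lemma p_value_decr (s t : R) : 0 <= s -> s < t -> p_value t < p_value s.
Proof.
move=> s0 st; rewrite (p_value_split s0 (ltW st)) ltrDl.
apply: (@lt_le_trans _ _ (gauss_pr `[s, t[)).
  have := @gauss_pr_itv_lb s t t true true st.
  rewrite !ger0_norm ?(le_trans s0 (ltW st))// => /(_ (ltW st) (lexx _)).
  by apply: lt_le_trans; rewrite mulr_gt0 ?subr_gt0// mulr_gt0 ?expR_gt0// peak_gt0.
apply: gauss_pr_le => //; first exact: measurable_abs_itv.
by move=> x /=; rewrite in_itv/= => /andP[sx xt]; rewrite ger0_norm ?sx// (le_trans s0).
Qed.

(** The density is bounded by its peak, and a p-value has two tails. *)
Lemma p_value_lip (s t : R) : 0 <= s -> s <= t -> p_value s - p_value t <= 2 * peak * (t - s).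
Proof.
move=> s0 st; rewrite (p_value_split s0 st) addrAC subrr add0r.
apply: (@le_trans _ _ (gauss_pr (`[s, t] `|` `[- t, - s]))).
  apply: gauss_pr_le; [exact: measurable_abs_itv|exact: measurableU|].
  move=> x /= /andP[]; rewrite !in_itv/= ler_normr ltr_norml => /orP[sx|sx] /andP[tx xt].
    by left; rewrite sx ltW.
  by right; rewrite ltW//= lerNr.
apply: (le_trans (@pr_setU_le R _ (measurableTypeR R) gam _ _ _ _)) => //.
have -> : 2 * peak * (t - s) = peak * (t - s) + peak * (- s - (- t)) by ring.
by apply: lerD; apply: gauss_pr_itv_ub; rewrite // lerN2.
Qed.

Lemma continuous_p_value : continuous (@p_value R).
Proof.
have lip (y z : R) : `|p_value y - p_value z| <= 2 * peak * `|y - z|.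
  rewrite -(p_value_norm y) -(p_value_norm z).
  apply: (@le_trans _ _ (2 * peak * `| `|y| - `|z| |)); last first.
    apply: ler_wpM2l; last exact: ler_dist_dist.
    by rewrite mulr_ge0// ltW// peak_gt0.
  wlog yz : y z / `|y| <= `|z|.
    by move=> H; case/orP: (le_total `|y| `|z|) => /H//; rewrite distrC [X in _ <= _ * X]distrC.
  rewrite [X in _ <= _ * X]distrC (ger0_norm (_ : 0 <= `|z| - `|y|)) ?subr_ge0//.
  rewrite ger0_norm; first exact: p_value_lip.
  rewrite subr_ge0; move: yz; rewrite le_eqVlt => /orP[/eqP->//|yz].
  by rewrite ltW// p_value_decr.
move=> y; apply/cvgrPdist_le => e e0.
have pk := peak_gt0.
have e'0 : 0 < e / (2 * peak) by rewrite divr_gt0// mulr_gt0.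
have : \forall z \near y, `|y - z| <= e / (2 * peak).
  have cy : (fun z : R => z) @ y --> y by exact: cvg_id.
  by move/cvgrPdist_le : cy; apply.
apply: filterS => z yz; apply: le_trans (lip _ _) _.
by rewrite mulrC -ler_pdivlMr ?mulr_gt0.
Qed.

Lemma p_value_le_tail (t : R) : 0 < t -> p_value t <= 2 * expR (- (t ^+ 2 / 2)).
Proof.
move=> t0; rewrite p_valueE gtr0_norm// itv_abs_ge//.
apply: (le_trans (@pr_setU_le R _ (measurableTypeR R) gam _ _ _ _)) => //.
have -> : pr gam `]-oo, (- t)] = gauss_pr `[t, +oo[.
  rewrite -[RHS]gauss_prN//; congr gauss_pr; apply/seteqP; split => x /=;
    by rewrite !in_itv/= andbT lerNr.
by have := gauss_pr_tail_ub (ltW t0); rewrite -[pr gam _]/(gauss_pr _); lra.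
Qed.

(** Intermediate value theorem: the p-value is continuous, equal to 1 at 0, and
    tends to 0 at infinity. *)
Lemma p_value_surj (x : R) : 0 < x <= 1 -> exists2 t, 0 <= t & p_value t = x.
Proof.
move=> /andP[x0 x1].
pose M := 2 / x + 2; have M0 : 2 <= M by rewrite lerDr divr_ge0// ltW.
have pM : p_value M <= x.
  apply: le_trans (p_value_le_tail _) _; first by lra.
  rewrite expRN ler_pdivrMr ?expR_gt0// mulrC -ler_pdivrMr//.
  apply: le_trans (expR_ge1Dx _).
  have : 2 / x <= M by rewrite lerDl.
  nra.
have [] := @IVT R (@p_value R) 0 M x.
- lra.
- by apply: continuous_subspaceT; exact: continuous_p_value.
- by rewrite p_value0 ge_min pM le_max x1 orbT.
- by move=> t; rewrite in_itv/= => /andP[t0 _] <-; exists t.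
Qed.

End GaussianTails.

(** * Shifted Gaussians and higher criticism events *)

Section ShiftDomination.
Context {R : realType}.
Local Notation mu := (@lebesgue_measure R).
Local Notation gam := (@normal_prob R 0 1).
Local Notation phi := (@normal_pdf R 0 1).

Lemma measurable_shift (nu : R) (B : set R) : measurable B ->
  measurable ((fun w : R => w + nu) @^-1` B : set R).
Proof.
move=> mB; rewrite -[X in measurable X]setTI.
by apply: (@measurable_funD _ (measurableTypeR R) _ setT id (cst nu)).
Qed.

Lemma normal_prob_shift (nu : R) (B : set R) : measurable B ->
  gam ((fun w : R => w + nu) @^-1` B) =
  (\int[mu]_x ((\1_B x)%:E * (phi (x - nu))%:E))%E.
Proof.
move=> mB; have mB' := measurable_shift nu mB.
rewrite (normal_prob_indic mB') (@ge0_integral_affine _ 1 (- nu))//; last 2 first.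
- exact: measurable_indic_pdf.
- by move=> x; exact: indic_pdf_ge0.
rewrite normr1 mul1e; apply: eq_integral => x _; rewrite mul1r; congr (_%:E * _)%E.
rewrite !indicE; congr (nat_of_bool _)%:R.
by apply/idP/idP => /set_mem H; apply/mem_set; move: H; rewrite /preimage/= subrK.
Qed.

Lemma cosh_mono (u v : R) : `|u| <= `|v| ->
  expR u + expR (- u) <= expR v + expR (- v).
Proof.
have ev (w : R) : expR w + expR (- w) = expR `|w| + expR (- `|w|).
  by case: (ger0P w) => _ //; rewrite opprK addrC.
rewrite (ev u) (ev v); set p := `|u|; set q := `|v| => pq.
have p0 : 0 <= p by exact: normr_ge0.
have q0 : 0 <= q by exact: normr_ge0.
have h1 : expR p <= expR q by rewrite ler_expR.
have h2 : expR (- p) * expR (- q) <= 1 by rewrite -expRD -expR0 ler_expR; lra.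
have e1 := expRxMexpNx_1 p; have e2 := expRxMexpNx_1 q.
have : 0 <= (expR q - expR p) * (1 - expR (- p) * expR (- q)).
  by rewrite mulr_ge0// subr_ge0.
have -> : (expR q - expR p) * (1 - expR (- p) * expR (- q)) =
  expR q - expR p - (expR q * expR (- q)) * expR (- p) + (expR p * expR (- p)) * expR (- q).
  by ring.
by rewrite e1 e2; lra.
Qed.

(** Averaging the shifts by [nu] and [- nu] multiplies the density by a function
    of [cosh (nu x)], which increases with [|x|]. *)
Lemma normal_pdf_symm_shift (nu x : R) :
  phi (x - nu) + phi (x + nu) =
  phi x * (expR (- (nu ^+ 2 / 2)) * (expR (nu * x) + expR (- (nu * x)))).
Proof.
rewrite !normal_pdf01E -mulrDr -[RHS]mulrA; congr (_ * _).
by rewrite mulrA -expRD mulrDr -!expRD; congr (expR _ + expR _); field.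
Qed.

Lemma gauss_pr_shiftN (nu : R) (B : set R) : measurable B -> (forall x, B x -> B (- x)) ->
  gauss_pr ((fun w => w - nu) @^-1` B) = gauss_pr ((fun w => w + nu) @^-1` B).
Proof.
move=> mB symB; rewrite -(gauss_prN (measurable_shift nu mB)); congr gauss_pr.
apply/seteqP; split => x /=; rewrite /preimage/= => /symB; rewrite opprD opprK//.
Qed.

Lemma gauss_pr_shift_sum (nu : R) (B : set R) : measurable B -> (forall x, B x -> B (- x)) ->
  ((2 * gauss_pr ((fun w => w + nu) @^-1` B))%:E = \int[mu]_x ((\1_B x)%:E *
   (phi x * (expR (- (nu ^+ 2 / 2)) * (expR (nu * x) + expR (- (nu * x)))))%:E))%E.
Proof.
move=> mB symB; rewrite mulr_natl mulr2n -{1}(gauss_pr_shiftN nu mB symB) EFinD.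
rewrite -!gauss_prE; [|exact: measurable_shift..].
have mh (c : R) : measurable_fun [set: measurableTypeR R]
    (fun x => (\1_B x)%:E * (phi (x + c))%:E)%E.
  rewrite (_ : (fun _ => _) = (fun x => (\1_B x * phi (x + c))%:E)); last first.
    by apply/funext => y; rewrite EFinM.
  apply/measurable_EFinP; apply: measurable_funM; first exact: measurable_indic.
  apply: (measurableT_comp (measurable_normal_pdf _ _)).
  exact: (@measurable_funD _ (measurableTypeR R) _ setT id (cst c)).
have h0 (c x : R) : (0 <= (\1_B x)%:E * (phi (x + c))%:E)%E.
  by rewrite -EFinM lee_fin mulr_ge0// normal_pdf_ge0.
rewrite (normal_prob_shift nu mB) (normal_prob_shift (- nu) mB) -ge0_integralD//.
- apply: eq_integral => x _; rewrite -!EFinM -EFinD -mulrDr opprK addrC.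
  by rewrite [X in _ * X]addrC addrC normal_pdf_symm_shift.
Qed.

(** The likelihood ratio [g], a multiple of [cosh (nu x)], increases with [|x|].  If
    it exceeds 1 at [t], it does so on the whole tail set; otherwise it is below
    1 on the complement. *)
Lemma gauss_pr_shift_abs_ge (nu t : R) : 0 <= t ->
  p_value t <= gauss_pr [set w : R | t <= `|w + nu|].
Proof.
move=> t0; rewrite p_valueE (ger0_norm t0).
set B := [set x : R | t <= `|x|]; have mB : measurable B by exact: measurable_abs_ge.
rewrite -[X in _ <= gauss_pr X]/((fun w => w + nu) @^-1` B).
have symB x : B x -> B (- x) by rewrite /B/= normrN.
pose C := ~` B; have mC : measurable C by exact: measurableC.
have symC x : C x -> C (- x) by rewrite /C /B/= normrN.
pose g x : R := expR (- (nu ^+ 2 / 2)) * (expR (nu * x) + expR (- (nu * x))).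
have g0 x : 0 <= g x by rewrite mulr_ge0 ?addr_ge0 ?expR_ge0.
have gmono x y : `|x| <= `|y| -> g x <= g y.
  by move=> xy; rewrite ler_wpM2l ?expR_ge0// cosh_mono// !normrM ler_wpM2l.
have mg : measurable_fun [set: measurableTypeR R] g.
  have me (c : R) : measurable_fun [set: measurableTypeR R] (fun x : R => expR (c * x)).
    by apply: (measurableT_comp (@measurable_expR R)); exact: measurable_funM.
  apply: measurable_funM => //; apply: measurable_funD; first exact: me.
  by under eq_fun do rewrite -mulNr; exact: me.
have mint (D : set R) (f : R -> R) : measurable D ->
    measurable_fun [set: measurableTypeR R] f ->
    measurable_fun [set: measurableTypeR R] (fun x => (\1_D x)%:E * (phi x * f x)%:E)%E.
  move=> mD mf; rewrite (_ : (fun _ => _) = (fun x => (\1_D x * (phi x * f x))%:E)); last first.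
    by apply/funext => y; rewrite EFinM.
  apply/measurable_EFinP; apply: measurable_funM; first exact: measurable_indic.
  by apply: measurable_funM => //; exact: measurable_normal_pdf.
have int2 (D : set R) : measurable D ->
    ((2 * gauss_pr D)%:E = \int[mu]_x ((\1_D x)%:E * (phi x * 2)%:E))%E.
  move=> mD; rewrite EFinM -gauss_prE// (normal_prob_indic mD) -ge0_integralZl//.
  - by apply: eq_integral => x _; rewrite -!EFinM; congr EFin; ring.
  - exact: measurable_indic_pdf.
  - by move=> x _; exact: indic_pdf_ge0.
have posint (D : set R) (f : R -> R) : (forall x, 0 <= f x) ->
    forall x, (0 <= (\1_D x)%:E * (phi x * f x)%:E)%E.
  by move=> f0 x; rewrite -EFinM lee_fin !mulr_ge0// normal_pdf_ge0.
have cmp (D : set R) (f1 f2 : R -> R) : measurable D ->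
    measurable_fun [set: measurableTypeR R] f1 -> measurable_fun [set: measurableTypeR R] f2 ->
    (forall x, 0 <= f1 x) -> (forall x, 0 <= f2 x) -> (forall x, D x -> f1 x <= f2 x) ->
    (\int[mu]_x ((\1_D x)%:E * (phi x * f1 x)%:E) <=
     \int[mu]_x ((\1_D x)%:E * (phi x * f2 x)%:E))%E.
  move=> mD m1 m2 f10 f20 f12; apply: ge0_le_integral => //.
  - by move=> x _; exact: posint.
  - exact: mint.
  - exact: mint.
  - move=> x _; rewrite -!EFinM lee_fin indicE; case: (boolP (x \in D)) => [/set_mem Dx|_].
      by rewrite !mul1r ler_wpM2l ?normal_pdf_ge0// f12.
    by rewrite !mul0r.
have c2 : measurable_fun [set: measurableTypeR R] (fun _ : R => 2 : R) by [].
have [gt|gt] := leP 2 (g t).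
  have : 2 * gauss_pr B <= 2 * gauss_pr ((fun w => w + nu) @^-1` B).
    rewrite -lee_fin (gauss_pr_shift_sum nu mB symB) (int2 _ mB); apply: (cmp B (fun=> 2) g) => //.
    by move=> x Bx; apply: le_trans gt _; apply: gmono; rewrite (ger0_norm t0).
  by rewrite ler_pM2l.
have : 2 * gauss_pr ((fun w => w + nu) @^-1` C) <= 2 * gauss_pr C.
  rewrite -lee_fin (gauss_pr_shift_sum nu mC symC) (int2 _ mC); apply: (cmp C g (fun=> 2)) => //.
  move=> x /negP; rewrite -ltNge => xt; apply: le_trans (ltW gt); apply: gmono.
  by rewrite (ger0_norm t0) ltW.
rewrite (_ : (fun w : R => w + nu) @^-1` C = ~` ((fun w => w + nu) @^-1` B))//.
rewrite (gauss_prC mB) (gauss_prC (measurable_shift nu mB)).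
by lra.
Qed.

End ShiftDomination.

Section HigherCriticismEvents.
Context {R : realType}.

Definition p_count n (Y : 'cV[R]_n) (x : R) : nat := #|[set k | p_value (Y k 0) <= x]%SET|.

Definition hc_threshold (a : R) (n : nat) : R := (1 + a) * Num.sqrt (2 * ln (ln n%:R)).

(** The standardized excess of [N] over [n p], with denominators cleared. *)
Definition exceeds (c : R) (n : nat) (p : R) (N : nat) : Prop :=
  c * Num.sqrt (n%:R * p * (1 - p)) < N%:R - n%:R * p.

Lemma exceedsE (c : R) n p N : (0 < n)%N -> 0 < p < 1 ->
  exceeds c n p N <-> c < Num.sqrt n%:R * (N%:R / n%:R - p) / Num.sqrt (p * (1 - p)).
Proof.
move=> n0 /andP[p0 p1]; have nn : 0 < n%:R :> R by rewrite ltr0n.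
have s0 : 0 < Num.sqrt (p * (1 - p)) by rewrite sqrtr_gt0 mulr_gt0// subr_gt0.
have sn : 0 < Num.sqrt (n%:R : R) by rewrite sqrtr_gt0.
have nE : n%:R = Num.sqrt n%:R * Num.sqrt (n%:R : R) by rewrite -expr2 sqr_sqrtr ?ltW.
have e1 : c * Num.sqrt (n%:R * p * (1 - p)) =
    Num.sqrt n%:R * (c * Num.sqrt (p * (1 - p))).
  by rewrite -[n%:R * p * _]mulrA sqrtrM ?ltW//; ring.
have e2 : N%:R - n%:R * p = Num.sqrt n%:R * (Num.sqrt n%:R * (N%:R / n%:R - p)).
  by rewrite mulrA -nE; field; rewrite gt_eqF.
by rewrite ltr_pdivlMr// /exceeds e1 e2 ltr_pM2l.
Qed.

Lemma p_count_count n (Y : 'cV[R]_n) (x : R) :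
  p_count Y x = count (<= x) (sorted_p_values Y).
Proof.
rewrite /sorted_p_values count_sort count_map /p_count cardE -size_filter.
by rewrite /enum_mem -filter_predI; congr (size _); apply: eq_filter => k /=; rewrite !inE andbT.
Qed.

Definition exceeds_between (c s u : R) n (Y : 'cV[R]_n) : Prop :=
  exists i, s <= p_value (Y i 0) <= u /\
    exceeds c n (p_value (Y i 0)) (p_count Y (p_value (Y i 0))).

(** The maximum over order statistics may be taken over the p-values themselves:
    among the indices [j] sharing a p-value, the largest, which is the number of
    p-values at most that one, gives the largest term. *)
Lemma hc_rejectsP (a : R) n (Y : 'cV[R]_n) :
  hc_rejects a Y <-> exceeds_between (hc_threshold a n) n%:R^-1 (1 / 2) Y.
Proof.
have szp : size (sorted_p_values Y) = n.
  by rewrite size_sort size_map size_enum_ord.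
have srt : sorted <=%R (sorted_p_values Y) by apply: sort_sorted; exact: le_total.
have pr01 (p : R) : (0 < n)%N -> n%:R^-1 <= p <= 1 / 2 -> 0 < p < 1.
  move=> n0 /andP[h1 h2]; apply/andP; split; last by lra.
  by apply: lt_le_trans h1; rewrite invr_gt0 ltr0n.
split.
  rewrite /hc_rejects /hc_score => /bigmax_gtP[//|[j Pj]].
  rewrite lte_fin => Hj; set p := _`_j in Pj Hj.
  have n0 : (0 < n)%N by apply: leq_ltn_trans (ltn_ord j).
  have pin : p \in sorted_p_values Y by rewrite mem_nth// szp.
  have : p \in [seq p_value (Y i 0) | i <- enum 'I_n] by rewrite -(mem_sort <=%R).
  move=> /mapP[i _ pE]; exists i; rewrite -pE; split=> //.
  apply/exceedsE => //; first exact: pr01.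
  apply: (lt_le_trans Hj); rewrite ler_wpM2r ?invr_ge0 ?sqrtr_ge0// ler_wpM2l ?sqrtr_ge0//.
  rewrite lerD2r ler_pM2r ?invr_gt0 ?ltr0n// ler_nat p_count_count.
  rewrite ltnNge; apply/negP => Hc.
  (* were [N p <= j], the entry of index [j] would be larger than [p] *)
  have := @nth_count_gt _ _ p 0 _ j srt; rewrite Hc szp ltn_ord => /(_ isT).
  by rewrite -/p ltxx.
move=> [i [Pi Hi]]; set p := p_value (Y i 0) in Pi Hi.
have n0 : (0 < n)%N by apply: leq_ltn_trans (ltn_ord i).
have pin : p \in sorted_p_values Y.
  by rewrite mem_sort; apply/mapP; exists i => //; rewrite mem_enum.
pose N := p_count Y p.
have NE : N = count (<= p) (sorted_p_values Y) by exact: p_count_count.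
have N0 : (count (< p) (sorted_p_values Y) < N)%N by rewrite NE count_lt_le_mem.
have Nn : (N <= n)%N by rewrite NE -[X in (_ <= X)%N]szp count_size.
have N1 : (N.-1 < n)%N by apply: leq_trans Nn; rewrite prednK// (leq_ltn_trans _ N0).
have pE : (sorted_p_values Y)`_(N.-1) = p.
  apply: nth_count_eq => //; rewrite -NE; move: N0 N1; move: (count _ _) => q.
  by lia.
rewrite /hc_rejects /hc_score; apply/bigmax_gtP; right; exists (Ordinal N1).
  by rewrite pE.
rewrite lte_fin pE prednK ?(leq_ltn_trans _ N0)//.
by apply/exceedsE => //; exact: pr01.
Qed.

Lemma measurable_p_value d (T : measurableType d) (f : T -> R) :
  measurable_fun setT f -> measurable_fun setT (fun t => p_value (f t)).
Proof.
move=> mf; apply: (@measurableT_comp _ _ _ _ _ _ (@p_value R)) => //.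
exact: continuous_measurable_fun (@continuous_p_value R).
Qed.

Lemma measurable_exceeds_between (c s u : R) n d (T : measurableType d) (Y : T -> 'cV[R]_n) :
  (forall i, measurable_fun setT (fun t => Y t i 0)) ->
  measurable [set t | exceeds_between c s u (Y t)].
Proof.
move=> mY; have mp i := measurable_p_value (mY i).
have mb (b : T -> bool) : measurable_fun setT b -> measurable [set t | b t].
  by move=> mbt; rewrite -[X in measurable X]setTI; exact: (mbt measurableT [set true]).
pose E (ik : 'I_n * {set 'I_n}) : set T :=
  [set t | (s <= p_value (Y t ik.1 0)) && (p_value (Y t ik.1 0) <= u)] `&`
  [set t | forall k : 'I_n, true -> (p_value (Y t k 0) <= p_value (Y t ik.1 0)) == (k \in ik.2)] `&`
  [set t | c * Num.sqrt (n%:R * p_value (Y t ik.1 0) * (1 - p_value (Y t ik.1 0))) <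
           #|ik.2|%:R - n%:R * p_value (Y t ik.1 0)].
have -> : [set t | exceeds_between c s u (Y t)] = [set t | exists2 ik, true & E ik t].
  apply/seteqP; split => t /=.
    move=> [i [Pi Hi]].
    exists (i, [set k | p_value (Y t k 0) <= p_value (Y t i 0)]%SET) => //.
    by split=> //=; split=> //= k _; rewrite inE.
  move=> [[i K] _ [[/= Pi HK] He]]; exists i; split=> //.
  rewrite /exceeds /p_count (_ : [set k | _]%SET = K)//.
  by apply/setP => k; rewrite inE; exact/eqP/HK.
apply: measurable_exists => -[i K] _; rewrite /E/=; apply: measurableI; first apply: measurableI.
- apply: mb; apply: measurable_and; exact: measurable_fun_ler.
- apply: measurable_forall => k _.
  have ml : measurable_fun setT (fun t => p_value (Y t k 0) <= p_value (Y t i 0)).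
    exact: measurable_fun_ler.
  apply: (mb (fun t => (p_value (Y t k 0) <= p_value (Y t i 0)) == (k \in K))).
  case: (k \in K); first by under eq_fun do rewrite eqb_id.
  by under eq_fun do rewrite eqbF_neg; exact: measurable_neg.
- apply: mb; apply: measurable_fun_ltr.
    apply: measurable_funM => //; apply: (@measurableT_comp _ _ _ _ _ _ (@Num.sqrt R)).
      by apply: continuous_measurable_fun; exact: sqrt_continuous.
    apply: measurable_funM; first exact: measurable_funM.
    exact: measurable_funB.
  by apply: measurable_funB => //; exact: measurable_funM.
Qed.

Lemma measurable_hc_rejects (a : R) n d (T : measurableType d) (Y : T -> 'cV[R]_n) :
  (forall i, measurable_fun setT (fun t => Y t i 0)) ->
  measurable [set t | hc_rejects a (Y t)].
Proof.
move=> mY; have := measurable_exceeds_between (hc_threshold a n) n%:R^-1 (1 / 2) mY.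
by congr measurable; apply/seteqP; split => t /hc_rejectsP.
Qed.

End HigherCriticismEvents.

(** * The p-values of white noise *)

Section PValueMaximal.
Context {R : realType}.

(** [U Z = (U A) W], and [U A] is orthogonal because [U A A' U' = U S U' = 1]. *)
Lemma whitened_std_gaussian n (S : 'M[R]_n) d (T : measurableType d) (P : probability T R)
    (Z : T -> 'cV[R]_n) : pos_def S -> centered_gaussian P S Z ->
  std_gaussian P (fun i t => (inv_cholesky S *m Z t) i 0).
Proof.
move=> pS [A [W [iW AA ZE]]]; have [_ _ USU] := inv_choleskyP pS.
pose Q i k := (inv_cholesky S *m A) i k.
have oQ : orthonormal_rows Q.
  move=> i j; transitivity ((inv_cholesky S *m A *m (inv_cholesky S *m A)^T) i j).
    by rewrite [RHS]mxE; apply: eq_bigr => k _; rewrite [_^T _ _]mxE.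
  by rewrite trmx_mul mulmxA -[_ *m A *m A^T]mulmxA AA USU mxE.
have := preserves_gaussian_orthonormal oQ (std_gaussian_of_iid iW).
congr (std_gaussian P _); apply/funext => i; apply/funext => t.
by rewrite ZE mulmxA [RHS]mxE; apply: eq_bigr => k _; congr (_ * _); rewrite mxE.
Qed.

(** Reduces probabilities of events that depend only on a finite partition of
    the line to finite sums of products. *)
Lemma std_gaussian_discrete n d (T : measurableType d) (P : probability T R)
    (Y : 'I_n -> T -> R) (C : finType) (cell : 'I_n -> R -> C) (A : pred {ffun 'I_n -> C}) :
  std_gaussian P Y -> (forall k x, measurable [set w | cell k w = x]) ->
  pr P [set t | A [ffun k => cell k (Y k t)]] =
  \sum_(f | A f) \prod_k gauss_pr [set w | cell k w = f k].
Proof.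
move=> [mY PY] mc.
have mF (f : {ffun 'I_n -> C}) : measurable [set t | forall k, cell k (Y k t) = f k].
  rewrite (_ : [set t | _] = [set t | forall k, true -> cell k (Y k t) = f k]).
    apply: measurable_forall => k _.
    by rewrite -[X in measurable X]setTI; apply: (mY k _ [set w | cell k w = f k]).
  by apply/seteqP; split => t /= H k; [move=> _|]; exact: H.
have -> : [set t | A [ffun k => cell k (Y k t)]] =
    [set t | exists2 f, A f & [set t | forall k, cell k (Y k t) = f k] t].
  apply/seteqP; split => t /=.
    by move=> At; exists [ffun k => cell k (Y k t)] => // k; rewrite ffunE.
  by move=> [f Af Hf]; rewrite (_ : [ffun k => _] = f)//; apply/ffunP => k; rewrite ffunE.
rewrite pr_exists//; last first.
  by move=> f g t _ _ /= Hf Hg; apply/ffunP => k; rewrite -Hf -Hg.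
by apply: eq_bigr => f _; rewrite -PY.
Qed.

Lemma p_value_le_iff (t w : R) : 0 <= t -> (p_value w <= p_value t) = (t <= `|w|).
Proof.
move=> t0; rewrite -(p_value_norm w); apply/idP/idP; last first.
  by rewrite le_eqVlt => /orP[/eqP->//|tw]; rewrite ltW// p_value_decr.
by apply: contraTT; rewrite -!ltNge => wt; exact: p_value_decr.
Qed.

Lemma measurable_p_value_le (x : R) : measurable [set w : R | p_value w <= x].
Proof.
have := @measurable_p_value R _ (measurableTypeR R) idfun (@measurable_id _ _ _).
move=> /(_ measurableT [set` `]-oo, x]] (measurable_itv _)); rewrite setTI; congr measurable.
Qed.

Lemma p_value_uniform (x : R) : 0 < x <= 1 -> gauss_pr [set w : R | p_value w <= x] = x.
Proof.
move=> /p_value_surj[t t0 <-]; rewrite [RHS]p_valueE ger0_norm//; congr gauss_pr.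
by apply/seteqP; split => w /=; rewrite p_value_le_iff.
Qed.

Lemma p_value_le1 (y : R) : p_value y <= 1.
Proof. by rewrite p_valueE gauss_pr_le1//; exact: measurable_abs_ge. Qed.

Lemma find_iota_le (g : nat -> R) (M j : nat) (x : R) :
  (forall i k, (i <= k)%N -> g i <= g k) -> (j < M)%N ->
  (find (fun i => (x <= g i)%R) (iota 0 M) <= j)%N = (x <= g j).
Proof.
move=> gh jM; apply/idP/idP => [fj|xg].
  apply: le_trans (gh _ _ fj).
  have fM : (find (fun i => (x <= g i)%R) (iota 0 M) < size (iota 0 M))%N.
    by rewrite size_iota (leq_ltn_trans fj).
  have hf : has (fun i => x <= g i) (iota 0 M) by rewrite has_find.
  by have := nth_find 0%N hf; rewrite nth_iota ?add0n// (leq_ltn_trans fj).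
rewrite leqNgt; apply/negP => jf; have := before_find 0%N jf.
by rewrite nth_iota// add0n xg.
Qed.

(** Discretize the levels on the geometric grid [g j = min 1 (s q^j)] of ratio
    [q = (1 + e) / (1 + e')]: passing from a level [x] to the next grid point costs
    at most the factor [q], which is absorbed by lowering [e] to [e'].  The finite
    maximal inequality applies to the grid cells. *)
Lemma p_value_maximal n d (T : measurableType d) (P : probability T R)
    (Y : T -> 'cV[R]_n) (s e e' : R) :
  std_gaussian P (fun i t => Y t i 0) -> 0 < s <= 1 -> 0 < e' < e ->
  forall F : set T, measurable F ->
  (forall t, F t -> exists2 x, s <= x <= 1 &
     (1 + e) * (n%:R * x) <= (p_count (Y t) x)%:R) ->
  pr P F <= expR (- (n%:R * s * (e' ^+ 2 / (2 + e')))).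
Proof.
move=> gY /andP[s0 s1] /andP[e'0 e'e] F mF HF.
pose q := (1 + e) / (1 + e').
have q1 : 1 < q by rewrite ltr_pdivlMr; lra.
have q0 : 0 <= q by lra.
pose g j : R := Num.min 1 (s * q ^+ j).
have gh : (forall i k, (i <= k)%N -> g i <= g k).
  move=> i k ik; rewrite /g le_min ge_min lexx/= ge_min; apply/orP; right.
  by rewrite ler_wpM2l ?(ltW s0)// ler_eXn2l.
have g01 j : 0 < g j <= 1.
  by rewrite /g lt_min ltr01 ge_min lexx/= mulr_gt0// exprn_gt0// (lt_trans ltr01).
have [M gM] : exists M, g M = 1.
  have bern m : 1 + m%:R * (q - 1) <= q ^+ m.
    elim: m => [|m IH]; first by rewrite mul0r addr0 expr0.
    rewrite exprS; apply: (@le_trans _ _ (q * (1 + m%:R * (q - 1)))).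
      rewrite -natr1; have : 0 <= m%:R * (q - 1) * (q - 1).
        by rewrite !mulr_ge0// subr_ge0 ltW.
      lra.
    by rewrite ler_wpM2l.
  have d0 : 0 < s * (q - 1) by rewrite mulr_gt0// subr_gt0.
  pose m := Num.bound (1 / (s * (q - 1))).
  have Hm : 1 / (s * (q - 1)) < m%:R.
    by rewrite /m; apply: archi_boundP; rewrite divr_ge0// ltW.
  exists m; rewrite /g; apply/min_idPl.
  have := bern m; rewrite -(ler_pM2l s0); apply: le_trans.
  by move: Hm; rewrite ltr_pdivrMr//; nra.
(* the index of the first grid level above the p-value; the default of [find] is
   [M], which is correct since [g M = 1] *)
pose cell (w : R) : 'I_M.+1 := inord (find (fun i => p_value w <= g i) (iota 0 M)).
have cellE w (j : nat) : (j <= M)%N -> (cell w <= j)%N = (p_value w <= g j).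
  rewrite /cell inordK; last by rewrite ltnS -[leqRHS](size_iota 0 M) find_size.
  rewrite leq_eqVlt => /orP[/eqP->|jM]; last exact: find_iota_le.
  by rewrite gM p_value_le1 -[X in (_ <= X)%N](size_iota 0 M) find_size.
have cellM w : (cell w <= M)%N by rewrite -ltnS.
have mle (j : nat) : (j <= M)%N -> measurable [set w : R | (cell w <= j)%N].
  move=> jM; rewrite (_ : [set w | _] = [set w | p_value w <= g j]).
    exact: measurable_p_value_le.
  by apply/seteqP; split => w /=; rewrite cellE.
have mcell (x : 'I_M.+1) : measurable [set w : R | cell w = x].
  have mx : measurable [set w : R | (cell w <= x)%N] by apply: mle; rewrite -ltnS.
  have [x0|x0] := posnP x.
    rewrite (_ : [set w | _] = [set w : R | (cell w <= x)%N])//.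
    apply/seteqP; split => w /= => [->//|]; rewrite x0 leqn0 => /eqP c0.
    by apply: val_inj => /=; rewrite x0 c0.
  rewrite (_ : [set w | _] = [set w : R | (cell w <= x)%N] `\` [set w : R | (cell w <= x.-1)%N]).
    by apply: measurableD => //; apply: mle; have := ltn_ord x; lia.
  apply/seteqP; split => w /= => [->|[c1 /negP c2]].
    by split=> //; apply/negP; lia.
  by apply: val_inj => /=; lia.
pose w (x : 'I_M.+1) := gauss_pr [set z | cell z = x].
have w0 x : 0 <= w x by exact: gauss_pr_ge0.
have cumulE (j : 'I_M.+1) : cumul w j = g j.
  rewrite -(p_value_uniform (g01 j)) /cumul /w.
  rewrite -(@pr_exists R _ (measurableTypeR R) (@normal_prob R 0 1) 'I_M.+1
     (fun x => (x <= j)%N) (fun x => [set z | cell z = x])); last 2 first.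
  - by move=> i _; exact: mcell.
  - by move=> i k t _ _ /= -> ->.
  rewrite -[LHS]/(pr (@normal_prob R 0 1) _); congr pr; apply/seteqP; split => z /=.
    by move=> [x xj /= zx]; rewrite -cellE ?zx// -ltnS.
  by move=> zj; exists (cell z) => //; rewrite cellE// -ltnS.
have wsum : \sum_x w x = 1.
  rewrite -gM -[M in g M]/(nat_of_ord (@ord_max M)) -cumulE /cumul.
  by apply: eq_bigl => x; rewrite -ltnS ltn_ord.
have w00 : w ord0 = s.
  transitivity (cumul w (@ord0 M)).
    by rewrite /cumul (bigD1 ord0)//= big1 ?addr0// => x; rewrite leqn0 -val_eqE/= andbN.
  by rewrite cumulE /g expr0 mulr1; apply/min_idPr.
have w000 : 0 < w ord0 by rewrite w00.
have max := @maximal_relative R n M w e' w0 w000 wsum (ltW e'0).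
rewrite w00 in max; apply: le_trans max.
rewrite -(@std_gaussian_discrete n _ _ P (fun i t => Y t i 0) _ (fun=> cell))//.
pose A (f : {ffun 'I_n -> 'I_M.+1}) := [exists i : 'I_M.+1, n%:R * (1 + e') * cumul w i <= (ncumul f i)%:R].
apply: pr_le => //.
  have [mY _] := gY.
  rewrite (_ : [set t | _] = [set t | exists2 f, A f & forall k, true -> cell (Y t k 0) = f k]).
    apply: measurable_exists => f _; apply: measurable_forall => k _.
    by rewrite -[X in measurable X]setTI; apply: (mY k _ [set w | cell w = f k]).
  apply/seteqP; split => t /=.
    by move=> At; exists [ffun k => cell (Y t k 0)] => // k _; rewrite ffunE.
  move=> [f Af Hf]; rewrite (_ : [ffun k => _] = f)//.
  by apply/ffunP => k; rewrite ffunE Hf.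
move=> t /HF[x /andP[sx x1] Hx] /=.
have ncE (j : 'I_M.+1) : ncumul [ffun k => cell (Y t k 0)] j = p_count (Y t) (g j).
  by apply: eq_card => k; rewrite !inE ffunE cellE// -ltnS.
pose P1 j := x <= g j.
have exP : exists j, P1 j by exists M; rewrite /P1 gM.
case: (ex_minnP exP) => j xj jmin.
have jM : (j <= M)%N by apply: jmin; rewrite /P1 gM.
have jM' : (j < M.+1)%N by rewrite ltnS.
apply/existsP; exists (Ordinal jM'); rewrite cumulE ncE/=.
have pc : (p_count (Y t) x <= p_count (Y t) (g j))%N.
  by apply: subset_leq_card; apply/fintype.subsetP => k; rewrite !inE => /le_trans; apply.
have gx : g j <= q * x.
  case: j xj jmin {jM jM' pc} => [|j] xj jmin.
    apply: (@le_trans _ _ s); first by rewrite /g expr0 mulr1 ge_min lexx orbT.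
    have x0 : 0 <= x by lra.
    by nra.
  have gx : g j < x by rewrite ltNge; apply/negP => /jmin; rewrite ltnn.
  have : g j.+1 <= q * g j.
    rewrite /g ge_min; move: (leP 1 (s * q ^+ j)) => [h|h].
      by rewrite mulr1 ltW.
    by rewrite exprS mulrCA lexx orbT.
  by move/le_trans; apply; rewrite ler_wpM2l// ltW.
apply: (@le_trans _ _ (p_count (Y t) x)%:R); last by rewrite ler_nat.
apply: le_trans Hx; rewrite [leRHS]mulrCA -mulrA ler_wpM2l//.
apply: (@le_trans _ _ ((1 + e') * (q * x))).
  by rewrite ler_wpM2l//; lra.
have qe : (1 + e') * q = 1 + e by rewrite /q mulrC divfK//; lra.
by rewrite mulrA qe.
Qed.

End PValueMaximal.

(** * The null hypothesis *)

Section NullBound.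
Context {R : realType}.

(** On [s, u] the exceedance [c sqrt(n x (1 - x))] is at least [e n x], where
    [e = c sqrt((1 - u) / (n u))] is the relative excess at the end of the block;
    [kap < 1] is the loss from the discretization. *)
Lemma exceeds_between_block n d (T : measurableType d) (P : probability T R)
    (Y : T -> 'cV[R]_n) (s u c kap : R) :
  (0 < n)%N -> std_gaussian P (fun i t => Y t i 0) ->
  0 < s -> s <= u -> u <= 1 / 2 -> 0 < c -> 0 < kap < 1 ->
  pr P [set t | exceeds_between c s u (Y t)] <=
  expR (- (kap ^+ 2 * (1 - u) * c ^+ 2 * (s / u) / (2 + c / Num.sqrt (n%:R * s)))).
Proof.
move=> n0 gY s0 su u12 c0 /andP[k0 k1].
have nn : 0 < n%:R :> R by rewrite ltr0n.
have u0 : 0 < u by exact: lt_le_trans su.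
have nu0 : 0 < n%:R * u by rewrite mulr_gt0.
have r0 : 0 < (1 - u) / (n%:R * u) by rewrite divr_gt0//; lra.
pose e := c * Num.sqrt ((1 - u) / (n%:R * u)).
have e0 : 0 < e by rewrite mulr_gt0// sqrtr_gt0.
have e2 : e ^+ 2 = c ^+ 2 * ((1 - u) / (n%:R * u)) by rewrite exprMn sqr_sqrtr// ltW.
have [mY _] := gY.
have mF := measurable_exceeds_between c s u mY.
have ee : 0 < kap * e < e by rewrite mulr_gt0//=; nra.
have s1 : 0 < s <= 1 by rewrite s0/=; lra.
apply: le_trans (p_value_maximal gY s1 ee mF _) _.
  move=> t [i [/andP[si iu] Hi]]; exists (p_value (Y t i 0)).
    by rewrite si p_value_le1.
  move: Hi; rewrite /exceeds; set x := p_value _ in si iu *; set N := (p_count _ _)%:R => Hi.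
  have x0 : 0 < x by exact: lt_le_trans si.
  have nx : 0 < n%:R * x by rewrite mulr_gt0.
  suff : e * (n%:R * x) <= c * Num.sqrt (n%:R * x * (1 - x)) by lra.
  rewrite /e -mulrA ler_wpM2l ?(ltW c0)// -[n%:R * x in leLHS]ger0_norm ?(ltW nx)//.
  rewrite -sqrtr_sqr -sqrtrM ?(ltW r0)// ler_wsqrtr//.
  have -> : (1 - u) / (n%:R * u) * (n%:R * x) ^+ 2 = (n%:R * x) * ((1 - u) * x / u).
    by field; rewrite !gt_eqF.
  by rewrite ler_wpM2l ?(ltW nx)// ler_pdivrMr//; nra.
rewrite ler_expR lerN2 exprMn e2.
have ns0 : 0 < n%:R * s by rewrite mulr_gt0.
have q0 : 0 < Num.sqrt (n%:R * s) by rewrite sqrtr_gt0.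
have eub : kap * e <= c / Num.sqrt (n%:R * s).
  apply: (@le_trans _ _ e); first by rewrite ler_piMl// ltW.
  rewrite /e ler_wpM2l ?(ltW c0)// -sqrtrV ?(ltW ns0)// ler_wsqrtr//.
  rewrite ler_pdivrMr// ler_pdivlMl// mulrC.
  have : n%:R * s <= n%:R * u by rewrite ler_wpM2l// ltW.
  by nra.
have -> : n%:R * s * (kap ^+ 2 * (c ^+ 2 * ((1 - u) / (n%:R * u))) / (2 + kap * e)) =
   kap ^+ 2 * (1 - u) * c ^+ 2 * (s / u) / (2 + kap * e).
  have k2 : 2 + kap * e != 0 by case/andP: ee => ? _; rewrite gt_eqF//; lra.
  by field; rewrite k2 !gt_eqF.
case/andP: ee => ke0 _.
apply: ler_wpM2l.
  by rewrite !mulr_ge0 ?sqr_ge0 ?invr_ge0 ?(ltW s0) ?(ltW u0)//; lra.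
by rewrite lef_pV2 ?posrE; lra.
Qed.

(** Chain [K] blocks of ratio [rho], bounding each by the worst parameters. *)
Lemma exceeds_between_range n d (T : measurableType d) (P : probability T R)
    (Y : T -> 'cV[R]_n) (s0 u c kap rho : R) (K : nat) :
  (0 < n)%N -> std_gaussian P (fun i t => Y t i 0) ->
  0 < s0 -> 1 < rho -> u < s0 * rho ^+ K -> u <= 1 / 2 -> 0 < c -> 0 < kap < 1 ->
  pr P [set t | exceeds_between c s0 u (Y t)] <=
  K%:R * expR (- (kap ^+ 2 * (1 - u) * c ^+ 2 / rho / (2 + c / Num.sqrt (n%:R * s0)))).
Proof.
move=> n0 gY s00 rho1 usK u12 c0 kap01.
have nn : 0 < n%:R :> R by rewrite ltr0n.
have [mY _] := gY.
set bnd := expR _.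
suff H s : s0 <= s -> u < s * rho ^+ K ->
    pr P [set t | exceeds_between c s u (Y t)] <= K%:R * bnd by exact: H.
elim: K s {usK} => [|K IH] s ss0 usK.
  rewrite mul0r expr0 mulr1 in usK *; rewrite (_ : [set t | _] = set0) /pr ?measure0//.
  by apply/seteqP; split => t // [i [/andP[si iu] _]]; move: usK; rewrite ltNge (le_trans si iu).
have s00' : 0 < s by exact: lt_le_trans ss0.
have [us|su] := ltP u s.
  rewrite (_ : [set t | _] = set0) /pr ?measure0 ?mulr_ge0 ?expR_ge0//.
  by apply/seteqP; split => t // [i [/andP[si iu] _]]; move: us; rewrite ltNge (le_trans si iu).
have srho : s <= s * rho by rewrite ler_peMr ?ltW.
pose u' := Num.min u (s * rho).
have su' : s <= u' by rewrite /u' le_min su srho.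
have u'u : u' <= u by rewrite /u' ge_min lexx.
have u'0 : 0 < u' by exact: lt_le_trans su'.
apply: (@le_trans _ _ (pr P [set t | exceeds_between c s u' (Y t)] +
    pr P [set t | exceeds_between c (s * rho) u (Y t)])).
  apply: le_trans (pr_setU_le _ (measurable_exceeds_between _ _ _ mY)
    (measurable_exceeds_between _ _ _ mY)).
  apply: pr_le; [exact: measurable_exceeds_between| |].
    by apply: measurableU; exact: measurable_exceeds_between.
  move=> t [i [/andP[si iu] Hi]].
  have [h|h] := leP (p_value (Y t i 0)) (s * rho).
    by left; exists i; rewrite si /u' le_min iu h.
  by right; exists i; rewrite iu (ltW h).
rewrite mulrSr mulrDl mul1r addrC; apply: lerD.
  apply: IH; first exact: le_trans srho.
  by rewrite -mulrA -exprS.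
apply: le_trans (exceeds_between_block n0 gY s00' su' (le_trans u'u u12) c0 kap01) _.
rewrite ler_expR lerN2.
have ns0 : 0 < n%:R * s0 by rewrite mulr_gt0.
have ns : 0 < n%:R * s by rewrite mulr_gt0.
have q0 : 0 < Num.sqrt (n%:R * s0) by rewrite sqrtr_gt0.
have q1 : 0 < Num.sqrt (n%:R * s) by rewrite sqrtr_gt0.
have cq : c / Num.sqrt (n%:R * s) <= c / Num.sqrt (n%:R * s0).
  rewrite ler_wpM2l ?(ltW c0)// lef_pV2 ?posrE// ler_wsqrtr// ler_wpM2l// ltW//.
have cq0 : 0 < c / Num.sqrt (n%:R * s) by rewrite divr_gt0.
have k2 : 0 <= kap ^+ 2 by exact: sqr_ge0.
have c2 : 0 <= c ^+ 2 by exact: sqr_ge0.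
have rr : rho^-1 <= s / u'.
  rewrite ler_pdivlMr// ler_pdivrMl; last by lra.
  by rewrite mulrC /u' ge_min lexx orbT.
have ri : 0 <= rho^-1 by rewrite invr_ge0 ltW// (lt_trans ltr01).
have u1 : 0 <= 1 - u by clear -u12; lra.
have u'1 : 0 <= 1 - u' by apply: le_trans u1 _; rewrite lerB.
apply: ler_pM => //.
- by do 2 apply: mulr_ge0 => //; exact: mulr_ge0.
- by rewrite invr_ge0; clear -cq0 cq; lra.
- apply: ler_pM => //; first by apply: mulr_ge0 => //; exact: mulr_ge0.
  by rewrite ler_wpM2r// ler_wpM2l// lerB.
- by rewrite lef_pV2 ?posrE; clear -cq0 cq; lra.
Qed.

Lemma expRN_le_inv (y : R) : 0 < y -> expR (- y) <= y^-1.
Proof.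
move=> y0; rewrite expRN lef_pV2 ?posrE ?expR_gt0//.
by apply: le_trans (expR_ge1Dx y); rewrite lerDr.
Qed.

Lemma exceeds_between_split (c s u v : R) n (Y : 'cV[R]_n) :
  exceeds_between c s v Y -> exceeds_between c s u Y \/ exceeds_between c u v Y.
Proof.
move=> [i [/andP[si iv] Hi]]; have [iu|ui] := leP (p_value (Y i 0)) u.
  by left; exists i; rewrite si iu.
by right; exists i; rewrite iv (ltW ui).
Qed.

(** Here [n p] may be of constant order and the Poisson regime governs the tail,
    with exponent linear in [c / sqrt(n s)].  Since [c^4 = (sqrt c)^8], nine blocks of
    ratio [sqrt c] cover the range, and the exponent is of order [sqrt c]. *)
Lemma null_low_range n d (T : measurableType d) (P : probability T R) (Y : T -> 'cV[R]_n)
    (c kap : R) (eps z : R) :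
  (0 < n)%N -> std_gaussian P (fun i t => Y t i 0) -> 0 < kap < 1 -> 1 / 4 <= kap ^+ 2 ->
  0 < eps -> 1 < c -> 0 < z -> 648 <= z * eps -> z ^+ 2 <= c ->
  c ^+ 4 / n%:R <= 1 / 2 ->
  pr P [set t | exceeds_between c n%:R^-1 (c ^+ 4 / n%:R) (Y t)] <= eps / 3.
Proof.
move=> n0 gY kap01 kap2 eps0 c1 z0 zeps zc u12; have nn : 0 < n%:R :> R by rewrite ltr0n.
 have c0 : 0 < c by exact: lt_trans c1.
pose sc := Num.sqrt c.
have sc2 : sc ^+ 2 = c by rewrite sqr_sqrtr// ltW.
have sc0 : 0 < sc by rewrite sqrtr_gt0.
have sc1 : 1 < sc.
  by rewrite -(ltr_pXn2r (n := 2)) ?nnegrE// ?(ltW sc0)// sc2 expr1n.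
have i0 : 0 < n%:R^-1 :> R by rewrite invr_gt0.
have uK : c ^+ 4 / n%:R < n%:R^-1 * sc ^+ 9.
  by rewrite mulrC ltr_pM2l// -sc2 -exprM exprSr ltr_pMr// exprn_gt0.
apply: le_trans (exceeds_between_range n0 gY i0 sc1 uK u12 c0 kap01) _.
rewrite divff ?gt_eqF// sqrtr1 divr1.
clearbody sc; clear uK i0; move: (c ^+ 4 / n%:R) u12 => u u12.
apply: (@le_trans _ _ (9 * expR (- (sc / 24)))).
  rewrite ler_pM2l// ler_expR lerN2.
  apply: (@le_trans _ _ (1 / 4 * (1 / 2) * c ^+ 2 / sc / (3 * c))).
    rewrite le_eqVlt; apply/orP; left; apply/eqP.
    by rewrite -sc2; field; rewrite gt_eqF.
  have c2 : 0 < c ^+ 2 by rewrite exprn_gt0.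
  apply: ler_pM.
  - by rewrite divr_ge0 ?(ltW sc0)//; clear -c2; lra.
  - by rewrite invr_ge0; clear -c0; lra.
  - rewrite ler_pM2r ?invr_gt0// ler_pM2r//.
    by apply: ler_pM => //; clear -u12; lra.
  - by rewrite lef_pV2 ?posrE; clear -c0 c1; lra.
have s24 : 0 < sc / 24 by rewrite divr_gt0.
apply: (@le_trans _ _ (9 * (sc / 24)^-1)).
  by rewrite ler_pM2l// expRN_le_inv.
have h : z <= sc.
  by rewrite -(ler_pXn2r (n := 2)) ?nnegrE ?(ltW sc0) ?(ltW z0)// sc2.
have -> : 9 * (sc / 24)^-1 = 216 / sc by field; rewrite gt_eqF.
have h2 : z * eps <= sc * eps by rewrite ler_pM2r.
rewrite ler_pdivrMr// mulrAC ler_pdivlMr//; clear -h2 zeps; lra.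
Qed.

(** The ratio of the end points is a constant, and so one block has an exponent
    of order [c^2 e1], which tends to infinity. *)
Lemma null_high_range n d (T : measurableType d) (P : probability T R) (Y : T -> 'cV[R]_n)
    (c kap : R) (eps e1 x : R) :
  (0 < n)%N -> std_gaussian P (fun i t => Y t i 0) -> 0 < kap < 1 -> 1 / 4 <= kap ^+ 2 ->
  0 < eps -> 0 < e1 -> e1 <= 1 / 8 -> 0 < x ->
  1 <= c -> c ^+ 4 <= e1 * n%:R -> x * 2 <= c ^+ 2 -> 36 / (e1 * eps) <= x ->
  pr P [set t | exceeds_between c e1 (1 / 2) (Y t)] <= eps / 3.
Proof.
move=> n0 gY kap01 kap2 eps0 e10 e18 x0 c1 c4 xc xeps; have nn : 0 < n%:R :> R by rewrite ltr0n.
 have c0 : 0 < c by exact: lt_le_trans c1.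
have r1 : 1 < e1^-1 by rewrite invf_gt1//; clear -e18; lra.
have uK : 1 / 2 < e1 * e1^-1 ^+ 1 by rewrite expr1 divff ?gt_eqF//; clear; lra.
apply: le_trans (exceeds_between_range n0 gY e10 r1 uK (lexx _) c0 kap01) _.
have -> (y : R) : 1%:R * y = y by rewrite mul1r.
rewrite invrK.
have q1 : c / Num.sqrt (n%:R * e1) <= 1.
  have ne : 0 < n%:R * e1 by rewrite mulr_gt0.
  rewrite ler_pdivrMr ?sqrtr_gt0// mul1r.
  rewrite -(ler_pXn2r (n := 2)) ?nnegrE ?sqrtr_ge0// ?(ltW c0)// sqr_sqrtr ?(ltW ne)//.
  rewrite mulrC; apply: le_trans c4; rewrite [leRHS](exprD c 2 2) ler_peMr ?sqr_ge0//.
  by rewrite exprn_ege1.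
have q0 : 0 <= c / Num.sqrt (n%:R * e1) by rewrite divr_ge0 ?sqrtr_ge0// ltW.
move: (c / Num.sqrt (n%:R * e1)) q0 q1 => q q0 q1.
have xe : 0 < x * e1 / 12 by rewrite divr_gt0// mulr_gt0.
have xe0 : 0 < x * e1 by rewrite mulr_gt0.
have ce0 : 0 < c ^+ 2 * e1 by rewrite mulr_gt0// exprn_gt0.
apply: (@le_trans _ _ (expR (- (x * e1 / 12)))).
  rewrite ler_expR lerN2.
  apply: (@le_trans _ _ (1 / 4 * (1 - 1 / 2) * c ^+ 2 * e1 / 3)).
    have : x * 2 * e1 <= c ^+ 2 * e1 by rewrite ler_pM2r.
    by clear; lra.
  apply: ler_pM.
  - by clear -ce0; lra.
  - by rewrite invr_ge0.
  - by rewrite ler_pM2r// ler_pM2r ?exprn_gt0// ler_pM2r//; clear -kap2; lra.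
  - by rewrite lef_pV2 ?posrE//; clear -q0 q1; lra.
apply: le_trans (expRN_le_inv xe) _.
have -> : (x * e1 / 12)^-1 = 12 / (x * e1) by field; rewrite !gt_eqF.
rewrite ler_pdivrMr//.
by move: xeps; rewrite ler_pdivrMr ?mulr_gt0//; clear; lra.
Qed.

(** The number of blocks of ratio [w] is at most [ln n / ln w + 1].  Losses of a factor
    [w] occur at most five times in the exponent: the discretization (twice), [1 - e1],
    the ratio of a block, and the Bernstein correction [c / sqrt(n s) <= 1 / c].
    As [w^5 <= 1 + a], one factor [1 + a] of the squared threshold pays for them, and
    the other leaves [(ln n)^-(1 + a)] per block. *)
Lemma null_mid_range n d (T : measurableType d) (P : probability T R) (Y : T -> 'cV[R]_n)
    (c kap : R) (eps a w e1 x : R) :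
  (0 < n)%N -> std_gaussian P (fun i t => Y t i 0) -> 0 < kap < 1 ->
  0 < eps -> 0 < a -> 1 < w -> w ^+ 5 <= 1 + a ->
  kap = w^-1 -> 1 - e1 = w^-1 -> e1 <= 1 / 2 -> e1 < 1 -> 0 < x -> n%:R = expR (expR x) ->
  1 <= c -> 2 + c^-1 <= 2 * w -> c ^+ 2 = 2 * (1 + a) ^+ 2 * x ->
  3 * (1 / ln w + 1) / (a * eps) <= x ->
  pr P [set t | exceeds_between c (c ^+ 4 / n%:R) e1 (Y t)] <= eps / 3.
Proof.
move=> n0 gY kap01 eps0 a0 w1 w5 kapE e1w e12 e11 x0 nE c1 cw c2 xeps.
have nn : 0 < n%:R :> R by rewrite ltr0n.
have c0 : 0 < c by exact: lt_le_trans c1.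
have w0 : 0 < w by exact: lt_trans w1.
have lw0 : 0 < ln w by exact: ln_gt0.
have sqn : Num.sqrt (n%:R * (c ^+ 4 / n%:R)) = c ^+ 2.
  rewrite mulrC divfK ?gt_eqF// (exprM c 2 2) sqrtr_sqr ger0_norm//.
  exact: sqr_ge0.
have u10 : 0 < c ^+ 4 / n%:R by rewrite divr_gt0// exprn_gt0.
pose l := expR x; have l0 : 0 < l by exact: expR_gt0.
pose K := (Num.trunc (l / ln w)).+1.
have lw : 0 <= l / ln w by rewrite divr_ge0// ltW.
have [K1 K2] : K%:R <= l / ln w + 1 /\ l / ln w < K%:R.
  have /andP[h1 h2] := truncn_itv lw; split=> //.
  by rewrite /K -natr1 lerD2r.
have uK : e1 < (c ^+ 4 / n%:R) * w ^+ K.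
  apply: (@lt_le_trans _ _ (n%:R^-1 * w ^+ K)); last first.
    rewrite ler_pM2r ?exprn_gt0// ler_peMl ?invr_ge0 ?(ltW nn)//.
    by rewrite exprn_ege1.
  rewrite ltr_pdivlMl//; apply: (@lt_le_trans _ _ n%:R).
    by rewrite gtr_pMr.
  rewrite nE -[w]lnK ?posrE// -expRM_natl ler_expR.
  by move: K2; rewrite ltr_pdivrMr// => /ltW.
apply: le_trans (exceeds_between_range n0 gY u10 w1 uK e12 c0 kap01) _.
rewrite sqn e1w kapE; clear uK u10 sqn.
have a1 : 0 < 1 + a by rewrite addr_gt0.
have ax1 : 0 <= (1 + a) * x by rewrite mulr_ge0 ?(ltW a1)// ltW.
apply: (@le_trans _ _ ((l / ln w + 1) * expR (- ((1 + a) * x)))).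
  apply: ler_pM; [exact: ler0n|exact: expR_ge0|exact: K1|].
  rewrite ler_expR lerN2.
  have -> : c / c ^+ 2 = c^-1 by field; rewrite gt_eqF.
  have c20 : 0 < 2 + c^-1 by rewrite addr_gt0// invr_gt0.
  rewrite c2 ler_pdivlMr//.
  apply: (@le_trans _ _ ((1 + a) * x * (2 * w))); first by rewrite ler_wpM2l.
  have -> : w^-1 ^+ 2 / w * (2 * (1 + a) ^+ 2 * x) / w =
     (1 + a) * x * (2 * (1 + a) / w ^+ 4) by field; rewrite gt_eqF.
  rewrite ler_wpM2l//.
  by rewrite ler_pdivlMr ?exprn_gt0// -mulrA -exprS ler_pM2l.
apply: (@le_trans _ _ ((1 / ln w + 1) * expR (- (a * x)))).
  have -> : (1 / ln w + 1) * expR (- (a * x)) =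
      ((1 / ln w + 1) * l) * expR (- ((1 + a) * x)).
    by rewrite -mulrA /l -expRD; congr (_ * expR _); ring.
  rewrite ler_wpM2r ?expR_ge0// div1r mulrDl mul1r mulrC lerD2l.
  by have := expR_ge1Dx x; rewrite -/l; clear -x0; lra.
have ax : 0 < a * x by rewrite mulr_gt0.
have lw1 : 0 < 1 / ln w + 1 by rewrite addr_gt0// divr_gt0.
apply: (@le_trans _ _ ((1 / ln w + 1) * (a * x)^-1)).
  by rewrite ler_pM2l// expRN_le_inv.
rewrite ler_pdivrMr// mulrAC ler_pdivlMr//.
by move: xeps; rewrite ler_pdivrMr ?mulr_gt0//; clear; lra.
Qed.

Lemma fifth_power_bound (v : R) : 0 < v -> v <= 1 / 8 -> (1 + v) ^+ 5 <= 1 + 8 * v.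
Proof.
move=> v0 v8.
have -> : (1 + v) ^+ 5 = 1 + v * (5 + 10 * v + 10 * v ^+ 2 + 5 * v ^+ 3 + v ^+ 4) by ring.
have p2 : v ^+ 2 <= 1 / 64 by nra.
have p3 : v ^+ 3 <= 1 / 64 by rewrite exprS; nra.
have p4 : v ^+ 4 <= 1 / 64 by rewrite exprS; nra.
by rewrite lerD2l mulrC ler_pM2r//; lra.
Qed.

(** A power of [x = ln ln n] is negligible compared with [n]; only the cubic term of
    the exponential series is needed. *)
Lemma threshold_growth (a e1 x : R) : 0 < a -> 0 < e1 -> 0 < x ->
  24 * (1 + a) ^+ 4 / e1 <= x -> 4 * (1 + a) ^+ 4 * x ^+ 2 <= e1 * expR (expR x).
Proof.
move=> a0 e10 x0 h; set l := expR x; have l0 : 0 < l by exact: expR_gt0.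
have xl : x <= l by have := expR_ge1Dx x; rewrite -/l; clear; lra.
have a14 : 0 < (1 + a) ^+ 4 by rewrite exprn_gt0// addr_gt0.
have h3 : l ^+ 3 / 6 <= expR l.
  have := expR_ge1Dxn 2 (ltW l0); rewrite (_ : 3`!%:R = 6 :> R)//.
  by clear; lra.
have h4 : 24 * (1 + a) ^+ 4 <= e1 * l.
  by rewrite [leRHS]mulrC -ler_pdivrMr//; apply: le_trans xl.
apply: (@le_trans _ _ (e1 * (l ^+ 3 / 6))); last by rewrite ler_pM2l.
apply: (@le_trans _ _ (4 * (1 + a) ^+ 4 * l ^+ 2)).
  apply: ler_wpM2l; first by rewrite mulr_ge0// ltW.
  by rewrite lerXn2r ?nnegrE ?(ltW x0) ?(ltW l0).
have : 24 * (1 + a) ^+ 4 * l ^+ 2 <= e1 * l * l ^+ 2 by rewrite ler_wpM2r ?sqr_ge0.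
have -> : e1 * (l ^+ 3 / 6) = e1 * l * l ^+ 2 / 6 by field.
by clear; lra.
Qed.

Lemma exists_scale (x e : R) : 0 < e -> exists2 z, 0 < z & x <= z * e.
Proof.
move=> e0; exists ((`|x| + 1) / e); first by rewrite divr_gt0// ltr_wpDl.
by rewrite divfK ?gt_eqF//; apply: le_trans (ler_norm x) _; rewrite lerDl.
Qed.

(** Uniform in the probability space, so that it applies to every whitened
    vector of size [n] at once. *)
Lemma null_hc (a eps : R) : 0 < a -> 0 < eps -> exists X : R, forall n,
  X <= ln (ln n%:R) -> 1 < n%:R :> R -> 1 < ln n%:R :> R ->
  forall d (T : measurableType d) (P : probability T R) (Y : T -> 'cV[R]_n),
  std_gaussian P (fun i t => Y t i 0) -> pr P [set t | hc_rejects a (Y t)] <= eps.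
Proof.
move=> a0 eps0.
pose a1 : R := Num.min a 1 / 8.
have a10 : 0 < a1 by rewrite divr_gt0// lt_min a0 ltr01.
have a18 : a1 <= 1 / 8 by rewrite ler_pM2r ?invr_gt0// ge_min lexx orbT.
have a1a : 8 * a1 <= a by rewrite /a1 mulrC divfK// ge_min lexx.
clearbody a1; pose w := 1 + a1; have w1 : 1 < w by rewrite ltrDl.
have w0 : 0 < w by exact: lt_trans w1.
pose e1 := a1 / w.
have e10 : 0 < e1 by rewrite divr_gt0.
have e18 : e1 <= 1 / 8.
  by rewrite ler_pdivrMr// /w; clear -a10 a18; nra.
have e1w : 1 - e1 = w^-1 by rewrite /e1 /w; field; rewrite gt_eqF.
have kap01 : 0 < w^-1 < 1 by rewrite invr_gt0 w0 invf_lt1.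
have kap2 : 1 / 4 <= w^-1 ^+ 2.
  by rewrite exprVn div1r lef_pV2 ?posrE ?exprn_gt0// /w; clear -a10 a18; nra.
have w5 : w ^+ 5 <= 1 + a.
  by apply: le_trans (fifth_power_bound a10 a18) _; clear -a1a; lra.
have [z z0 zeps] := exists_scale 648 eps0.
(* a lower bound for the threshold that serves all three ranges *)
pose C := 1 + 1 / (2 * a1) + z ^+ 2.
have e_1 : 0 < 1 / (2 * a1) by rewrite divr_gt0// mulr_gt0.
have e_2 : 0 <= z ^+ 2 by exact: sqr_ge0.
have C1 : 1 < C by rewrite /C; clear -e_1 e_2; lra.
have Ca : 1 / (2 * a1) <= C by rewrite /C; clear -e_1 e_2; lra.
have Ce : z ^+ 2 <= C by rewrite /C; clear -e_1 e_2; lra.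
clearbody C; clear e_1 e_2.
pose X2 := 3 * (1 / ln w + 1) / (a * eps).
pose X3 := 36 / (e1 * eps).
pose X4 := 24 * (1 + a) ^+ 4 / e1.
exists (Num.max (Num.max (1 + C ^+ 2) X2) (Num.max X3 X4)) => n.
set l := ln n%:R; set x := ln l; rewrite !ge_max => /andP[/andP[xC xX2] /andP[xX3 xX4]] n1 l1.
move=> d T P Y gY.
have nn : 0 < n%:R :> R by exact: lt_trans n1.
have n0 : (0 < n)%N by rewrite -(ltr0n R).
have l0 : 0 < l by exact: lt_trans l1.
have nE : n%:R = expR (expR x) by rewrite lnK// lnK.
pose c := hc_threshold a n.
have cE : c = (1 + a) * Num.sqrt (2 * x) by [].
have C20 : 0 <= C ^+ 2 by exact: sqr_ge0.
have x0 : 0 < x by clear -xC C20; lra.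
have xC2 : C ^+ 2 <= x by clear -xC; lra.
clearbody x; clear xC.
have c2 : c ^+ 2 = 2 * (1 + a) ^+ 2 * x.
  by rewrite cE exprMn sqr_sqrtr ?mulr_ge0// ?(ltW x0)//; ring.
have c00 : 0 <= c by rewrite cE mulr_ge0 ?sqrtr_ge0// addr_ge0 ?(ltW a0).
have a12 : 1 <= (1 + a) ^+ 2 by rewrite exprn_ege1// lerDl ltW.
have xc : x * 2 <= c ^+ 2 by rewrite c2; clear -x0 a12; nra.
have Cc : C <= c.
  rewrite -(ler_pXn2r (n := 2)) ?nnegrE// ?(le_trans ler01 (ltW C1))//.
  by clear -xc xC2 x0; lra.
have c1 : 1 < c by exact: lt_le_trans Cc.
have c0 : 0 < c by exact: lt_trans c1.
have c4 : c ^+ 4 <= e1 * n%:R.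
  rewrite (exprM c 2 2) c2 nE; apply: le_trans (threshold_growth a0 e10 x0 xX4).
  by rewrite le_eqVlt; apply/orP; left; apply/eqP; ring.
have u1e : c ^+ 4 / n%:R <= e1 by rewrite ler_pdivrMr.
have cw : 2 + c^-1 <= 2 * w.
  suff : c^-1 <= 2 * a1 by rewrite /w; clear; lra.
  have a20 : 0 < 2 * a1 by rewrite mulr_gt0.
  rewrite -[leRHS]invrK lef_pV2 ?posrE ?invr_gt0//.
  by apply: le_trans Cc; rewrite -div1r.
have b1 : pr P [set t | exceeds_between c n%:R^-1 (c ^+ 4 / n%:R) (Y t)] <= eps / 3.
  apply: (null_low_range n0 gY kap01 kap2 eps0 c1 z0 zeps); first exact: le_trans Cc.
  by apply: le_trans u1e _; clear -e18; lra.
have b2 : pr P [set t | exceeds_between c (c ^+ 4 / n%:R) e1 (Y t)] <= eps / 3.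
  apply: (null_mid_range n0 gY kap01 eps0 a0 w1 w5 _ e1w _ _ x0 nE (ltW c1) cw c2 xX2) => //.
    by clear -e18; lra.
  by clear -e18; lra.
have b3 : pr P [set t | exceeds_between c e1 (1 / 2) (Y t)] <= eps / 3.
  exact: (null_high_range n0 gY kap01 kap2 eps0 e10 e18 x0 (ltW c1) c4 xc xX3).
have [mY _] := gY.
have mE s u : measurable [set t | exceeds_between c s u (Y t)].
  exact: measurable_exceeds_between.
apply: (@le_trans _ _ (pr P ([set t | exceeds_between c n%:R^-1 (c ^+ 4 / n%:R) (Y t)] `|`
   ([set t | exceeds_between c (c ^+ 4 / n%:R) e1 (Y t)] `|`
    [set t | exceeds_between c e1 (1 / 2) (Y t)])))).
  apply: pr_le; [exact: measurable_hc_rejects|by apply: measurableU => //; apply: measurableU|].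
  move=> t /hc_rejectsP/(exceeds_between_split (c ^+ 4 / n%:R))[H|]; first by left.
  by move=> /(exceeds_between_split e1)[H|H]; right; [left|right].
apply: le_trans (pr_setU_le _ _ _) _ => //; first exact: measurableU.
apply: (@le_trans _ _ (eps / 3 + (eps / 3 + eps / 3))); last by clear; lra.
apply: lerD => //; apply: le_trans (pr_setU_le _ _ _) _ => //.
exact: lerD.
Qed.

End NullBound.

(** * Close pairs in a random support *)

Lemma card_window n b (a : nat) : (#|[set k : 'I_n | (a <= k < a + b)%N]%SET| <= b)%N.
Proof.
have [->|b0] := posnP b.
  by rewrite eq_card0// => k; rewrite !inE addn0; apply/negP; lia.
pose f (k : 'I_n) : 'I_b.-1.+1 := inord (k - a).
have inj : {in [set k : 'I_n | (a <= k < a + b)%N]%SET &, injective f}.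
  move=> k l; rewrite !inE => /andP[k1 k2] /andP[l1 l2] /(congr1 val) /=.
  rewrite !inordK; [|lia|lia] => h; apply: val_inj => /=; lia.
by rewrite -(card_in_imset inj); apply: leq_trans (max_card _) _; rewrite card_ord prednK.
Qed.

Section CloseSignals.
Context {R : realType}.
Variables (n m b : nat).
Implicit Types (s A : {set 'I_n}) (e f : 'I_n * 'I_n).
Hypothesis m_gt0 : (0 < m)%N.
Hypothesis mn : (m <= n)%N.

Definition close e := (e.1 < e.2 < e.1 + b)%N.
Definition pair_set e : {set 'I_n} := [set e.1; e.2]%SET.
Definition close_pairs s : nat := #|[set e | close e && (pair_set e \subset s)]%SET|.
Definition supersets A : nat := #|[set s : {set 'I_n} | (A \subset s) && (#|s| == m)]%SET|.

Lemma supersetsE A : (#|A| <= m)%N -> supersets A = 'C(n - #|A|, m - #|A|).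
Proof.
move=> Am; have cA : (n - #|A| = #|(~: A)%SET|)%N by have := cardsC A; rewrite card_ord; lia.
rewrite cA -cards_draws; pose F (B : {set 'I_n}) := (A :|: B)%SET.
have key (B : {set 'I_n}) : B \subset (~: A)%SET -> B = (F B :\: A)%SET.
  move=> /fintype.subsetP BA; apply/setP => x; rewrite !inE; have := BA x; rewrite inE.
  by case: (x \in A) => //=; case: (x \in B) => //= /(_ isT).
have inj : {in [set B : {set 'I_n} | (B \subset ~: A) && (#|B| == m - #|A|)%N]%SET &, injective F}.
  by move=> B B'; rewrite !inE => /andP[/key hB _] /andP[/key hB' _] FE; rewrite hB hB' FE.
rewrite -(card_in_imset inj); apply: eq_card => s; rewrite inE.
apply/andP/imsetP => [[/fintype.subsetP As /eqP sm]|[B]].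
  exists (s :\: A)%SET; last first.
    apply/setP => x; rewrite !inE; have := As x.
    by case: (x \in A) => //= ->.
  rewrite inE; apply/andP; split.
    by apply/fintype.subsetP => x; rewrite !inE => /andP[].
  rewrite cardsD (_ : (s :&: A)%SET = A) ?sm//.
  by apply/setP => x; rewrite inE; have := As x; case: (x \in A) => [->|_]; rewrite ?andbF.
rewrite inE => /andP[/fintype.subsetP BA /eqP Bm ->]; split.
  by apply/fintype.subsetP => x; rewrite inE => ->.
rewrite /F cardsU Bm (_ : (A :&: B)%SET = finset.set0) ?cards0; first by apply/eqP; lia.
by apply/setP => x; rewrite !inE; have := BA x; rewrite inE; case: (x \in A) => //=; case: (x \in B) => // /(_ isT).
Qed.

Lemma supersets0 A : (m < #|A|)%N -> supersets A = 0%N.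
Proof.
move=> mA; apply: eq_card0 => s; rewrite !inE; apply/negP => /andP[As /eqP sm].
by move: mA; rewrite -sm ltnNge subset_leq_card.
Qed.

Definition draws : R := ('C(n, m))%:R.
Definition density : R := m%:R / n%:R.

Lemma draws_gt0 : 0 < draws.
Proof. by rewrite ltr0n bin_gt0. Qed.

Let n_gt0 : (0 < n)%N. Proof. exact: leq_trans mn. Qed.

Lemma binS_ratio k : (k < m)%N ->
  ((n - k) * 'C(n - k.+1, m - k.+1) = (m - k) * 'C(n - k, m - k))%N.
Proof.
move=> km; have := mul_bin_diag (n - k) (m - k.+1).
by rewrite -subnS (_ : (m - k.+1).+1 = m - k)%N//; lia.
Qed.

(** Each of the [#|A|] prescribed elements is drawn with conditional probability
    at most [m / n]. *)
Lemma supersets_le A : (supersets A)%:R <= draws * density ^+ #|A|.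
Proof.
have p0 : 0 <= density by rewrite divr_ge0.
have [Am|mA] := leqP #|A| m; last first.
  by rewrite supersets0// mulr_ge0 ?(ltW draws_gt0)// exprn_ge0.
rewrite supersetsE//; elim: #|A| Am => [|k IH] km.
  by rewrite !subn0 expr0 mulr1.
have nk : 0 < (n - k)%:R :> R by rewrite ltr0n subn_gt0 (leq_trans km).
have -> : ('C(n - k.+1, m - k.+1))%:R = (m - k)%:R / (n - k)%:R * ('C(n - k, m - k))%:R :> R.
  rewrite mulrAC; apply/(canRL (mulfK _)); first by rewrite gt_eqF.
  by rewrite -!natrM mulnC binS_ratio.
rewrite exprS mulrCA; apply: ler_pM => //.
- rewrite /density ler_pdivrMr// mulrAC ler_pdivlMr ?ltr0n// -!natrM ler_nat.
  by rewrite !mulnBl !mulnBr; nia.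
- by apply: IH; exact: ltnW.
Qed.

(** The exact inclusion probability of a pair is [m (m - 1) / (n (n - 1))]; the loss
    [1 / n] in the second factor accounts for [m - 1]. *)
Lemma supersets2_ge A : #|A| = 2%N ->
  draws * (density * (density - n%:R^-1)) <= (supersets A)%:R.
Proof.
move=> A2; have nn : 0 < n%:R :> R by rewrite ltr0n.
have [m2|m1] := leqP 2 m; last first.
  have m1' : m = 1%N by lia.
  by rewrite (_ : density - n%:R^-1 = 0) ?mulr0// /density m1' div1r subrr.
rewrite supersetsE ?A2//.
have n1 : 0 < (n - 1)%:R :> R by rewrite ltr0n; lia.
have e1 : ('C(n - 1, m - 1))%:R = density * draws :> R.
  rewrite /density /draws mulrAC; apply/(canRL (mulfK _)); first by rewrite gt_eqF.
  have := @binS_ratio 0 (leq_trans (leqnSn 1) m2); rewrite !subn0 => h.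
  by rewrite -!natrM mulnC h.
have -> : ('C(n - 2, m - 2))%:R = (m - 1)%:R / (n - 1)%:R * (density * draws) :> R.
  rewrite -e1 mulrAC; apply/(canRL (mulfK _)); first by rewrite gt_eqF.
  by rewrite -!natrM mulnC binS_ratio.
have -> : draws * (density * (density - n%:R^-1)) = (density - n%:R^-1) * (density * draws).
  by ring.
apply: ler_wpM2r.
  by rewrite mulr_ge0 ?(ltW draws_gt0)// divr_ge0.
have -> : density - n%:R^-1 = (m - 1)%:R / n%:R by rewrite natrB// mulrBl div1r.
by rewrite ler_wpM2l// lef_pV2 ?posrE// ler_nat leq_subr.
Qed.

Lemma card_close_from (x : 'I_n) : (#|[set e | close e && (e.1 == x)]%SET| <= b)%N.
Proof.
have inj : {in [set e | close e && (e.1 == x)]%SET &, injective snd}.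
  by move=> [i j] [k l]; rewrite !inE /= => /andP[_ /eqP->] /andP[_ /eqP->] ->.
rewrite -(card_in_imset inj); apply: leq_trans (card_window n b x).
apply: subset_leq_card; apply/fintype.subsetP => k /imsetP[[i j]].
by rewrite !inE /close /= => /andP[/andP[h1 h2] /eqP ix] ->; subst i; lia.
Qed.

Lemma card_close_to (x : 'I_n) : (#|[set e | close e && (e.2 == x)]%SET| <= b)%N.
Proof.
have inj : {in [set e | close e && (e.2 == x)]%SET &, injective fst}.
  by move=> [i j] [k l]; rewrite !inE /= => /andP[_ /eqP->] /andP[_ /eqP->] ->.
rewrite -(card_in_imset inj).
pose a := (x.+1 - b)%N.
apply: leq_trans (card_window n b a).
apply: subset_leq_card; apply/fintype.subsetP => k /imsetP[[i j]].
by rewrite !inE /close /= => /andP[/andP[h1 h2] /eqP ix] ->; subst j; rewrite /a; lia.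
Qed.

Definition n_close : nat := #|[set e | close e]%SET|.

Lemma n_close_le : (n_close <= n * b)%N.
Proof.
rewrite /n_close -sum1_card (partition_big fst predT)//=.
apply: (@leq_trans (\sum_(x < n) b)); last by rewrite sum_nat_const card_ord.
apply: leq_sum => x _; apply: leq_trans (card_close_from x).
rewrite sum1_card; apply: eq_leq; apply: eq_card => e.
by rewrite [LHS]unfold_in/= !inE.
Qed.

Lemma card_pair_set e : close e -> #|pair_set e| = 2%N.
Proof.
rewrite /close => /andP[h _]; rewrite /pair_set cards2.
by rewrite -val_eqE /= ltn_eqF.
Qed.

Lemma pair_set_meet e f :
  ~~ ([disjoint pair_set e & pair_set f]) ->
  [|| f.1 == e.1, f.2 == e.1, f.1 == e.2 | f.2 == e.2].
Proof.
move=> /pred0Pn[x /andP[/=]]; rewrite !inE => /orP[/eqP->|/eqP->] /orP[/eqP->|/eqP->];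
  by rewrite eqxx ?orbT.
Qed.

Lemma card_close_meet e :
  (#|[set f | close f && ~~ [disjoint pair_set e & pair_set f]]%SET| <= 4 * b)%N.
Proof.
have sub : [set f | close f && ~~ [disjoint pair_set e & pair_set f]]%SET \subset
   ([set f | close f && (f.1 == e.1)] :|: [set f | close f && (f.2 == e.1)] :|:
   [set f | close f && (f.1 == e.2)] :|: [set f | close f && (f.2 == e.2)])%SET.
  apply/fintype.subsetP => f; rewrite !inE => /andP[cf /pair_set_meet].
  by rewrite cf /=; case/or4P => ->; rewrite ?orbT.
apply: leq_trans (subset_leq_card sub) _.
have h1 := card_close_from e.1; have h2 := card_close_to e.1.
have h3 := card_close_from e.2; have h4 := card_close_to e.2.
rewrite (_ : 4 * b = b + b + b + b)%N; last by lia.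
apply: leq_trans (leq_card_setU _ _) _; apply: leq_add => //.
apply: leq_trans (leq_card_setU _ _) _; apply: leq_add => //.
by apply: leq_trans (leq_card_setU _ _) _; apply: leq_add.
Qed.

Lemma pair_set_inj e f : close e -> close f -> pair_set e = pair_set f -> e = f.
Proof.
case: e f => [i j] [k l]; rewrite /close /pair_set /= => /andP[ij _] /andP[kl _] /setP H.
have := H i; have := H j; have := H k; have := H l.
rewrite !inE !eqxx !orbT /= -!val_eqE /= => hl hk hj hi.
have vik : i = k :> nat by lia.
have vjl : j = l :> nat by lia.
by congr pair; apply: val_inj.
Qed.

(** Two close pairs together have four, three or two elements according to
    whether they are disjoint, meet in one element, or coincide. *)
Lemma supersets_pair_le e f : close e -> close f ->
  (supersets (pair_set e :|: pair_set f))%:R <=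
  draws * (density ^+ 4 +
    (if [disjoint pair_set e & pair_set f] then 0 else density ^+ 3) +
    (if e == f then density ^+ 2 else 0)).
Proof.
move=> ce cf; apply: le_trans (supersets_le _) _.
have p0 : 0 <= density by rewrite divr_ge0.
apply: ler_wpM2l; first exact: ltW draws_gt0.
have dU : #|(pair_set e :|: pair_set f)%SET| = (4 - #|(pair_set e :&: pair_set f)%SET|)%N.
  by rewrite cardsU !card_pair_set.
case: ifP => [d|/negbT d].
  move: (d); rewrite -setI_eq0 => /eqP d'; rewrite dU d' cards0 subn0 addr0 lerDl.
  by case: ifP => // _; exact: exprn_ge0.
have I1 : (0 < #|(pair_set e :&: pair_set f)%SET|)%N.
  by rewrite card_gt0 setI_eq0.
case: eqP => [ef|ef].
  rewrite ef finset.setUid card_pair_set// lerDr addr_ge0// exprn_ge0//.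
have U3 : (2 < #|(pair_set e :|: pair_set f)%SET|)%N.
  rewrite ltnNge; apply/negP => U2.
  have eU : pair_set e = (pair_set e :|: pair_set f)%SET.
    by apply/eqP; rewrite eqEcard finset.subsetUl card_pair_set.
  have fU : pair_set f = (pair_set e :|: pair_set f)%SET.
    by apply/eqP; rewrite eqEcard finset.subsetUr card_pair_set.
  have ef' : pair_set e = pair_set f by rewrite {1}eU -fU.
  by apply: ef; apply: pair_set_inj.
have -> : #|(pair_set e :|: pair_set f)%SET| = 3%N by lia.
by rewrite addr0 lerDr exprn_ge0.
Qed.

Definition draw_sum (F : {set 'I_n} -> R) : R := \sum_(s : {set 'I_n} | #|s| == m) F s.

Lemma close_pairsE s : (close_pairs s)%:R = \sum_(e | close e) (pair_set e \subset s)%:R :> R.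
Proof.
rewrite /close_pairs -sum1_card natr_sum big_mkcond [RHS]big_mkcond/=.
apply: eq_bigr => e _; rewrite inE; case: (close e) => //=.
by case: (_ \subset _).
Qed.

Lemma supersets_sum A : (supersets A)%:R = draw_sum (fun s => (A \subset s)%:R).
Proof.
rewrite /supersets -sum1_card natr_sum /draw_sum big_mkcond [RHS]big_mkcond/=.
apply: eq_bigr => s _; rewrite inE andbC; case: (_ == _) => //=.
by case: (_ \subset _).
Qed.

Lemma draw_sum1 : draw_sum (fun=> 1) = draws.
Proof.
have h := card_draws 'I_n m; rewrite card_ord in h.
rewrite /draw_sum /draws -h -sum1_card natr_sum.
by apply: eq_bigl => s; rewrite inE.
Qed.

(** Second moment about [n_close * density^2].  The disjoint pairs of pairs cancel
    against the square of the mean.  A pair meets at most [4 b] close pairs, so the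
    others contribute at most [K p^2 (1 + 4 b p)] with [K p <= n b p], where
    [b p <= 2/5]; the loss [1 / n] in the first moment adds [2 K^2 p^3 / n]. *)
Lemma close_pairs_variance : 5 * (b * m)%:R <= 2 * n%:R :> R ->
  draw_sum (fun s => ((close_pairs s)%:R - n_close%:R * density ^+ 2) ^+ 2) <= draws * (2 * m%:R).
Proof.
move=> bm; set K : R := n_close%:R; set p := density.
have nn : 0 < n%:R :> R by rewrite ltr0n.
have p0 : 0 <= p by rewrite divr_ge0.
have dr0 := draws_gt0.
have mE : m%:R = n%:R * p by rewrite /p /density mulrC divfK// gt_eqF.
have bp : b%:R * p <= 2 / 5.
  by rewrite /p /density mulrA ler_pdivrMr// -natrM; lra.
have bp0 : 0 <= b%:R * p by rewrite mulr_ge0.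
have KE : K = \sum_(e | close e) 1.
  by rewrite /K /n_close -sum1_card natr_sum; apply: eq_bigl => e; rewrite inE.
have Knb : K <= n%:R * b%:R by rewrite -natrM ler_nat n_close_le.
have K0 : 0 <= K by [].
have S1 : draws * (K * (p * (p - n%:R^-1))) <= draw_sum (fun s => (close_pairs s)%:R).
  have -> : draw_sum (fun s => (close_pairs s)%:R) = \sum_(e | close e) (supersets (pair_set e))%:R.
    under [RHS]eq_bigr do rewrite supersets_sum.
    by rewrite /draw_sum exchange_big/=; apply: eq_bigr => s _; exact: close_pairsE.
  rewrite mulrCA KE mulr_suml; apply: ler_sum => e ce.
  by rewrite mul1r; apply: supersets2_ge; exact: card_pair_set.
have S2 : draw_sum (fun s => (close_pairs s)%:R ^+ 2) <=
    draws * (K * (K * p ^+ 4 + 4 * b%:R * p ^+ 3 + p ^+ 2)).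
  have -> : draw_sum (fun s => (close_pairs s)%:R ^+ 2) =
      \sum_(e | close e) \sum_(f | close f) (supersets (pair_set e :|: pair_set f))%:R.
    under [RHS]eq_bigr do under eq_bigr do rewrite supersets_sum.
    under [RHS]eq_bigr do rewrite /draw_sum exchange_big/=.
    rewrite [RHS]exchange_big/=; apply: eq_bigr => s _.
    rewrite expr2 close_pairsE mulr_suml; apply: eq_bigr => e _.
    rewrite mulr_sumr; apply: eq_bigr => f _.
    by rewrite (finset.subUset s (pair_set e) (pair_set f)) -natrM mulnb.
  rewrite mulrCA [X in X * _]KE mulr_suml; apply: ler_sum => e ce; rewrite mul1r.
  apply: (@le_trans _ _ (\sum_(f | close f) draws * (p ^+ 4 +
    (if [disjoint pair_set e & pair_set f] then 0 else p ^+ 3) +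
    (if e == f then p ^+ 2 else 0)))).
    by apply: ler_sum => f cf; exact: supersets_pair_le.
  rewrite -mulr_sumr ler_pM2l// !big_split/=; apply: lerD; first apply: lerD.
  - by rewrite KE mulr_suml; apply: ler_sum => f _; rewrite mul1r.
  - rewrite -(natrM _ 4).
    apply: (@le_trans _ _ ((#|[set f | close f && ~~ [disjoint pair_set e & pair_set f]]%SET|)%:R * p ^+ 3)); last first.
      by rewrite ler_wpM2r ?exprn_ge0// ler_nat card_close_meet.
    rewrite -sum1_card natr_sum mulr_suml big_mkcond [leRHS]big_mkcond/=.
    apply: ler_sum => f _; rewrite inE; case: (close f) => //=.
    by case: ifP => _ //=; rewrite mul1r.
  - rewrite (bigD1 e)//= eqxx big1 ?addr0// => f /andP[_ fe].
    by rewrite eq_sym (negbTE fe).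
have -> : draw_sum (fun s => ((close_pairs s)%:R - K * p ^+ 2) ^+ 2) =
   draw_sum (fun s => (close_pairs s)%:R ^+ 2) -
   2 * (K * p ^+ 2) * draw_sum (fun s => (close_pairs s)%:R) + (K * p ^+ 2) ^+ 2 * draws.
  rewrite -draw_sum1 /draw_sum !mulr_sumr -sumrN -!big_split/=.
  by apply: eq_bigr => s _; ring.
have Kp0 : 0 <= 2 * (K * p ^+ 2) by rewrite !mulr_ge0// sqr_ge0.
have S1' := ler_wpM2l Kp0 S1.
apply: (@le_trans _ _ (draws * (K * (4 * b%:R * p ^+ 3 + p ^+ 2) + 2 * K ^+ 2 * p ^+ 3 / n%:R))).
  have -> : draws * (K * (4 * b%:R * p ^+ 3 + p ^+ 2) + 2 * K ^+ 2 * p ^+ 3 / n%:R) =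
    draws * (K * (K * p ^+ 4 + 4 * b%:R * p ^+ 3 + p ^+ 2)) -
    2 * (K * p ^+ 2) * (draws * (K * (p * (p - n%:R^-1)))) + (K * p ^+ 2) ^+ 2 * draws by ring.
  by rewrite lerD2r lerB.
rewrite ler_pM2l//.
have Kp : K * p <= 2 / 5 * n%:R.
  apply: (@le_trans _ _ (n%:R * b%:R * p)); first by rewrite ler_wpM2r.
  by rewrite -mulrA mulrC ler_wpM2r.
have -> : K * (4 * b%:R * p ^+ 3 + p ^+ 2) + 2 * K ^+ 2 * p ^+ 3 / n%:R =
  (K * p) * (p * (4 * (b%:R * p) + 1)) * p ^+ 0 + 2 * (K * p) * (K * p / n%:R) * p by ring.
have Kpn : K * p / n%:R <= 2 / 5 by rewrite ler_pdivrMr.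
have Kpn0 : 0 <= K * p / n%:R by rewrite !mulr_ge0// invr_ge0 ltW.
have Kp00 : 0 <= K * p by rewrite mulr_ge0.
have np0 : 0 <= n%:R * p by rewrite mulr_ge0.
rewrite expr0 mulr1 mE.
have h1 : K * p * (p * (4 * (b%:R * p) + 1)) <= 2 / 5 * n%:R * (p * (13 / 5)).
  apply: ler_pM => //; first by rewrite mulr_ge0//; lra.
  by rewrite ler_wpM2l//; lra.
have h2 : 2 * (K * p) * (K * p / n%:R) * p <= 2 * (2 / 5 * n%:R) * (2 / 5) * p.
  rewrite ler_wpM2r//; apply: ler_pM => //; first by rewrite mulr_ge0.
  by rewrite ler_pM2l.
lra.
Qed.

(** Chebyshev's inequality: the reference value [n_close * density^2] is at most
    [2 m / 5], at distance [m / 10] from [m / 2]. *)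
Lemma many_close_pairs_rare : 5 * (b * m)%:R <= 2 * n%:R :> R ->
  (#|[set s : {set 'I_n} | (#|s| == m) && (m <= 2 * close_pairs s)%N]%SET|)%:R <= draws * (200 / m%:R) :> R.
Proof.
move=> bm; have V := close_pairs_variance bm.
have nn : 0 < n%:R :> R by rewrite ltr0n.
have mm : 0 < m%:R :> R by rewrite ltr0n.
have dr0 := draws_gt0.
rewrite -(ler_pM2r (_ : 0 < m%:R ^+ 2 / 100)) ?divr_gt0 ?exprn_gt0//.
have -> : draws * (200 / m%:R) * (m%:R ^+ 2 / 100) = draws * (2 * m%:R).
  by field; rewrite gt_eqF.
apply: le_trans V.
rewrite -sum1_card natr_sum mulr_suml /draw_sum big_mkcond [leRHS]big_mkcond/=.
apply: ler_sum => s _; rewrite inE; case: (_ == _) => //=.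
case: ifP => [ms|_]; last exact: sqr_ge0.
have p0 : 0 <= density by rewrite divr_ge0.
have Kp : n_close%:R * density ^+ 2 <= 2 / 5 * m%:R.
  apply: (@le_trans _ _ ((n * b)%:R * density ^+ 2)).
    by rewrite ler_wpM2r ?sqr_ge0// ler_nat n_close_le.
  have -> : (n * b)%:R * density ^+ 2 = (b * m)%:R * m%:R / n%:R.
    by rewrite /density !natrM; field; rewrite gt_eqF.
  by rewrite ler_pdivrMr// mulrAC ler_wpM2r//; lra.
have D : m%:R <= 2 * (close_pairs s)%:R :> R by rewrite -natrM ler_nat.
have -> : 1 * (m%:R ^+ 2 / 100) = (m%:R / 10) ^+ 2 :> R by field.
by rewrite lerXn2r ?nnegrE ?divr_ge0//; lra.
Qed.

Definition clean (s : {set 'I_n}) (j : 'I_n) : bool :=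
  (j \in s) && [forall i in s, ~~ (i < j < i + b)%N].

(** A signal that is not clean is the second element of a close pair. *)
Lemma card_clean s : #|s| = m -> (2 * close_pairs s < m)%N ->
  (m <= 2 * #|[set j | clean s j]%SET|)%N.
Proof.
move=> sm D.
suff : (#|s :\: [set j | clean s j]| <= close_pairs s)%N.
  have sub : ([set j | clean s j]%SET \subset s)%SET.
    by apply/fintype.subsetP => j; rewrite inE => /andP[].
  rewrite cardsD (finset.setIidPr sub) sm.
  by move: D; move: #|_| (close_pairs s) => q D; lia.
apply: (@leq_trans #|snd @: [set e | close e && (pair_set e \subset s)]%SET|); last exact: leq_imset_card.
apply: subset_leq_card; apply/fintype.subsetP => j; rewrite !inE /clean => /andP[nc js].
move: nc; rewrite js/= negb_forall => /existsP[i]; rewrite negb_imply negbK => /andP[is_ ij].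
apply/imsetP; exists (i, j) => //; rewrite inE /close /= ij/=.
by apply/fintype.subsetP => x; rewrite !inE => /orP[/eqP->|/eqP->].
Qed.

End CloseSignals.

(** * Higher criticism of shifted white noise *)

Section ShiftedAcceptance.
Context {R : realType}.

(** Evaluate at the largest p-value below [p0]: the count there is the same as at
    [p0], while the null mean and deviation are smaller. *)
Lemma exceeds_of_count (c p0 p1 : R) n (Y : 'cV[R]_n) :
  0 <= c -> n%:R^-1 <= p1 -> p0 <= 1 / 2 ->
  (exists k, p1 <= p_value (Y k 0) <= p0) ->
  n%:R * p0 + c * Num.sqrt (n%:R * p0) < (p_count Y p0)%:R ->
  exceeds_between c n%:R^-1 (1 / 2) Y.
Proof.
move=> c0 np1 p02 [k /andP[k1 k2]] HN.
have [i Pi imax] := @arg_maxP _ R 'I_n k (fun i => p_value (Y i 0) <= p0)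
  (fun i => p_value (Y i 0)) k2.
set x := p_value (Y i 0) in Pi imax.
have kx : p1 <= x by apply: le_trans k1 _; exact: imax.
have x0 : 0 <= x by exact: p_value_ge0.
exists i; rewrite -/x (le_trans np1 kx) (le_trans Pi p02); split=> //.
have NE : p_count Y x = p_count Y p0.
  apply: eq_card => j; rewrite !inE; apply/idP/idP => [/le_trans->//|jp].
  exact: imax.
rewrite /exceeds NE.
have nn : 0 <= n%:R :> R by [].
have h1 : n%:R * x <= n%:R * p0 by rewrite ler_wpM2l.
have h2 : c * Num.sqrt (n%:R * x * (1 - x)) <= c * Num.sqrt (n%:R * p0).
  rewrite ler_wpM2l// ler_wsqrtr//; apply: le_trans h1.
  by rewrite ler_piMr ?mulr_ge0//; lra.
lra.
Qed.

(** [(Q - z)^2 / Q] increases with [Q >= z], so that a lower bound on the excess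
    [Q - z] may be inserted. *)
Lemma chernoff_exponent_mono (z D Q g : R) : 0 <= z -> 0 < D -> z + D <= Q -> g <= D / 2 ->
  D ^+ 2 / (16 * (z + D)) <= (Q - (z + g)) ^+ 2 / (4 * Q).
Proof.
move=> z0 D0 DQ gD; have Q0 : 0 < Q by lra.
have zD0 : 0 < z + D by lra.
have h2 : ((Q - z) / 2) ^+ 2 <= (Q - (z + g)) ^+ 2 by rewrite lerXn2r ?nnegrE; lra.
apply: (@le_trans _ _ (((Q - z) / 2) ^+ 2 / (4 * Q))); last first.
  by rewrite ler_pM2r// invr_gt0; lra.
rewrite ler_pdivrMr ?mulr_gt0// mulrAC ler_pdivlMr ?mulr_gt0//.
have [E EE] : exists E, Q = z + E by exists (Q - z); ring.
rewrite {}EE in DQ Q0 *; rewrite [z + E - z]addrC addKr.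
have DE : D <= E by lra.
have a1 : D ^+ 2 <= E ^+ 2 by rewrite lerXn2r ?nnegrE; lra.
have a2 : 0 <= D * E * (E - D) by apply: mulr_ge0; [apply: mulr_ge0|]; lra.
have a3 : D ^+ 2 * z <= E ^+ 2 * z by rewrite ler_wpM2r.
have -> : (E / 2) ^+ 2 * (16 * (z + D)) = 4 * (E ^+ 2 * z + E ^+ 2 * D) by rewrite !expr2; field.
have -> : D ^+ 2 * (4 * (z + E)) = 4 * (D ^+ 2 * z + D ^+ 2 * E) by rewrite !expr2; ring.
by rewrite ler_pM2l// lerD//; rewrite !expr2 in a2 *; lra.
Qed.

Variables (n : nat) (d : measure_display) (T : measurableType d) (P : probability T R).
Variables (W : 'I_n -> T -> R) (nu : 'I_n -> R).
Hypothesis gW : std_gaussian P W.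

Let Y (t : T) : 'cV[R]_n := \col_k (nu k + W k t).

Definition exceed_prob (t : R) (k : 'I_n) : R := gauss_pr [set w : R | t <= `|w + nu k|].

Lemma measurable_shift_abs_ge (t v : R) : measurable [set w : R | t <= `|w + v|].
Proof.
rewrite -[X in measurable X]/((fun w => w + v) @^-1` [set w : R | t <= `|w|]).
by apply: measurable_shift; exact: measurable_abs_ge.
Qed.

Lemma exceed_prob_ge_p_value (t : R) k : 0 <= t -> p_value t <= exceed_prob t k.
Proof. exact: gauss_pr_shift_abs_ge. Qed.

Lemma count_lower_tail (t y : R) (Q := \sum_k exceed_prob t k) :
  0 <= t -> 0 < Q -> y <= Q ->
  pr P [set x | (p_count (Y x) (p_value t))%:R <= y] <= expR (- ((Q - y) ^+ 2 / (4 * Q))).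
Proof.
move=> t0 Q0 yQ.
pose cell (k : 'I_n) (w : R) := t <= `|w + nu k|.
have mc k (x : bool) : measurable [set w | cell k w = x].
  case: x; first exact: measurable_shift_abs_ge.
  rewrite (_ : [set w | _] = ~` [set w | cell k w]).
    by apply: measurableC; exact: measurable_shift_abs_ge.
  by apply/seteqP; split => w /=; [move=> ->|move/negP/negbTE].
have -> : [set x | (p_count (Y x) (p_value t))%:R <= y] =
    [set x | (#|[set k | [ffun k => cell k (W k x)] k]%SET|)%:R <= y].
  apply/seteqP; split => x /=; congr (_%:R <= y); apply: eq_card => k;
    by rewrite !inE ffunE mxE /cell p_value_le_iff// addrC.
rewrite (std_gaussian_discrete (fun f : {ffun 'I_n -> bool} => (#|[set k | f k]%SET|)%:R <= y) gW mc).
have q01 k : 0 <= exceed_prob t k <= 1.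
  by rewrite gauss_pr_ge0 gauss_pr_le1//; exact: measurable_shift_abs_ge.
apply: le_trans (bernoulli_lower_tail q01 Q0 yQ).
apply: ler_sum => f _; apply: ler_prod => k _; rewrite gauss_pr_ge0 /=.
case: (f k) => //; rewrite (_ : [set w | _] = ~` [set w | cell k w]).
  by rewrite gauss_prC//; exact: measurable_shift_abs_ge.
by apply/seteqP; split => w /=; [move=> ->|move/negP/negbTE].
Qed.

Lemma measurable_no_p_value (u v : R) :
  measurable [set x | ~ exists k, u <= p_value (Y x k 0) <= v].
Proof.
have [mW _] := gW.
have -> : [set x | ~ exists k, u <= p_value (Y x k 0) <= v] =
    [set x | forall k, true -> (~` [set x | u <= p_value (Y x k 0) <= v]) x].
  apply/seteqP; split => x /= H; first by move=> k _ h; apply: H; exists k.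
  by move=> [k h]; apply: (H k).
apply: measurable_forall => k _; apply: measurableC.
have mp : measurable_fun setT (fun x => p_value (Y x k 0)).
  by apply: measurable_p_value; under eq_fun do rewrite mxE; exact: measurable_funD.
rewrite -[X in measurable X]setTI.
have mb : measurable_fun setT (fun x => u <= p_value (Y x k 0) <= v).
  by apply: measurable_and; exact: measurable_fun_ler.
exact: (mb measurableT [set true]).
Qed.

(** Independence over [G], and [1 - q <= exp(- q)]. *)
Lemma no_moderate_p_value (t q2 : R) (G : {set 'I_n}) : 0 <= t ->
  (forall k, k \in G -> q2 <= gauss_pr [set w : R | t <= `|w + nu k| < t + 1]) ->
  pr P [set x | ~ exists k, p_value (t + 1) <= p_value (Y x k 0) <= p_value t] <=
  expR (- (q2 * #|G|%:R)).
Proof.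
move=> t0 Gq; have [mW PW] := gW.
pose I (v : R) := [set w : R | t <= `|w + v| < t + 1].
have mI v : measurable (I v).
  rewrite -[X in measurable X]/((fun w => w + v) @^-1` [set w : R | t <= `|w| < t + 1]).
  by apply: measurable_shift; exact: measurable_abs_itv.
pose B k : set R := if k \in G then ~` I (nu k) else setT.
have mB k : measurable (B k) by rewrite /B; case: ifP => // _; exact: measurableC.
have mset : measurable [set x | forall k, B k (W k x)].
  rewrite (_ : [set x | _] = [set x | forall k, true -> B k (W k x)]).
    apply: measurable_forall => k _; rewrite -[X in measurable X]setTI.
    exact: (mW k _ (B k)).
  by apply/seteqP; split => x /= H k; [move=> _|]; exact: H.
apply: (@le_trans _ _ (pr P [set x | forall k, B k (W k x)])).
  apply: pr_le => //.
    exact: measurable_no_p_value.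
  move=> x /= H k; rewrite /B; case: ifP => // _ /andP[h1 h2]; apply: H; exists k.
  rewrite mxE [nu k + _]addrC -(p_value_norm (W k x + _)); apply/andP; split; last first.
    by rewrite p_value_le_iff// normr_id.
  move: h2; rewrite le_eqVlt => h2; apply/orP; right.
  by apply: p_value_decr.
rewrite PW//.
apply: (@le_trans _ _ (\prod_(k in G) expR (- q2))).
  rewrite [leRHS]big_mkcond/=; apply: ler_prod => k _; rewrite gauss_pr_ge0/= /B.
  case: ifP => [kG|_]; last by rewrite gauss_prT.
  rewrite gauss_prC//; have := Gq k kG; have := expR_ge1Dx (- q2); rewrite -/(I (nu k)); lra.
by rewrite prodr_const mulrC -mulrN expRM_natl.
Qed.

(** [D] is the guaranteed surplus of the mean count at level [p0].  Acceptance
    forces either a count below its mean by [D / 2] or the absence of p-values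
    between [p_value (t + 1)] and [p0]. *)
Lemma shifted_accept (c t q1 q2 M : R) (J G : {set 'I_n}) (p0 := p_value t)
    (D := M * (q1 - p0)) :
  0 <= c -> 0 <= t -> n%:R^-1 <= p_value (t + 1) -> p0 <= 1 / 2 ->
  p0 < q1 -> 0 < M -> M <= #|J|%:R ->
  (forall k, k \in J -> q1 <= exceed_prob t k) ->
  (forall k, k \in G -> q2 <= gauss_pr [set w : R | t <= `|w + nu k| < t + 1]) ->
  c * Num.sqrt (n%:R * p0) <= D / 2 ->
  pr P [set x | ~ exceeds_between c n%:R^-1 (1 / 2) (Y x)] <=
  expR (- (D ^+ 2 / (16 * (n%:R * p0 + D)))) + expR (- (q2 * #|G|%:R)).
Proof.
move=> c0 t0 np1 p02 pq M0 MJ HJ HG cD.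
have [mW _] := gW.
have mY k : measurable_fun setT (fun x => Y x k 0).
  by under eq_fun do rewrite mxE; exact: measurable_funD.
have p00 : 0 <= p0 by exact: p_value_ge0.
have D0 : 0 < D by rewrite mulr_gt0// subr_gt0.
pose Q := \sum_k exceed_prob t k.
have np00 : 0 <= n%:R * p0 by rewrite mulr_ge0.
have QD : n%:R * p0 + D <= Q.
  have -> : n%:R * p0 = \sum_(k < n) p0 by rewrite sumr_const card_ord mulr_natl.
  apply: (@le_trans _ _ (\sum_(k < n) p0 + \sum_(k in J) (q1 - p0))).
    rewrite lerD2l sumr_const -mulr_natl ler_wpM2r//; lra.
  rewrite [X in _ + X]big_mkcond/= -big_split/=; apply: ler_sum => k _.
  case: ifP => kJ; last by rewrite addr0; exact: exceed_prob_ge_p_value.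
  by have := HJ k kJ; lra.
pose y := n%:R * p0 + c * Num.sqrt (n%:R * p0).
have Q0 : 0 < Q by lra.
have yQ : y <= Q by rewrite /y; lra.
have mcount : measurable [set x | (p_count (Y x) p0)%:R <= y].
  have -> : [set x | (p_count (Y x) p0)%:R <= y] =
     [set x | exists2 K : {set 'I_n}, (#|K|%:R <= y) &
       forall k : 'I_n, true -> (p_value (Y x k 0) <= p0) = (k \in K)].
    apply/seteqP; split => x /=.
      by move=> H; exists [set k | p_value (Y x k 0) <= p0]%SET => // k _; rewrite inE.
    move=> [K Ky HK]; rewrite /p_count (_ : [set k | _]%SET = K)//.
    by apply/setP => k; rewrite inE HK.
  apply: measurable_exists => K _; apply: measurable_forall => k _.
  have ml : measurable_fun setT (fun x => p_value (Y x k 0) <= p0).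
    by apply: measurable_fun_ler => //; exact: measurable_p_value.
  by rewrite -[X in measurable X]setTI; exact: (ml measurableT [set k \in K]).
have mex : measurable [set x | ~ exists k, p_value (t + 1) <= p_value (Y x k 0) <= p0].
  exact: measurable_no_p_value.
apply: (@le_trans _ _ (pr P ([set x | (p_count (Y x) p0)%:R <= y] `|`
   [set x | ~ exists k, p_value (t + 1) <= p_value (Y x k 0) <= p0]))).
  apply: pr_le; [|exact: measurableU|].
    by apply: measurableC; exact: measurable_exceeds_between.
  move=> x /= Hx; have [h|h] := leP (p_count (Y x) p0)%:R y; [by left|right => Hk].
  by apply: Hx; apply: exceeds_of_count Hk h.
apply: le_trans (pr_setU_le _ mcount mex) _; apply: lerD; last exact: no_moderate_p_value.
apply: le_trans (count_lower_tail t0 Q0 yQ) _.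
rewrite ler_expR lerN2.
exact: chernoff_exponent_mono.
Qed.

End ShiftedAcceptance.

(** * Power at a level adapted to the signal strength *)

Section GaussianWindows.
Context {R : realType}.
Local Notation peak := (@normal_peak R 1).

Lemma gauss_pr_window (x M : R) : `|x| <= M -> `|x + 1| <= M ->
  peak * expR (- (M ^+ 2 / 2)) <= gauss_pr `[x, x + 1[.
Proof.
move=> xM x1M; have := @gauss_pr_itv_lb _ x (x + 1) M true true.
by rewrite addrAC subrr add0r mulr1; apply=> //; rewrite ltrDl.
Qed.

Lemma peak_le2 : peak <= 2.
Proof.
have := @gauss_pr_window 0 1; rewrite add0r normr0 normr1 => /(_ ler01 (lexx _)) H.
have {}H : peak * expR (- (1 ^+ 2 / 2)) <= 1.
  by apply: le_trans H _; apply: gauss_pr_le1.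
have := expR_ge1Dx (- (1 ^+ 2 / 2) : R); rewrite expr1n => h2; rewrite expr1n in H.
have := ler_wpM2l (ltW peak_gt0) h2; lra.
Qed.

Lemma gauss_pr_itv_shift_abs (t v M : R) : `|t - v| <= M -> `|t - v + 1| <= M -> 0 <= t ->
  peak * expR (- (M ^+ 2 / 2)) <= gauss_pr [set w : R | t <= `|w + v| < t + 1].
Proof.
move=> h1 h2 t0; apply: le_trans (gauss_pr_window h1 h2) _.
apply: gauss_pr_le => //.
  rewrite -[X in measurable X]/((fun w => w + v) @^-1` [set w : R | t <= `|w| < t + 1]).
  by apply: measurable_shift; exact: measurable_abs_itv.
move=> w /=; rewrite in_itv/= => /andP[w1 w2].
by rewrite ger0_norm; [apply/andP; split|]; lra.
Qed.

Lemma exceed_prob_ge n (nu : 'I_n -> R) k (t v M : R) : v <= nu k ->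
  `|t - v| <= M -> `|t - v + 1| <= M ->
  peak * expR (- (M ^+ 2 / 2)) <= exceed_prob nu t k.
Proof.
move=> vk h1 h2; apply: le_trans (gauss_pr_window h1 h2) _.
apply: gauss_pr_le => //; first exact: measurable_shift_abs_ge.
move=> w /=; rewrite in_itv/= => /andP[w1 w2].
by apply: le_trans (ler_norm _); lra.
Qed.

Lemma p_value_ge (t M : R) : 0 <= t -> t + 1 <= M -> peak * expR (- (M ^+ 2 / 2)) <= p_value t.
Proof.
move=> t0 tM; have := @exceed_prob_ge 1 (fun=> 0) ord0 t 0 M (lexx _).
rewrite subr0 !ger0_norm ?addr_ge0// => H.
apply: le_trans (H _ _) _ => //; first by lra.
rewrite /exceed_prob p_valueE.
apply: gauss_pr_le; [exact: measurable_shift_abs_ge|exact: measurable_abs_ge|].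
by move=> w /=; rewrite addr0 [`|t|]ger0_norm.
Qed.

End GaussianWindows.

Section Detection.
Context {R : realType}.
Local Notation peak := (@normal_peak R 1).

(** In the application [B^2] and [k B E^3] are the orders of the null mean and of the
    surplus.  Both [D^2 / x] and [D] are then of order [E] at least. *)
Lemma chernoff_rate (k B E D x : R) : 0 < k <= 1 -> 1 <= B -> 1 <= E -> 0 <= x ->
  x <= 2 * B ^+ 2 -> k * B * E ^+ 3 <= D ->
  k ^+ 2 * E / 48 <= D ^+ 2 / (16 * (x + D)).
Proof.
move=> /andP[k0 k1] B1 E1 x0 xB DB.
have B0 : 0 < B by apply: lt_le_trans B1.
have E0 : 0 < E by apply: lt_le_trans E1.
have E30 : 0 < E ^+ 3 by rewrite exprn_gt0.
have kE0 : 0 < k * E ^+ 3 by rewrite mulr_gt0.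
have z0 : 0 < k * B * E ^+ 3 by rewrite !mulr_gt0.
have D0 : 0 < D by apply: lt_le_trans DB.
have xD : 0 < x + D by lra.
have xD16 : 0 < 16 * (x + D) by rewrite mulr_gt0.
rewrite ler_pdivlMr//.
have EE3 : E <= E ^+ 3 by rewrite exprS ler_peMr ?(ltW E0)// exprn_ege1.
have B2 : 0 <= B ^+ 2 by exact: sqr_ge0.
have k20 : 0 <= k ^+ 2 by exact: sqr_ge0.
have E31 : 1 <= E ^+ 3 by rewrite exprn_ege1.
have s1 : k ^+ 2 * E * x <= 2 * D ^+ 2.
  apply: (@le_trans _ _ (k ^+ 2 * E * (2 * B ^+ 2))).
    by rewrite ler_wpM2l// mulr_ge0 ?(ltW E0).
  have : (k * B * E ^+ 3) ^+ 2 <= D ^+ 2 by rewrite lerXn2r ?nnegrE ?(ltW z0) ?(ltW D0).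
  have -> : (k * B * E ^+ 3) ^+ 2 = (k ^+ 2 * B ^+ 2) * (E ^+ 3 * E ^+ 3) by ring.
  have : (k ^+ 2 * B ^+ 2) * E <= (k ^+ 2 * B ^+ 2) * (E ^+ 3 * E ^+ 3).
    apply: ler_wpM2l; [exact: mulr_ge0|apply: le_trans EE3 _].
    by rewrite ler_peMr// ltW.
  by clear; lra.
have s2 : k ^+ 2 * E * D <= D ^+ 2.
  rewrite [D ^+ 2]expr2 ler_pM2r//; apply: le_trans DB.
  rewrite expr2 -!mulrA ler_pM2l//; apply: ler_pM => //.
  - exact: ltW.
  - exact: ltW.
  - exact: le_trans k1 _.
have -> : k ^+ 2 * E / 48 * (16 * (x + D)) = (k ^+ 2 * E * x + k ^+ 2 * E * D) / 3 by field.
clear -s1 s2; lra.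
Qed.

Variables (n : nat) (d : measure_display) (T : measurableType d) (P : probability T R).
Variables (W : 'I_n -> T -> R) (nu : 'I_n -> R) (J G : {set 'I_n}).
Variables (a beta kap sig h zeta l eps dlt : R).
Hypothesis gW : std_gaussian P W.
Hypotheses (nE : n%:R = expR l) (l0 : 0 < l).
Hypotheses (a0 : 0 < a) (eps01 : 0 < eps <= 1) (dlt0 : 0 <= dlt <= zeta).
Hypotheses (kap0 : 0 < kap) (ksig : kap < sig) (sig1 : sig < 1).
Hypothesis beta_half : 1 / 2 < beta.
Hypotheses (h0 : 0 < h)
  (hE : 4 * h = 1 / 2 - beta + 2 * sig * kap - kap ^+ 2 - sig ^+ 2 / 2).
Hypotheses (zeta0 : 0 < zeta) (zeta1 : zeta <= 1) (zetah : 8 * zeta <= h)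
  (zetas : 4 * zeta <= 1 - sig).
Let s2 : R := Num.sqrt (2 * l).
Let E := expR (h * l).
Hypotheses (zs2 : 1 <= zeta * s2).
Hypotheses (KE1 : 32 <= peak * E) (KE2 : 96 * 64 <= eps * peak ^+ 2 * E)
  (KE3 : 2 * (1 + a) ^+ 2 / h <= E)
  (KF : 8 <= eps * peak * expR ((1 - ((1 + sig) / 2) ^+ 2) * l))
  (Kp : 4 <= expR (sig ^+ 2 * l)).
Hypothesis cardJ : expR ((1 - beta) * l) / 4 <= #|J|%:R.
Hypothesis cardG : n%:R / 4 <= #|G|%:R :> R.
Hypothesis nuJ : forall k, k \in J -> kap * s2 * (1 - dlt) <= nu k.
Hypothesis nuG : forall k, k \in G -> `|nu k| <= kap * s2 * dlt.

Let t := sig * s2.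
Let p0 := p_value t.
Let q1 := peak * expR (- (((sig - kap) ^+ 2 + h) * l)).
Let q2 := peak * expR (- (((1 + sig) / 2) ^+ 2 * l)).
Let M := expR ((1 - beta) * l) / 4.

Lemma s2_gt0 : 0 < s2. Proof. by rewrite sqrtr_gt0 mulr_gt0. Qed.

Lemma s2_sqr : s2 ^+ 2 = 2 * l. Proof. by rewrite sqr_sqrtr// mulr_ge0// ltW. Qed.

Lemma scaled_exponent (y : R) : (y * s2) ^+ 2 / 2 = y ^+ 2 * l.
Proof. by rewrite exprMn s2_sqr; field. Qed.

Lemma kap_dlt : 0 <= kap * dlt <= zeta.
Proof.
move: dlt0 kap0 ksig sig1 => /andP[d0 dz] k0 ks s1.
rewrite mulr_ge0 ?(ltW k0)//=; apply: le_trans dz; rewrite ler_piMl//.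
exact: ltW (lt_trans ks s1).
Qed.

Lemma drift_bound (v : R) : `|v| <= kap * s2 * dlt -> `|v| <= zeta * s2.
Proof.
move=> h1; apply: le_trans h1 _; rewrite mulrAC ler_pM2r ?s2_gt0//.
by have /andP[] := kap_dlt.
Qed.

(** The distance [t - v] is at most [(sig - kap + zeta) s2], and a window of length 1
    fits below [(sig - kap + 2 zeta) s2]. *)
Lemma exceed_prob_signal k : k \in J -> q1 <= exceed_prob nu t k.
Proof.
move=> kJ; have s20 := s2_gt0; have /andP[kd0 kdz] := kap_dlt.
have := nuJ kJ; set v := kap * s2 * (1 - dlt) => vk.
have tv : t - v = (sig - kap) * s2 + kap * dlt * s2 by rewrite /t /v; ring.
have x0 : 0 <= (sig - kap) * s2 by rewrite mulr_ge0 ?(ltW s20)// subr_ge0 ltW.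
have x1 : 0 <= kap * dlt * s2 by rewrite mulr_ge0 ?(ltW s20).
have x2 : kap * dlt * s2 <= zeta * s2 by rewrite ler_pM2r.
have ub : t - v + 1 <= (sig - kap + 2 * zeta) * s2.
  have -> : (sig - kap + 2 * zeta) * s2 = (sig - kap) * s2 + zeta * s2 + zeta * s2 by ring.
  by move: zs2 x2; rewrite tv; lra.
have lb : 0 <= t - v by rewrite tv addr_ge0.
apply: le_trans (exceed_prob_ge (M := (sig - kap + 2 * zeta) * s2) vk _ _).
- rewrite /q1 ler_pM2l ?peak_gt0// ler_expR lerN2 scaled_exponent ler_pM2r//.
  move: zeta0 zeta1 zetah kap0 ksig sig1 => z0 z1 zh k0 ks s1.
  have : zeta * (sig - kap) <= zeta * 1 by rewrite ler_wpM2l ?(ltW z0)//; lra.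
  have : zeta * zeta <= zeta * 1 by rewrite ler_wpM2l ?(ltW z0).
  by rewrite !expr2; lra.
- by rewrite ger0_norm//; lra.
- by rewrite ger0_norm// addr_ge0.
Qed.

Lemma far_window : t + zeta * s2 + 1 <= (1 + sig) / 2 * s2.
Proof.
have s20 := s2_gt0; move: zs2 zetas; rewrite /t => h1 h2.
have : 4 * zeta * s2 <= (1 - sig) * s2 by rewrite ler_pM2r.
lra.
Qed.

Lemma band_prob_quiet k : k \in G -> q2 <= gauss_pr [set w : R | t <= `|w + nu k| < t + 1].
Proof.
move=> kG; have nk := drift_bound (nuG kG); have s20 := s2_gt0.
have t0 : 0 <= t by rewrite mulr_ge0 ?(ltW s20)// ltW// (lt_trans kap0).
rewrite /q2 -scaled_exponent; have := far_window.
have zs0 : 0 <= zeta * s2 by rewrite mulr_ge0 ?(ltW s20)// ltW.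
move: (zeta * s2) (nu k) t ((1 + sig) / 2 * s2) nk zs0 t0.
move=> z v u K; rewrite ler_norml => /andP[v1 v2] z0 u0 uK.
by apply: gauss_pr_itv_shift_abs => //; rewrite ler_norml; apply/andP; split; lra.
Qed.

Lemma p0_ub : p0 <= 2 * expR (- (sig ^+ 2 * l)).
Proof.
rewrite -scaled_exponent; apply: p_value_le_tail.
by rewrite mulr_gt0 ?s2_gt0// (lt_trans kap0).
Qed.

Lemma p0_half : p0 <= 1 / 2.
Proof.
apply: le_trans p0_ub _; rewrite expRN.
have e0 := expR_gt0 (sig ^+ 2 * l); rewrite ler_pdivrMr//; move: Kp; lra.
Qed.

(** As [(1 + sig) / 2 < 1], the Gaussian tail just beyond [t + 1] is a power of [n]
    larger than [1 / n]. *)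
Lemma p_value_floor : n%:R^-1 <= p_value (t + 1).
Proof.
have t0 : 0 <= t + 1.
  by rewrite addr_ge0// mulr_ge0 ?(ltW s2_gt0)// ltW// (lt_trans kap0).
apply: (@le_trans _ _ q2); last first.
  rewrite /q2 -scaled_exponent; apply: p_value_ge => //.
  by apply: le_trans far_window; move: zs2; lra.
rewrite nE -expRN /q2; move/andP: eps01 => [e0 e1].
have : 1 <= peak * expR ((1 - ((1 + sig) / 2) ^+ 2) * l).
  apply: (@le_trans _ _ (eps * peak * expR ((1 - ((1 + sig) / 2) ^+ 2) * l))).
    by apply: le_trans KF; lra.
  by rewrite -mulrA ler_piMl// mulr_ge0 ?expR_ge0// ltW// peak_gt0.
move/(ler_wpM2r (expR_ge0 (- l))); rewrite mul1r -mulrA -expRD => H.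
by apply: le_trans H _; rewrite (_ : _ + - l = - (((1 + sig) / 2) ^+ 2 * l))//; ring.
Qed.

Lemma E_ge1 : 1 <= E.
Proof. by rewrite -expR0 ler_expR mulr_ge0 ?ltW. Qed.

(** From [hE], [2 sig kap - kap^2 >= 4 h], so signals exceed [t] more often than
    noise does by a power of [n]. *)
Lemma q1_ge : 2 * p0 <= q1.
Proof.
apply: (@le_trans _ _ (4 * expR (- (sig ^+ 2 * l)))).
  by have := p0_ub; lra.
have E1 := E_ge1; have pk : 0 < peak := peak_gt0.
apply: (@le_trans _ _ (peak * E * expR (- (sig ^+ 2 * l)))).
  by rewrite ler_pM2r ?expR_gt0//; apply: le_trans KE1; lra.
have H : (sig - kap) ^+ 2 + h <= sig ^+ 2 - h.
  by move: (sqr_ge0 sig) hE h0 beta_half; rewrite !expr2; lra.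
rewrite -mulrA ler_pM2l// -expRD ler_expR.
by move: (ler_wpM2r (ltW l0) H); rewrite !mulrDl; lra.
Qed.

Let D := M * (q1 - p0).
Let B : R := expR ((1 - sig ^+ 2) / 2 * l).

Lemma B_ge1 : 1 <= B.
Proof.
rewrite -expR0 ler_expR mulr_ge0 ?(ltW l0)// divr_ge0// subr_ge0.
by rewrite expr_le1// ltW// (lt_trans kap0).
Qed.

Lemma null_mean_ub : n%:R * p0 <= 2 * B ^+ 2.
Proof.
apply: (@le_trans _ _ (n%:R * (2 * expR (- (sig ^+ 2 * l))))); first by rewrite ler_wpM2l ?p0_ub.
rewrite nE mulrCA -expRD /B -expRM_natl ler_pM2l// ler_expR le_eqVlt.
by apply/orP; left; apply/eqP; field.
Qed.

Lemma p0_ge0 : 0 <= p0. Proof. exact: p_value_ge0. Qed.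

(** The exponent [1 - beta - (sig - kap)^2 - h] of the surplus equals
    [(1 - sig^2) / 2 + 3 h]. *)
Lemma D_lb : peak / 8 * B * E ^+ 3 <= D.
Proof.
apply: (@le_trans _ _ (M * (q1 / 2))); last first.
  by rewrite ler_pM2l ?divr_gt0 ?expR_gt0//; have := q1_ge; lra.
rewrite /M /q1 le_eqVlt; apply/orP; left; apply/eqP.
rewrite -(mulrA _ B).
have -> : B * E ^+ 3 = expR ((1 - beta) * l) * expR (- (((sig - kap) ^+ 2 + h) * l)).
  rewrite /B /E -expRM_natl -!expRD; congr expR.
  have -> : beta = 1 / 2 + 2 * sig * kap - kap ^+ 2 - sig ^+ 2 / 2 - 4 * h by rewrite hE; ring.
  by field.
by field.
Qed.

(** [ln l <= l], and [h l <= exp(h l)] once more. *)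
Lemma threshold_le : hc_threshold a n <= E.
Proof.
have E0 : 0 < E := expR_gt0 _.
rewrite -(ler_pXn2r (n := 2)) ?nnegrE ?(ltW E0)//; last first.
  by rewrite mulr_ge0 ?sqrtr_ge0// addr_ge0// ltW.
have ll : ln l <= l by apply: ltW; exact: ln_sublinear.
rewrite /hc_threshold nE expRK exprMn; have [l1|l1] := leP (ln l) 0.
  rewrite ler0_sqrtr ?expr0n/= ?mulr0 ?sqr_ge0//; lra.
rewrite sqr_sqrtr; last lra.
apply: (@le_trans _ _ (2 * (1 + a) ^+ 2 / h * (h * l))).
  rewrite (_ : 2 * (1 + a) ^+ 2 / h * (h * l) = (1 + a) ^+ 2 * (2 * l)).
    by rewrite ler_wpM2l ?sqr_ge0//; lra.
  by field; rewrite gt_eqF.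
rewrite expr2; apply: ler_pM => //.
- by rewrite divr_ge0 ?(ltW h0)// mulr_ge0 ?sqr_ge0.
- by rewrite mulr_ge0 ?ltW.
- by have := expR_ge1Dx (h * l); rewrite -/E; lra.
Qed.

Lemma threshold_sep : hc_threshold a n * Num.sqrt (n%:R * p0) <= D / 2.
Proof.
have E0 : 0 < E := expR_gt0 _; have B0 : 0 < B := expR_gt0 _.
have sq : Num.sqrt (n%:R * p0) <= 2 * B.
  rewrite -(ler_pXn2r (n := 2)) ?nnegrE ?sqrtr_ge0 ?mulr_ge0 ?(ltW B0)//.
  rewrite sqr_sqrtr ?mulr_ge0 ?p0_ge0//; apply: le_trans null_mean_ub _.
  by have := sqr_ge0 B; rewrite exprMn; lra.
apply: (@le_trans _ _ (E * (2 * B))).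
  by apply: ler_pM; rewrite ?sqrtr_ge0 ?threshold_le// mulr_ge0 ?sqrtr_ge0// addr_ge0// ltW.
apply: (@le_trans _ _ (peak / 8 * B * E ^+ 3 / 2)); last first.
  by have := D_lb; lra.
have -> : peak / 8 * B * E ^+ 3 / 2 = B * E * (peak * E * E / 16) by field.
have -> : E * (2 * B) = B * E * 2 by ring.
rewrite ler_pM2l ?mulr_gt0//.
have : 32 * 1 <= peak * E * E by apply: ler_pM; rewrite ?KE1 ?E_ge1.
lra.
Qed.

(** The nonasymptotic form of the power statement for a fixed mean vector: the
    hypotheses on [E] and on the other exponentials hold for all large [n]. *)
Lemma detection_bound :
  pr P [set x | ~ exceeds_between (hc_threshold a n) n%:R^-1 (1 / 2) (\col_k (nu k + W k x))]
  <= eps.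
Proof.
have pk : 0 < peak := peak_gt0; have p00 := p0_ge0; have q1p := q1_ge.
have q10 : 0 < q1 by rewrite mulr_gt0 ?expR_gt0.
have t0 : 0 <= t by rewrite mulr_ge0 ?(ltW s2_gt0)// ltW// (lt_trans kap0).
have c0 : 0 <= hc_threshold a n by rewrite mulr_ge0 ?sqrtr_ge0// addr_ge0// ltW.
have M0 : 0 < M by rewrite divr_gt0 ?expR_gt0.
have pq : p0 < q1 by lra.
apply: le_trans (shifted_accept gW c0 t0 p_value_floor p0_half pq M0 cardJ
  exceed_prob_signal band_prob_quiet threshold_sep) _.
rewrite -/p0 -/D.
have E0 : 0 < E := expR_gt0 _; have /andP[e0 e1] := eps01.
have e20 : 0 < eps / 2 by rewrite divr_gt0.
have : expR (- (D ^+ 2 / (16 * (n%:R * p0 + D)))) <= eps / 2.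
  have k01 : 0 < peak / 8 <= 1.
    by have := @peak_le2 R; rewrite divr_gt0//=; lra.
  have np0 : 0 <= n%:R * p0 by rewrite mulr_ge0.
  have := chernoff_rate k01 B_ge1 E_ge1 np0 null_mean_ub D_lb.
  set v := D ^+ 2 / _ => vE.
  have k0 : 0 < (peak / 8) ^+ 2 * E / 48 by rewrite divr_gt0// mulr_gt0// exprn_gt0// divr_gt0.
  have v0 : 0 < v by apply: lt_le_trans vE.
  apply: le_trans (expRN_le_inv v0) _.
  rewrite -[leRHS]invrK lef_pV2 ?posrE ?invr_gt0//.
  apply: le_trans vE; rewrite invf_div ler_pdivrMr//.
  by move: KE2; rewrite !expr2; lra.
have : expR (- (q2 * #|G|%:R)) <= eps / 2.
  have F0 := expR_gt0 ((1 - ((1 + sig) / 2) ^+ 2) * l).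
  have q2n : peak * expR ((1 - ((1 + sig) / 2) ^+ 2) * l) / 4 <= q2 * #|G|%:R.
    apply: (@le_trans _ _ (q2 * (n%:R / 4))).
      rewrite mulrA ler_pM2r// /q2 nE -mulrA ler_pM2l// -expRD ler_expR mulrBl mul1r.
      by rewrite addrC.
    by rewrite ler_wpM2l ?cardG// mulr_ge0 ?expR_ge0// ltW.
  have KF' := KF; set F := expR _ in F0 q2n KF'.
  have q20 : 0 < q2 * #|G|%:R by apply: lt_le_trans q2n; rewrite divr_gt0// mulr_gt0.
  apply: le_trans (expRN_le_inv q20) _.
  rewrite -[leRHS]invrK lef_pV2 ?posrE ?invr_gt0//.
  apply: le_trans q2n; rewrite invf_div ler_pdivrMr//.
  by move: KF'; lra.
by move=> G2 G1; rewrite [leRHS](splitr eps) lerD.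
Qed.

End Detection.

(** * The detection boundary, and whitened sparse signals *)

Section Asymptotics.
Context {R : realType}.

(** For [kappa = sqrt r < 1/2] the maximizer [sig = 2 kappa] is admissible and the
    condition becomes [r > beta - 1/2].  Otherwise the supremum is approached at
    [sig = 1], where the condition reads [(1 - kappa)^2 < 1 - beta]; a value slightly
    below 1 then works by continuity. *)
Lemma detectable_level (beta r : R) : 1 / 2 < beta < 1 -> rho_star beta < r < 1 ->
  exists2 sig, 0 < Num.sqrt r < sig /\ sig < 1 &
    0 < 1 / 2 - beta + 2 * sig * Num.sqrt r - Num.sqrt r ^+ 2 - sig ^+ 2 / 2.
Proof.
move=> /andP[b2 b1] /andP[rr r1].
have b10 : 0 <= 1 - beta by lra.
pose s := Num.sqrt (1 - beta).
have s2 : s ^+ 2 = 1 - beta by exact: sqr_sqrtr.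
have s0 : 0 <= s by exact: sqrtr_ge0.
have rb : beta - 1 / 2 < r.
  move: rr; rewrite /rho_star; case: ifP => // _; apply: le_lt_trans.
  by rewrite -/s; have := sqr_ge0 (s - 1 / 2); move: s2; rewrite !expr2; lra.
have r0 : 0 < r by lra.
pose k := Num.sqrt r; have k0 : 0 < k by rewrite sqrtr_gt0.
have k2 : k ^+ 2 = r by rewrite sqr_sqrtr// ltW.
have k1 : k < 1 by rewrite -(ltr_pXn2r (n := 2)) ?nnegrE ?(ltW k0)// k2 expr1n.
rewrite -/k; have [kh|kh] := ltP k (1 / 2).
  exists (2 * k); first by split; [apply/andP; split|]; lra.
  by move: k2; rewrite !expr2; lra.
have gap : 0 < 2 * k - k ^+ 2 - beta.
  have [b34|b34] := leP beta (3 / 4).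
    have q : 0 <= (k - 1 / 2) * (1 - k) by apply: mulr_ge0; lra.
    by move: k2 q; rewrite !expr2; nra.
  move: rr; rewrite /rho_star leNgt b34/= -/s => rs.
  have s1 : s <= 1 by rewrite -(ler_pXn2r (n := 2)) ?nnegrE// s2 expr1n; lra.
  have : 1 - s < k by rewrite -(ltr_pXn2r (n := 2)) ?nnegrE ?subr_ge0 ?(ltW k0)// k2.
  by move=> ks; move: s2; rewrite !expr2; nra.
set g := 2 * k - k ^+ 2 - beta in gap.
pose e := Num.min (g / 4) ((1 - k) / 2).
have e0 : 0 < e by rewrite lt_min !divr_gt0// subr_gt0.
have e1 : e <= g / 4 by rewrite ge_min lexx.
have e2 : e <= (1 - k) / 2 by rewrite ge_min lexx orbT.
clearbody e; exists (1 - e); first by split; [apply/andP; split|]; lra.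
have -> : 1 / 2 - beta + 2 * (1 - e) * k - k ^+ 2 - (1 - e) ^+ 2 / 2 =
  g - e * (2 * k - 1 + e / 2) by rewrite /g; field.
have : e * (2 * k - 1 + e / 2) <= e * 2 by rewrite ler_pM2l//; lra.
lra.
Qed.

Lemma near_ln_ge (x : R) : \forall n \near \oo, x <= ln n%:R.
Proof.
near=> n; rewrite -[x]expRK ler_ln ?posrE ?expR_gt0//.
  by near: n; exact: nbhs_infty_ger.
by rewrite ltr0n; near: n; exact: nbhs_infty_gt.
Unshelve. all: by end_near. Qed.

Lemma near_expR_ln_ge (c x : R) : 0 < c -> \forall n \near \oo, x <= expR (c * ln n%:R).
Proof.
move=> c0; near=> n; apply: le_trans (expR_ge1Dx _).
have : x / c <= ln n%:R by near: n; exact: near_ln_ge.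
by rewrite ler_pdivrMr// mulrC => h; apply: (le_trans h); rewrite lerDr.
Unshelve. all: by end_near. Qed.

Lemma rounds_bounds (x : R) k : rounds x k -> x - 1 <= k%:R <= x + 1.
Proof. by rewrite /rounds ltr_norml => /andP[h1 h2]; apply/andP; split; lra. Qed.

Lemma powR_expR n (x : R) : (0 < n)%N -> n%:R `^ x = expR (x * ln n%:R).
Proof. by move=> n0; rewrite /powR pnatr_eq0 eqn0Ngt n0. Qed.

End Asymptotics.

Section SigmaOf.
Context {R : realType} {d : measure_display} {T : measurableType d}.
Variables (n : nat) (X : T -> 'cV[R]_n).

Let gen : set (set T) :=
  \big[setU/set0]_(i < n) preimage_set_system setT (fun t => X t i 0) measurable.
Let TX := g_sigma_algebraType gen.

Lemma measurable_coordinate_sigma_of i : measurable_fun [set: TX] (fun t : TX => X t i 0).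
Proof.
move=> _ A mA; apply: sub_sigma_algebra; rewrite /gen.
have : preimage_set_system setT (fun t => X t i 0) measurable ([set: T] `&` (fun t => X t i 0) @^-1` A).
  by exists A.
by move: (_ `&` _) => C hC; rewrite (bigD1 i)//=; left.
Qed.

Lemma sigma_of_coordinates (g : 'I_n -> R) : sigma_of X [set t | X t = \col_j g j].
Proof.
rewrite -[sigma_of X _]/(measurable ([set t | X t = \col_j g j] : set TX)).
have -> : [set t | X t = \col_j g j] =
    [set t : TX | forall j : 'I_n, true -> [set t : TX | X t j 0 = g j] t].
  apply/seteqP; split => t /=; first by move=> -> j _; rewrite mxE.
  by move=> H; apply/colP => j; rewrite mxE; exact: H.
apply: measurable_forall => j _; rewrite -[X in measurable X]setTI.
exact: (measurable_coordinate_sigma_of j measurableT (measurable_set1 (g j))).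
Qed.

(** Measurability with respect to [X] is measurability on the space whose sigma
    algebra is generated by the coordinates of [X]. *)
Lemma sigma_of_hc_rejects (a : R) (U : 'M[R]_n) (v : 'cV[R]_n) :
  sigma_of X [set t | ~ hc_rejects a (v + U *m X t)].
Proof.
rewrite -[sigma_of X _]/(measurable ([set t | ~ hc_rejects a (v + U *m X t)] : set TX)).
apply: measurableC; apply: measurable_hc_rejects => i.
under eq_fun do rewrite !mxE.
apply: measurable_funD => //; apply: measurable_sum => j.
by apply: measurable_funM => //; exact: measurable_coordinate_sigma_of.
Qed.

End SigmaOf.

Section SignalRows.
Context {R : realType}.
Variables (n b : nat) (S : 'M[R]_n) (delta A : R) (s : {set 'I_n}).
Hypotheses (hS : Theta_star delta b S) (delta0 : 0 <= delta) (A0 : 0 <= A) (b0 : (0 < b)%N).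
Let U := inv_cholesky S.
Let signal : 'cV[R]_n := \col_j (if j \in s then A else 0).

Lemma inv_cholesky_trig (k j : 'I_n) : (k < j)%N -> U k j = 0.
Proof.
have [[pS _] _] := hS; have [/is_trig_mxP tU _ _] := inv_choleskyP pS.
exact: tU.
Qed.

(** The columns beyond [k] vanish by triangularity, and those in [Q] up to [k] all lie
    at distance [b] or more from the diagonal; in the rows with [k < b] there are none. *)
Lemma far_row_sum (k : 'I_n) (Q : pred 'I_n) :
  (forall i, Q i -> (i <= k)%N -> (i + b <= k)%N) ->
  `|\sum_(i < n | Q i) U k i| <= delta.
Proof.
move=> far; apply: le_trans (ler_norm_sum _ _ _) _.
have [bk|kb] := leqP b k; last first.
  rewrite big1// => i Qi; rewrite inv_cholesky_trig ?normr0//.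
  by rewrite ltnNge; apply/negP => /(far _ Qi); lia.
apply: le_trans (hS.2 k bk).
rewrite big_mkcond [leRHS]big_mkcond/=; apply: ler_sum => i _.
case: ifP => Qi; last by case: ifP.
case: ifP => // ibk; rewrite inv_cholesky_trig ?normr0//.
by rewrite ltnNge; apply/negP => /(far _ Qi); rewrite ibk.
Qed.

Lemma whitened_signalE (k : 'I_n) : (U *m signal) k 0 = A * \sum_(i in s) U k i.
Proof.
rewrite mxE mulr_sumr [RHS]big_mkcond/=; apply: eq_bigr => i _.
by rewrite mxE; case: ifP; rewrite ?mulr0// mulrC.
Qed.

(** The diagonal entry contributes at least [A], the other signals at most
    [A delta] in absolute value. *)
Lemma clean_signal_ge (j : 'I_n) : clean b s j -> A * (1 - delta) <= (U *m signal) j 0.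
Proof.
move=> /andP[js /forall_inP cl]; rewrite whitened_signalE ler_wpM2l//.
have [[pS diag1] _] := hS.
have Ujj := inv_cholesky_diag_ge1 (inv_choleskyP pS) (diag1 j).
rewrite (bigD1 j)//=.
have : `|\sum_(i < n | (i \in s) && (i != j)) U j i| <= delta.
  apply: far_row_sum => i /andP[ins ij] ilej.
  by have := cl i ins; have : val i != val j by []; move=> /=; lia.
by rewrite ler_norml -/U in Ujj * => /andP[h _]; lra.
Qed.

Definition quiet : {set 'I_n} := [set k : 'I_n | [forall i in s, ~~ (i <= k < i + b)%N]]%SET.

Lemma quiet_signal_le (k : 'I_n) : k \in quiet -> `|(U *m signal) k 0| <= A * delta.
Proof.
rewrite inE => /forall_inP cl; rewrite whitened_signalE normrM ger0_norm// ler_wpM2l//.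
by apply: far_row_sum => i ins ik; have := cl i ins; lia.
Qed.

(** Each signal disturbs a window of length [b]. *)
Lemma card_quiet : (n <= #|quiet| + #|s| * b)%N.
Proof.
suff : (#|~: quiet| <= #|s| * b)%N.
  by move=> h; rewrite -[X in (X <= _)%N]card_ord -(finset.cardsC quiet) leq_add2l.
have sub : ~: quiet \subset (\bigcup_(i in s) [set k : 'I_n | (i <= k < i + b)%N])%SET.
  apply/fintype.subsetP => k; rewrite !inE => /forall_inPn[i ins /negbNE ik].
  by apply/bigcupP; exists i => //; rewrite inE.
apply: leq_trans (subset_leq_card sub) _.
apply: (@leq_trans (\sum_(i in s) #|[set k : 'I_n | (i <= k < i + b)%N]%SET|)).
  elim/big_ind2: _ => [|A1 x A2 y h1 h2|//]; first by rewrite cards0.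
  by apply: leq_trans (leq_card_setU _ _) _; exact: leq_add.
rewrite -sum_nat_const; apply: leq_sum => i _.
exact: card_window.
Qed.

End SignalRows.

(** * Averaging over the support *)

Section RandomSupport.
Context {R : realType}.

Lemma pr_indep d (T : measurableType d) (P : probability T R) n (X Y : T -> 'cV[R]_n) E F :
  independent_vectors P X Y -> sigma_of X E -> sigma_of Y F ->
  measurable E -> measurable F -> pr P (E `&` F) = pr P E * pr P F.
Proof.
move=> XY sE sF mE mF; apply: EFin_inj.
by rewrite EFinM -!prE//; [exact: XY|exact: measurableI].
Qed.

(** Given the support [s], which is independent of [Z], the data are white noise
    shifted by a fixed vector.  Supports with many close pairs are discarded at
    the cost of their probability. *)
Lemma mixture_error n d (T : measurableType d) (P : probability T R) (Z mu : T -> 'cV[R]_n)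
    (m b : nat) (A a eps : R) (S : 'M[R]_n) :
  pos_def S -> centered_gaussian P S Z -> sparse_signal P m A mu ->
  independent_vectors P mu Z -> 0 < A -> (0 < m)%N -> (m <= n)%N ->
  5 * (b * m)%:R <= 2 * n%:R :> R -> 0 <= eps ->
  (forall s : {set 'I_n}, #|s| = m -> (2 * close_pairs b s < m)%N ->
    pr P [set t | ~ hc_rejects a (inv_cholesky S *m (\col_j (if j \in s then A else 0)) +
                                  inv_cholesky S *m Z t)] <= eps) ->
  pr P [set t | ~ hc_rejects a (inv_cholesky S *m (mu t + Z t))] <= eps + 200 / m%:R.
Proof.
move=> pS gZ [L [mL Lm PL muE]] indep A0 m0 mn bm eps0 good.
set U := inv_cholesky S in good *.
pose sgn (s : {set 'I_n}) : 'cV[R]_n := \col_j (if j \in s then A else 0).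
pose F s := [set t | ~ hc_rejects a (U *m sgn s + U *m Z t)].
pose E s := [set t | L t = s].
have [mW _] := whitened_std_gaussian pS gZ.
have mF s : measurable (F s).
  apply: measurableC; apply: measurable_hc_rejects => i.
  by under eq_fun do rewrite mxE; apply: measurable_funD => //; exact: mW.
have mEF s : measurable (E s `&` F s) by apply: measurableI => //; exact: mL.
have sE s : sigma_of mu (E s).
  have -> : E s = [set t | mu t = \col_j (if j \in s then A else 0)].
    apply/seteqP; split => t /=; first by rewrite muE => ->.
    rewrite muE => /colP H; apply/setP => j; have := H j; rewrite !mxE.
    by case: (j \in L t); case: (j \in s) => // /eqP; rewrite ?(gt_eqF A0)// eq_sym (gt_eqF A0).
  exact: sigma_of_coordinates.
have prEs (s : {set 'I_n}) : #|s| = m -> pr P (E s) = (draws n m)^-1 by move=> sm; rewrite /pr PL.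
have -> : [set t | ~ hc_rejects a (U *m (mu t + Z t))] =
    [set t | exists2 s : {set 'I_n}, #|s| == m & (E s `&` F s) t].
  have FL t : F (L t) t = ~ hc_rejects a (U *m (mu t + Z t)).
    by rewrite mulmxDr muE.
  apply/seteqP; split => [t H|t [s _ [/= <-]]]; last by rewrite FL.
  exists (L t); first by rewrite Lm.
  by apply: conj; [exact: erefl|rewrite FL; exact: H].
apply: le_trans (pr_exists_le P (fun s _ => mEF s)) _.
have dr0 : 0 < draws (R := R) n m by exact: draws_gt0.
pose bad := [set s : {set 'I_n} | (#|s| == m) && (m <= 2 * close_pairs b s)%N]%SET.
apply: (@le_trans _ _ (\sum_(s : {set 'I_n} | #|s| == m) (draws n m)^-1 * (eps + (s \in bad)%:R))).
  apply: ler_sum => s /eqP sm.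
  rewrite (pr_indep indep (sE s) (sigma_of_hc_rejects (X := Z) a U (U *m sgn s)) (mL s) (mF s)).
  rewrite (prEs _ sm) ler_pM2l ?invr_gt0// inE sm eqxx/=.
  have [h|h] := leqP m (2 * close_pairs b s)%N; last by rewrite addr0; exact: good.
  by apply: le_trans (pr_le1 P (mF s)) _; rewrite mulr1n lerDr.
rewrite -mulr_sumr big_split/= mulrDr; apply: lerD.
  rewrite sumr_const.
  have -> : #|[pred s : {set 'I_n} | #|s| == m]| = 'C(n, m).
    by rewrite -[in RHS](card_ord n) -card_draws; apply: eq_card => s; rewrite !inE.
  by rewrite -mulr_natr mulrCA mulVf ?mulr1// gt_eqF.
rewrite ler_pdivrMl// -natr_sum.
apply: le_trans (many_close_pairs_rare m0 mn bm).
rewrite ler_nat -sum1_card big_mkcond [leqRHS]big_mkcond/=; apply: leq_sum => s _.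
by rewrite /bad !inE; case: (#|s| == m) => //=; case: (_ <= _)%N.
Qed.

End RandomSupport.

(** * Uniform control of both errors *)

Section UniformErrors.
Context {R : realType}.
Local Notation peak := (@normal_peak R 1).

(** Rounding errors are absorbed by the gap between [m b = n / 3] and [2 n / 5]. *)
Lemma sparse_sizes (n m b : nat) (x y : R) : n%:R = x * y -> 36 <= x -> 36 <= y ->
  rounds x m -> rounds (y / 3) b ->
  [/\ (0 < m)%N, (m <= n)%N, (0 < b)%N, 5 * (b * m)%:R <= 2 * n%:R :> R & x / 2 <= m%:R].
Proof.
move=> nE x36 y36 /rounds_bounds/andP[m1 m2] /rounds_bounds/andP[b1 b2].
have x0 : 0 <= x by apply: le_trans x36.
have y0 : 0 <= y by apply: le_trans y36.
have xy1 : 36 * y <= x * y by rewrite ler_wpM2r.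
have xy2 : x * 36 <= x * y by rewrite ler_wpM2l.
split.
- by rewrite -(ltr_nat R); clear -m1 x36; lra.
- by rewrite -(ler_nat R) nE; clear -m2 xy2 x36; lra.
- by rewrite -(ltr_nat R); clear -b1 y36; lra.
- rewrite natrM nE; have h : b%:R * m%:R <= (y / 3 + 1) * (x + 1) by apply: ler_pM.
  by clear -h xy1 xy2 x36 y36; lra.
- by clear -m1 x36; lra.
Qed.

(** The slack in [detectable_level] fixes [h] and the tolerance [zeta] on [delta]; what
    remains holds for all large [n] because it compares constants with powers
    of [n]. *)
Lemma alternative_hc (beta r a eps : R) :
  1 / 2 < beta < 1 -> rho_star beta < r < 1 -> 0 < a -> 0 < eps <= 1 ->
  exists2 zeta, 0 < zeta & \forall n \near \oo, forall (m b : nat) (delta : R),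
    rounds (n%:R `^ (1 - beta)) m -> rounds (n%:R `^ beta / 3) b -> 0 <= delta <= zeta ->
  forall S : 'M[R]_n, Theta_star delta b S ->
  forall d (T : measurableType d) (P : probability T R) (Z mu : T -> 'cV[R]_n),
    centered_gaussian P S Z -> sparse_signal P m (amplitude r n) mu ->
    independent_vectors P mu Z ->
    pr P [set t | ~ hc_rejects a (inv_cholesky S *m (mu t + Z t))] <= eps.
Proof.
move=> beta01 r01 a0 /andP[eps0 eps1].
have [sig [/andP[kap0 ksig] sig1] gap] := detectable_level beta01 r01.
set kap := Num.sqrt r in kap0 ksig gap.
have r0 : 0 < r by rewrite -sqrtr_gt0.
have [b2 b1] := andP beta01.
set g := 1 / 2 - beta + _ - _ - _ in gap.
pose h := g / 4; have h0 : 0 < h by rewrite divr_gt0.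
have hE : 4 * h = g by rewrite /h; field.
clearbody h; rewrite /g in hE; clear g gap.
(* room for [delta], for the unit windows, and for [sig + 2 zeta <= (1 + sig) / 2] *)
pose zeta := Num.min 1 (Num.min (h / 8) ((1 - sig) / 4)).
have zeta0 : 0 < zeta by rewrite !lt_min ltr01 !divr_gt0// subr_gt0.
have zeta1 : zeta <= 1 by rewrite ge_min lexx.
have zetah : 8 * zeta <= h.
  by rewrite mulrC -ler_pdivlMr// !ge_min lexx orbT.
have zetas : 4 * zeta <= 1 - sig.
  by rewrite mulrC -ler_pdivlMr// !ge_min lexx !orbT.
clearbody zeta; exists zeta => //.
pose e := eps / 2; have e0 : 0 < e by rewrite divr_gt0.
have e1 : e <= 1 by rewrite /e; clear -eps0 eps1; lra.
have pk : 0 < peak := peak_gt0.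
have sig0 : 0 < sig by exact: lt_trans ksig.
have f0 : 0 < 1 - ((1 + sig) / 2) ^+ 2.
  by rewrite subr_gt0 expr_lt1//; clear -sig1 sig0; lra.
near=> n => m b delta.
have l1 : 1 <= ln n%:R :> R by near: n; exact: near_ln_ge.
have n0 : (0 < n)%N by near: n; exact: nbhs_infty_gt.
have lz : (zeta ^+ 2)^-1 <= ln n%:R :> R by near: n; exact: near_ln_ge.
have E1 : 32 / peak <= expR (h * ln n%:R) by near: n; exact: near_expR_ln_ge.
have E2 : 96 * 64 / (e * peak ^+ 2) <= expR (h * ln n%:R) by near: n; exact: near_expR_ln_ge.
have E3 : 2 * (1 + a) ^+ 2 / h <= expR (h * ln n%:R) by near: n; exact: near_expR_ln_ge.
have EF : 8 / (e * peak) <= expR ((1 - ((1 + sig) / 2) ^+ 2) * ln n%:R).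
  by near: n; exact: near_expR_ln_ge.
have Ep : 4 <= expR (sig ^+ 2 * ln n%:R).
  by near: n; apply: near_expR_ln_ge; rewrite exprn_gt0.
have x36 : 36 <= expR ((1 - beta) * ln n%:R).
  by near: n; apply: near_expR_ln_ge; rewrite subr_gt0.
have xe : 400 / e <= expR ((1 - beta) * ln n%:R).
  by near: n; apply: near_expR_ln_ge; rewrite subr_gt0.
have y36 : 36 <= expR (beta * ln n%:R).
  by near: n; apply: near_expR_ln_ge; apply: lt_trans b2.
rewrite !powR_expR//; set l := ln n%:R in l1 lz E1 E2 E3 EF Ep x36 xe y36 *.
set x := expR ((1 - beta) * l) in x36 xe *; set y := expR (beta * l) in y36 *.
have nE : n%:R = expR l by rewrite lnK// posrE ltr0n.
have nxy : n%:R = x * y by rewrite nE -expRD; congr expR; ring.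
have l0 : 0 < l by exact: lt_le_trans l1.
move=> mr br dz S hS d T P Z mu gZ smu indep.
have [m0 mn bb0 bm xm] := sparse_sizes nxy x36 y36 mr br.
have x0 : 0 < x := expR_gt0 _.
have [[pS diag1] _] := hS.
have AE : amplitude r n = kap * Num.sqrt (2 * l).
  by rewrite /amplitude -/l mulrAC [LHS]sqrtrM ?mulr_ge0 ?(ltW l0)// mulrC.
have A0 : 0 < amplitude r n by rewrite AE mulr_gt0// sqrtr_gt0 mulr_gt0.
have [delta0 _] := andP dz.
apply: le_trans (mixture_error (a := a) (eps := e) pS gZ smu indep A0 m0 mn bm (ltW e0) _) _;
  last first.
  rewrite [leRHS](splitr eps) lerD2l -/e ler_pdivrMr ?ltr0n//.
  rewrite ler_pdivrMr// in xe; have : x / 2 * e <= m%:R * e by rewrite ler_pM2r.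
  by clear -xe; lra.
move=> s sm sgood.
have cl := card_clean m0 mn sm sgood.
have cq := card_quiet b s; rewrite sm in cq.
pose nu k := (inv_cholesky S *m (\col_j (if j \in s then amplitude r n else 0))) k 0.
rewrite (_ : [set t | _] = [set t | ~ exceeds_between (hc_threshold a n) n%:R^-1 (1 / 2)
    (\col_k (nu k + (inv_cholesky S *m Z t) k 0))]); last first.
  rewrite predeqE => t /=; rewrite hc_rejectsP.
  by rewrite (_ : _ + _ = \col_k (nu k + (inv_cholesky S *m Z t) k 0))//;
    apply/colP => k; rewrite mxE [RHS]mxE.
apply: (@detection_bound _ _ _ _ _ _ nu [set j | clean b s j]%SET (quiet b s) a beta kap sig h zeta
  l e delta (whitened_std_gaussian pS gZ) nE l0 a0 _ dz kap0 ksig sig1 b2 h0 hE zeta0 zeta1 zetah zetas).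
- by rewrite e0 e1.
- rewrite -(ler_pXn2r (n := 2)) ?nnegrE ?mulr_ge0 ?sqrtr_ge0 ?(ltW zeta0)//.
  rewrite expr1n exprMn sqr_sqrtr; last by rewrite mulr_ge0 ?(ltW l0).
  have z2 : 0 < zeta ^+ 2 by rewrite exprn_gt0.
  by rewrite -ler_pdivrMl// mulr1; apply: le_trans lz _; clear -l0; lra.
- by rewrite mulrC -ler_pdivrMr.
- by rewrite [leRHS]mulrC -ler_pdivrMr// mulr_gt0// exprn_gt0.
- exact: E3.
- by rewrite mulrC -ler_pdivrMr// mulr_gt0.
- exact: Ep.
- rewrite -/x; move: cl; rewrite -(ler_nat R) natrM => cl.
  by clear -cl xm; lra.
- move: cq; rewrite -(ler_nat R) natrD mulnC => cq; have nn : 0 <= n%:R :> R by [].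
  by clear -cq bm nn; lra.
- move=> k; rewrite inE => kc; rewrite -AE; by apply: (clean_signal_ge hS delta0 (ltW A0)).
- move=> k kq; rewrite -AE; by apply: (quiet_signal_le hS delta0 (ltW A0)).
Unshelve. all: by end_near. Qed.

End UniformErrors.

Section Measurability.
Context {R : realType} {d : measure_display} {T : measurableType d} {P : probability T R}.
Variable n : nat.

Lemma measurable_sparse_signal (m : nat) (A : R) (mu : T -> 'cV[R]_n) j :
  sparse_signal P m A mu -> measurable_fun setT (fun t => mu t j 0).
Proof.
move=> [L [mL _ _ muE]]; under eq_fun do rewrite muE mxE.
apply: measurable_fun_ifT => //; apply: (@measurable_fun_bool _ _ _ _ true).
rewrite setTI (_ : _ @^-1` _ = [set t | exists2 s : {set 'I_n}, j \in s & [set t | L t = s] t]).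
  by apply: measurable_exists => s _; exact: mL.
by apply/seteqP; split => t /=; [move=> jL; exists (L t)|move=> [s js ->]].
Qed.

Lemma measurable_centered_gaussian (S : 'M[R]_n) (Z : T -> 'cV[R]_n) j :
  centered_gaussian P S Z -> measurable_fun setT (fun t => Z t j 0).
Proof.
move=> [A [W [_ _ ZE]]]; under eq_fun do rewrite ZE mxE.
apply: measurable_sum => i; apply: measurable_funM => //.
under eq_fun do rewrite mxE; exact: measurable_funPT.
Qed.

Lemma measurable_hc_rejects_linear (a : R) (U : 'M[R]_n) (X : T -> 'cV[R]_n) :
  (forall j, measurable_fun setT (fun t => X t j 0)) ->
  measurable [set t | hc_rejects a (U *m X t)].
Proof.
move=> mX; apply: measurable_hc_rejects => i; under eq_fun do rewrite mxE.
by apply: measurable_sum => j; apply: measurable_funM.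
Qed.

End Measurability.

Theorem theorem4p1 (R : realType) (beta r a : R)
    (beta_range : 1 / 2 < beta < 1)
    (r_range : rho_star beta < r < 1)
    (a_gt0 : 0 < a)
    (m b : nat -> nat)
    (m_round : forall n, rounds (n%:R `^ (1 - beta)) (m n))
    (b_round : forall n, rounds (n%:R `^ beta / 3) (b n))
    (delta : nat -> R)
    (delta_gt0 : forall n, 0 < delta n)
    (delta_cvg0 : delta n @[n --> \oo] --> (0 : R))
    (d : forall n, 'M[R]_n -> measure_display)
    (T : forall n (S : 'M[R]_n), measurableType (d n S))
    (P : forall n (S : 'M[R]_n), probability (T n S) R)
    (Z mu : forall n (S : 'M[R]_n), T n S -> 'cV[R]_n)
    (Z_gaussian : forall n (S : 'M[R]_n), correlation_mx S ->
       centered_gaussian (P n S) S (Z n S))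
    (mu_signal : forall n (S : 'M[R]_n), correlation_mx S ->
       sparse_signal (P n S) (m n) (amplitude r n) (mu n S))
    (mu_Z_indep : forall n (S : 'M[R]_n), correlation_mx S ->
       independent_vectors (P n S) (mu n S) (Z n S)) :
  ereal_sup
    [set (P n S [set t | hc_rejects a (inv_cholesky S *m Z n S t)] +
          P n S [set t | ~ hc_rejects a (inv_cholesky S *m (mu n S t + Z n S t))])%E
       | S in Theta_star (delta n) (b n)] @[n --> \oo] --> (0%E : \bar R).
Proof.
set u := fun n => ereal_sup _.
have key eps : 0 < eps <= 1 ->
    \forall n \near \oo, (0%E <= u n)%E && (u n <= (2 * eps)%:E)%E.
  move=> eps01; have /andP[eps0 _] := eps01.
  have [X null] := null_hc a_gt0 eps0.
  have [zeta zeta0 alt] := alternative_hc beta_range r_range a_gt0 eps01.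
  have beta0 : 0 < beta by move: beta_range; clear; lra.
  move: alt; apply: filter_app; near=> n => alt.
  have l1 : 2 <= ln n%:R :> R by near: n; exact: near_ln_ge.
  have n1 : 2 <= n%:R :> R by near: n; exact: nbhs_infty_ger.
  have n0 : (0 < n)%N by rewrite -(ltr0n R); apply: lt_le_trans n1.
  have XE : X <= ln (ln n%:R).
    have lX : expR X <= ln n%:R by near: n; exact: near_ln_ge.
    rewrite -[X]expRK ler_ln ?posrE ?expR_gt0//.
    by apply: lt_le_trans l1.
  have dz : delta n <= zeta.
    by near: n; exact: (cvgr_le (0 : R) delta_cvg0).
  have y36 : 36 <= expR (beta * ln n%:R) by near: n; exact: near_expR_ln_ge.
  have b0 : (0 < b n)%N.
    have /rounds_bounds/andP[] := b_round n; rewrite powR_expR// => h _.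
    by rewrite -(ltr0n R); move: h y36; clear; lra.
  apply/andP; split.
    apply: (@le_trans _ _ ((P n 1%:M [set t | hc_rejects a (inv_cholesky 1%:M *m Z n 1%:M t)] +
      P n 1%:M [set t | ~ hc_rejects a (inv_cholesky 1%:M *m (mu n 1%:M t + Z n 1%:M t))])%E)).
      by rewrite adde_ge0.
    apply: ereal_sup_ubound; exists 1%:M => //.
    by apply: Theta_star1 => //; exact: ltW.
  apply: ge_ereal_sup => _ [S hS <-].
  have [[pS diag1] _] := hS; have cS : correlation_mx S by [].
  have gZ := Z_gaussian n S cS; have smu := mu_signal n S cS.
  rewrite !prE; last 2 first.
  - apply: measurableC; apply: measurable_hc_rejects_linear => j.
    under eq_fun do rewrite mxE.
    apply: measurable_funD; first exact: measurable_sparse_signal smu.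
    exact: measurable_centered_gaussian gZ.
  - apply: measurable_hc_rejects_linear => j; exact: measurable_centered_gaussian gZ.
  rewrite -EFinD lee_fin mulr_natl mulr2n; apply: lerD.
    apply: null => //; [by apply: lt_le_trans n1; rewrite ltr1n|by apply: lt_le_trans l1; rewrite ltr1n|].
    exact: whitened_std_gaussian.
  apply: (alt (m n) (b n) (delta n)) => //; first by rewrite dz ltW.
  exact: mu_Z_indep.
apply/fine_cvgP; split.
  have := key 1; rewrite ltr01 lexx => /(_ isT); apply: filterS => n /andP[h1 h2].
  by rewrite fin_numElt (lt_le_trans _ h1) ?ltNyr// (le_lt_trans h2) ?ltry.
apply/cvgrPdist_le => e e0.
pose eps := Num.min 1 (e / 2).
have eps01 : 0 < eps <= 1 by rewrite lt_min ltr01 divr_gt0//= ge_min lexx.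
have epse : 2 * eps <= e by rewrite mulrC -ler_pdivlMr// ge_min lexx orbT.
have := key eps eps01; apply: filterS => n /andP[h1 h2].
rewrite sub0r normrN /=; move: h1 h2; case: (u n) => [v| |]//=.
by rewrite !lee_fin => v0 v2; rewrite ger0_norm// (le_trans v2).
Unshelve. all: by end_near. Qed.
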